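(* Let $d\ge1$ and $k\in\mathbb{Z}$, let $\chi$ be a multiplicative character on the residue classes of $\mathbb{Z}[i]$ modulo $4d$, and put $\psi(z)=\chi(z)(z/|z|)^k$. Define for $n\ge1$ $$\lambda(n)=\sum_{\substack{z\in\mathbb{Z}[i],\ z\bar z=n\\ z \text{ primary}}}\psi(z)[z].$$ Then for every integer $c\ge1$ and every $x\ge 2$, $$\sum_{n\le x}\Lambda(n)\lambda(cn)\ll c\, f\, x^{76/77},\qquad f=d(|k|+1),$$ where the implied constant is absolute.
   Context: A Gaussian integer $z=r+is$ is called primary if $z\equiv 1 \pmod{2(1+i)}$, i.e. $r$ is odd and $s\equiv r-1\pmod 4$. For $z=r+is\equiv 1\pmod 2$ (i.e. $r$ odd, $s$ even) the Jacobi–Kubota symbol is $[z]=i^{(r-1)/2}\big(\frac{s}{|r|}\big)$, where $\big(\frac{s}{|r|}\big)$ is the Jacobi symbol. A character $\chi$ modulo $4d$ on $\mathbb{Z}[i]$ is a homomorphism $(\mathbb{Z}[i]/4d\mathbb{Z}[i])^*\to\mathbb{C}^*$, extended by $0$ to $z$ not coprime to $4d$. $\Lambda$ is the von Mangoldt function. *)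

(* Defs.v *)
From HB Require Import structures.
From mathcomp Require Import all_boot all_order all_algebra.
From mathcomp Require Import all_classical all_reals exp.
From mathcomp Require Export complex.

Set Implicit Arguments.
Unset Strict Implicit.
Unset Printing Implicit Defensive.

Import Order.TTheory GRing.Theory Num.Theory.
Local Open Scope classical_set_scope.
Local Open Scope ring_scope.
Local Open Scope complex_scope.

(* Z[i]: pairs r +i* s of integers, with the library's addition and
   multiplication of F[i], which it declares a ring only over a field F. *)
Definition gaussInt : Type := int[i].

HB.instance Definition _ := Choice.on gaussInt.
HB.instance Definition _ := GRing.Zmodule.on gaussInt.

Fact gaussInt_mul1 : left_id (1 +i* 0) (@ComplexField.mulc int).
Proof. by move=> [a b] /=; rewrite !mul1r !mul0r subr0 addr0. Qed.

Fact gaussInt_mulDl : left_distributive (@ComplexField.mulc int) +%R.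
Proof.
move=> [a b] [c d] [e f] /=; rewrite !mulrDl opprD.
by congr (_ +i* _); rewrite -!addrA; congr (_ + _); rewrite addrCA.
Qed.

Fact gaussInt_1neq0 : (1 +i* 0 : gaussInt) != 0.
Proof. by []. Qed.

HB.instance Definition _ := GRing.Zmodule_isComNzRing.Build gaussInt
  (@ComplexField.mulcA int) (@ComplexField.mulcC int)
  gaussInt_mul1 gaussInt_mulDl gaussInt_1neq0.

Definition gconj (z : gaussInt) : gaussInt := let: r +i* s := z in r -i* s.

Definition gcong (m z w : gaussInt) : Prop := exists q, z - w = m * q.

Definition primary (z : gaussInt) : Prop :=
  gcong (2 * (1 + (0 +i* 1 : gaussInt))) z 1.

Definition gcoprime (z m : gaussInt) : Prop := exists w, gcong m (z * w) 1.

Definition gaussInt_to_complex (R : realType) (z : gaussInt) : R[i] :=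
  let: r +i* s := z in r%:~R +i* s%:~R.

(* A homomorphism (Z[i]/m)^* -> C^*, extended by 0, read on Z[i]. *)
Record gauss_character (R : realType) (m : gaussInt) (chi : gaussInt -> R[i]) :
    Prop := GaussCharacter {
  gauss_character_cong z w : gcong m z w -> chi z = chi w;
  gauss_characterM z w :
    gcoprime z m -> gcoprime w m -> chi (z * w) = chi z * chi w;
  gauss_character_neq0 z : gcoprime z m -> chi z != 0;
  gauss_character_eq0 z : ~ gcoprime z m -> chi z = 0 }.

Definition legendre (a : int) (p : nat) : int :=
  if (p %| a)%Z then 0
  else if [exists b : 'I_p, (p %| (b%:Z) ^+ 2 - a)%Z] then 1 else -1.

(* Meaningful for odd n > 0; equal to 1 for n = 1. *)
Definition jacobi (a : int) (n : nat) : int :=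
  \prod_(p <- primes n) legendre a p ^+ logn p n.

(* Meaningful for r odd and s even; the exponent may be negative. *)
Definition jacobi_kubota (R : realType) (z : gaussInt) : R[i] :=
  let: r +i* s := z in
  ('i%C : R[i]) ^ ((r - 1) %/ 2)%Z * (jacobi s `|r|%N)%:~R.

Section Lambda.
Variables (R : realType) (chi : gaussInt -> R[i]) (k : int).

Definition psi (z : gaussInt) : R[i] :=
  chi z * (gaussInt_to_complex R z / `|gaussInt_to_complex R z|) ^ k.

Definition lambda (n : nat) : R[i] :=
  \sum_(z \in [set z : gaussInt | z * gconj z = n%:R /\ primary z])
     psi z * jacobi_kubota R z.

End Lambda.

(* primes n is a singleton exactly when n is a positive power of a prime. *)
Definition von_mangoldt (R : realType) (n : nat) : R :=
  if primes n is [:: p] then ln p%:R else 0.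

(* Main.v *)
From HB Require Import structures.
Require Import Defs.
From mathcomp Require Import all_boot all_order all_algebra.
From mathcomp Require Import all_classical all_reals exp.
From mathcomp Require Import finfield.
From mathcomp Require Import zify ring lra.

(* Multiplying out, [lambda (m * n)] is the sum of [psi (w * z) [w z]] over
   primary [w] and [z] of norms [m] and [n], because the symbol vanishes at
   non-primitive elements.  Vaughan's identity therefore reduces the theorem to
   sums over [z] for a single [w] (type I) and to bilinear sums over [w] and [z]
   with arbitrary coefficients (type II).

   Let [w = u + iv], [z = a + ib], [r = Re (w z)] and [q] the norm of [w].
   Quadratic reciprocity factors the symbol [w z] as (v/|u|) (b/|a|) (r/q) times
   a phase which depends only on [b] and on the signs and the residues mod 8 of
   [u], [a], [r].  The kernel K(w, z) = (r/q) satisfies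
   K(w, x) K(w, z) = (u/q) K(w, x z), so a power of a sum over [z] is again a
   single sum, over a longer range; Cauchy's inequality then leads to complete
   sums of (r1/q1) (r2/q2), which vanish unless [q1 q2] is a square.  Type I sums
   are treated in the same way with the kernel (b/|a|), summing over [b] for each
   [a].  All other factors linking the two variables (truncations, the sign of
   [r], the angle of [z]) are periodic, slowly varying, or indicators of a chain
   of sets; they are removed by sorting the outer variable into few classes, on
   each of which such a factor hardly changes.

   For X about t^77 a saving of nearly t is needed.  Type I sums give it for
   m <= t^9; type II sums for t^9 <= m <= t^39, using second moments up to t^20
   and sixth moments beyond.  Some powers of log and of divisor functions have to
   be absorbed, so the saving is t^(n0 + 20) for X about t^(77 n0) with [n0]
   large.  If c d (|k| + 1) exceeds t^(n0 + 5), then the divisor bound is enough. *)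

(** Why two moments occur. For outer norms [c * m] with [m <= M] and inner norms up to [N], the
    power [2 * kap] of the sum over [z] runs over a box of side about [N ^ kap]. To save [T], pairs
    with [m1 * m2] a square are harmless once [M >= T ^ (4 * kap + 4)]; the other pairs, whose
    complete sums have period up to [(c * M) ^ 2], are harmless once [N ^ kap >= T ^ (4 * kap + 4) *
    M ^ 2 * c ^ 2], both up to powers of [D]. Raising [kap] extends the range of [M] upwards but
    also raises its lower end: with [T] about [t], [kap = 1] starts at [t^8] and stops near [t^22],
    while [kap = 3] starts at [t^16] and passes the square root of [X]. The classes of the outer
    variable cost little because the moment bounds hold for arbitrary bounded coefficients: they may
    be summed over all classes, and the number of classes then multiplies only the high-moment term.
    The number [n0] acts as an inverse epsilon: [D = t^2] bounds logarithms and divisor functions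
    when [X] is about [t^(77 * n0)]. All conditions hold with room proportional to [n0], which is
    how powers of [D] disappear and the exponent [76/77] is reached exactly. *)

Set Implicit Arguments.
Unset Strict Implicit.
Unset Printing Implicit Defensive.

Import Order.TTheory GRing.Theory Num.Theory.
Local Open Scope ring_scope.

(** * The Jacobi symbol *)

Section Legendre.
Variables (p : nat) (p_pr : prime p) (p_odd : odd p).
Let m := p./2.

Lemma Fp_int_eq0 (a : int) : ((a%:~R : 'F_p) == 0) = (p %| a)%Z.
Proof. by rewrite -(dvdz_pcharf (pchar_Fp p_pr)). Qed.

Lemma Fp_nat_eq0 (a : nat) : ((a%:R : 'F_p) == 0) = (p %| a)%N.
Proof. by rewrite -(dvdn_pcharf (pchar_Fp p_pr)). Qed.

Lemma p_half : p = m.*2.+1.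
Proof. by rewrite -[LHS]odd_double_half p_odd. Qed.

(** These squares already exhaust the roots of ['X^m - 1]; in [Fp_euler] a nonsquare root would be
    one too many. *)
Lemma Fp_sqr_roots : uniq [seq (i%:R ^+ 2 : 'F_p) | i <- iota 1 m].
Proof.
rewrite map_inj_in_uniq ?iota_uniq // => i j; rewrite !mem_iota => Hi Hj.
have ph := p_half.
move/eqP; rewrite -subr_eq0 subr_sqr mulf_eq0 => /orP [] H.
- wlog lij : i j Hi Hj H / (j <= i)%N.
    move=> W; case: (leqP j i) => [?|/ltnW ?]; first exact: W.
    by apply/esym/W => //; rewrite -opprB oppr_eq0.
  move: H; rewrite -natrB // Fp_nat_eq0 => /dvdnP [[|k] E]; first lia.
  by exfalso; nia.
- by move: H; rewrite -natrD Fp_nat_eq0 => /dvdnP [[|k] E]; nia.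
Qed.

Lemma Fp_expr_pred (x : 'F_p) : x != 0 -> x ^+ m.*2 = 1.
Proof.
move=> nx; have := @expf_card 'F_p x; rewrite card_Fp // => E.
have : x ^+ m.*2.+1 = x by rewrite -p_half.
by rewrite exprS -[RHS]mulr1 => /(mulfI nx).
Qed.

Lemma Fp_euler (x : 'F_p) : x != 0 ->
  x ^+ m = (if [exists y : 'F_p, y ^+ 2 == x] then 1 else -1).
Proof.
move=> nx; case: existsP => [[y /eqP yx]|nsq].
  rewrite -yx -exprM mul2n Fp_expr_pred //.
  by apply: contraNneq nx => y0; rewrite -yx y0 expr0n.
have : x ^+ m ^+ 2 == 1 by rewrite -exprM muln2 Fp_expr_pred.
rewrite sqrf_eq1 => /orP [/eqP xm|/eqP //].
have m_gt0 : (0 < m)%N by have := prime_gt1 p_pr; have := p_half; lia.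
(* A nonsquare [x] with [x ^+ m = 1] would give [m + 1] distinct roots of a polynomial of degree
   [m]. *)
have := @max_poly_roots 'F_p ('X^m - 1)
  (x :: [seq (i%:R ^+ 2 : 'F_p) | i <- iota 1 m]).
rewrite size_XnsubC // /= size_map size_iota ltnn => H; suff: false by [].
apply: H.
- by rewrite -size_poly_eq0 size_XnsubC.
- rewrite rootE !hornerE xm subrr eqxx /= all_map; apply/allP => i.
  rewrite mem_iota => Hi /=; rewrite rootE !hornerE -exprM mul2n.
  rewrite Fp_expr_pred ?subrr // Fp_nat_eq0.
  by apply/negP => /dvdn_leq; have := p_half; lia.
rewrite Fp_sqr_roots andbT; apply/seq.mapP => -[i _ E]; apply: nsq.
by exists i%:R; rewrite E.
Qed.

Lemma legendre_euler (a : int) : (legendre a p)%:~R = (a%:~R : 'F_p) ^+ m.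
Proof.
have m_gt0 : (0 < m)%N by have := prime_gt1 p_pr; have := p_half; lia.
rewrite /legendre; case: ifPn => [pa|npa].
  have /eqP -> : (a%:~R : 'F_p) == 0 by rewrite Fp_int_eq0.
  by rewrite expr0n; case: m m_gt0.
rewrite Fp_euler ?Fp_int_eq0 //.
have -> : [exists b : 'I_p, (p %| b%:Z ^+ 2 - a)%Z]
        = [exists y : 'F_p, y ^+ 2 == a%:~R].
  apply/existsP/existsP => [[b H]|[y H]].
    exists (b%:R); rewrite -subr_eq0 -[(b : nat)%:R]/(((b : nat)%:Z)%:~R : 'F_p).
    by rewrite -rmorphXn -rmorphB Fp_int_eq0.
  have yp : (y < p)%N by have := ltn_ord y; rewrite [X in (_ < X)%N -> _]Fp_cast.
  exists (Ordinal yp); rewrite -Fp_int_eq0 rmorphB rmorphXn /=.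
  by rewrite subr_eq0 -[_%:~R]/((y : nat)%:R) natr_Zp.
by case: existsP.
Qed.

Lemma legendre_cases (a : int) :
  [\/ legendre a p = 0, legendre a p = 1 | legendre a p = -1].
Proof.
rewrite /legendre; case: ifP => _; first by constructor 1.
by case: ifP => _; [constructor 2 | constructor 3].
Qed.

Lemma Fp_1_neqN1 : (1 : 'F_p) != -1.
Proof.
rewrite -subr_eq0 opprK -[1 + 1]/(2%:R) Fp_nat_eq0.
by apply/negP => /dvdn_leq; have := prime_gt1 p_pr; have := p_half; lia.
Qed.

(** As [p] is odd, 0, 1 and -1 stay distinct in ['F_p]; identities between symbols can thus be
    checked there, through Euler's criterion. *)
Lemma sign_inj_Fp (a b : int) :
  [\/ a = 0, a = 1 | a = -1] -> [\/ b = 0, b = 1 | b = -1] ->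
  (a%:~R : 'F_p) = b%:~R -> a = b.
Proof.
have n0 : (1 : 'F_p) != 0 by rewrite oner_eq0.
have n1 := Fp_1_neqN1.
by case=> ->; case=> -> //= /eqP;
  rewrite ?rmorphN ?rmorph1 ?rmorph0 //= ?[0 == _]eq_sym ?oppr_eq0
    ?(negPf n0) ?(negPf n1) // eq_sym (negPf n1).
Qed.

Lemma legendreM (a b : int) : legendre (a * b) p = legendre a p * legendre b p.
Proof.
apply: sign_inj_Fp.
- exact: legendre_cases.
- by case: (legendre_cases a) => ->; case: (legendre_cases b) => ->;
    rewrite ?mul0r ?mulr0 ?mul1r ?mulr1 ?mulrNN ?mulr1;
    (try by constructor 1); (try by constructor 2); constructor 3.
- by rewrite rmorphM /= !legendre_euler rmorphM exprMn.
Qed.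

Lemma legendre_modP (a b : int) : (p %| a - b)%Z -> legendre a p = legendre b p.
Proof.
move=> H; apply: sign_inj_Fp; try exact: legendre_cases.
rewrite !legendre_euler; congr (_ ^+ _); apply/eqP.
by rewrite -subr_eq0 -rmorphB Fp_int_eq0.
Qed.

Lemma legendre_eq0 (a : int) : (legendre a p == 0) = (p %| a)%Z.
Proof. by rewrite /legendre; case: ifP => // _; case: ifP. Qed.

Lemma legendreN1 : legendre (-1) p = (-1) ^+ m.
Proof.
apply: sign_inj_Fp.
- exact: legendre_cases.
- by rewrite -signr_odd; case: odd; [constructor 3 | constructor 2].
- by rewrite legendre_euler rmorphXn rmorphN rmorph1.
Qed.

(** * Gauss's lemma: [ares i] is the least absolute residue of [a * i], and [eps i] its sign *)

Section Gauss.
Variables (a : nat) (npa : ~~ (p %| a)%N).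
Let res i := ((a * i) %% p)%N.
Let eps i : bool := (m < res i)%N.
Let ares i := if eps i then (p - res i)%N else res i.

(** Equal values at [i] and [j] would make [p] divide [a * (i - j)] or [a * (i + j)]; so the map is
    injective from the half system to itself. *)
Lemma ares_perm : perm_eq [seq ares i | i <- iota 1 m] (iota 1 m).
Proof.
have ph := p_half; have p_gt0 := prime_gt0 p_pr.
have res_lt i : (res i < p)%N by rewrite ltn_mod.
have res_gt0 i : i \in iota 1 m -> (0 < res i)%N.
  rewrite mem_iota => Hi; rewrite lt0n -/(dvdn p _) Euclid_dvdM // (negPf npa).
  by apply/negP => /dvdn_leq; lia.
have un : uniq [seq ares i | i <- iota 1 m].
  rewrite map_inj_in_uniq ?iota_uniq // => i j Hi Hj E.
  have: (res i = res j)%N \/ (res i + res j = p)%N.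
    have := res_lt i; have := res_lt j; move: E; rewrite /ares /eps.
    move: (res i) (res j) => x y.
    by case: (ltnP m x); case: (ltnP m y); lia.
  move: Hi Hj; rewrite !mem_iota => Hi Hj [] H.
  - have : (a * i == a * j %[mod p])%N by apply/eqP.
    wlog lij : i j {H E} Hi Hj / (j <= i)%N.
      move=> W; case: (leqP j i) => [?|/ltnW ?]; first exact: W.
      by rewrite eq_sym => h; apply/esym/W.
    rewrite eqn_mod_dvd ?leq_mul2l ?lij ?orbT // -mulnBr Euclid_dvdM //.
    by rewrite (negPf npa) => /dvdnP [[|k] ?]; [lia|nia].
  - have : (p %| a * i + a * j)%N by rewrite /dvdn -modnDm -/(res i) -/(res j) H modnn.
    rewrite -mulnDr Euclid_dvdM // (negPf npa) => /dvdnP [[|k] ?]; first lia.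
    by exfalso; nia.
apply: uniq_perm => //; first exact: iota_uniq.
have sub : {subset [seq ares i | i <- iota 1 m] <= iota 1 m}.
  move=> x /seq.mapP [i Hi ->]; rewrite mem_iota /ares /eps.
  have := res_gt0 _ Hi; have := res_lt i; move: (res i) => y.
  by case: (ltnP m y); lia.
by have [] := uniq_min_size un sub _; rewrite ?size_map.
Qed.

(** The product of all [a * i] is [a ^+ m * P], and by [ares_perm] it is also [P] times the signs;
    [P] cancels. *)
Lemma legendre_gauss :
  legendre a p = (-1) ^+ (\sum_(i <- iota 1 m) eps i).
Proof.
have ph := p_half; have p_gt0 := prime_gt0 p_pr.
apply: sign_inj_Fp.
- exact: legendre_cases.
- by rewrite -signr_odd; case: odd; [constructor 3 | constructor 2].
rewrite legendre_euler rmorphXn rmorphN rmorph1 /=.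
pose P : 'F_p := \prod_(i <- iota 1 m) i%:R.
have nP : P != 0.
  rewrite prodf_seq_neq0; apply/allP => i; rewrite mem_iota => Hi.
  by rewrite Fp_nat_eq0; apply/negP => /dvdn_leq; lia.
apply: (mulIf nP).
have -> : (a%:~R ^+ m * P : 'F_p) = \prod_(i <- iota 1 m) (a * i)%:R.
  under eq_bigr do rewrite natrM.
  by rewrite big_split /= big_const_seq count_predT size_iota iter_mulr_1.
have -> : P = \prod_(i <- iota 1 m) (ares i)%:R.
  by rewrite -(big_map ares predT (fun i => i%:R)) (perm_big _ ares_perm).
rewrite -prodrXr -big_split /=; apply: eq_bigr => i _.
have -> : ((a * i)%:R : 'F_p) = (res i)%:R.
  by rewrite {1}(divn_eq (a * i) p) natrD natrM (pcharf0 (pchar_Fp p_pr)) mulr0 add0r.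
rewrite /ares; case: (eps i); last by rewrite expr0 mul1r.
rewrite expr1 mulN1r natrB; last by rewrite ltnW // ltn_mod.
by rewrite (pcharf0 (pchar_Fp p_pr)) sub0r opprK.
Qed.

(** Eisenstein's form. Modulo 2, [i] is [a * i], which is the quotient plus the residue since [p] is
    odd, and the residue is [ares i + eps i]. The sums of [i] and of [ares i] agree and cancel. *)
Lemma gauss_parity : odd a ->
  odd (\sum_(i <- iota 1 m) eps i) = odd (\sum_(i <- iota 1 m) (a * i %/ p))%N.
Proof.
move=> oa; have ph := p_half; have p_gt0 := prime_gt0 p_pr.
have E : odd (\sum_(i <- iota 1 m) i) = odd (\sum_(i <- iota 1 m)
     (a * i %/ p + (ares i + eps i)))%N.
  have od (f g : nat -> nat) : (forall i, odd (f i) = odd (g i)) ->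
      odd (\sum_(i <- iota 1 m) f i) = odd (\sum_(i <- iota 1 m) g i).
    move=> fg; elim: (iota 1 m) => [|x s IH]; first by rewrite !big_nil.
    by rewrite !big_cons !oddD IH fg.
  apply: od => i.
  have H : odd (a * i)%N = odd i by rewrite oddM oa.
  rewrite -H {1}(divn_eq (a * i) p) !oddD oddM p_odd andbT; congr (_ (+) _).
  rewrite -/(res i) /ares /eps; case: ltnP => _; last by rewrite addbF.
  rewrite oddB; last by rewrite ltnW // ltn_mod.
  by rewrite p_odd /=; case: (odd (res i)).
move: E; rewrite !big_split /= !oddD.
have -> : (\sum_(i <- iota 1 m) ares i = \sum_(i <- iota 1 m) i)%N.
  by rewrite -(big_map ares predT id) (perm_big _ ares_perm).
by case: (odd _); case: (odd _); case: (odd _).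
Qed.
End Gauss.

(** For [i <= m] the number [2 * i] is its own residue, and it exceeds [m] exactly when
    [i > m./2]. *)
Lemma legendre2 : legendre 2 p = (-1) ^+ (m - m./2)%N.
Proof.
have ph := p_half.
rewrite (legendre_gauss (a := 2)); last first.
  by apply/negP => /dvdn_leq; have := prime_gt1 p_pr; lia.
congr (_ ^+ _).
rewrite (eq_big_seq (fun i => if (m./2 < i)%N then 1 else 0)%N); last first.
  move=> i; rewrite mem_iota => Hi; rewrite modn_small; last lia.
  by case: (ltnP m _); case: (ltnP m./2 i); lia.
rewrite -big_mkcond sum1_count -(subnKC (_ : m./2 <= m)%N); last lia.
rewrite iotaD count_cat.
rewrite (eq_in_count (a2 := pred0)); last by move=> i; rewrite mem_iota /=; lia.
rewrite count_pred0 (eq_in_count (a2 := predT)); last by move=> i; rewrite mem_iota /=; lia.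
by rewrite count_predT size_iota; lia.
Qed.

End Legendre.

(** Each sum counts the lattice points on one side of the diagonal of the rectangle [p./2] by
    [q./2]; by coprimality none lies on it. *)
Lemma floor_sum (p q : nat) : odd p -> odd q -> coprime p q ->
  ((\sum_(i <- iota 1 p./2) (q * i %/ p)) + (\sum_(j <- iota 1 q./2) (p * j %/ q))
    = p./2 * q./2)%N.
Proof.
have key (a b : nat) : odd a -> odd b -> coprime a b ->
  (\sum_(i <- iota 1 a./2) (b * i %/ a) =
   \sum_(i <- iota 1 a./2) \sum_(j <- iota 1 b./2) (a * j < b * i)%N)%N.
  move=> oa ob cab; apply: eq_big_seq => i; rewrite mem_iota => Hi.
  have a_gt0 : (0 < a)%N by case: a oa {cab Hi}.
  have ha : a = a./2.*2.+1 by rewrite -[LHS]odd_double_half oa.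
  have hb : b = b./2.*2.+1 by rewrite -[LHS]odd_double_half ob.
  rewrite (eq_big_seq (fun j => if (j <= b * i %/ a)%N then 1 else 0)%N); last first.
    move=> j; rewrite mem_iota => Hj; rewrite leq_divRL // ltn_neqAle mulnC.
    rewrite (_ : (j * a != b * i)%N) //; apply/negP => /eqP E.
    have : (a %| b * i)%N by rewrite -E dvdn_mull.
    by rewrite Gauss_dvdr // => /dvdn_leq; lia.
  rewrite -big_mkcond sum1_count.
  have le : (b * i %/ a <= b./2)%N.
    have : (b * i %/ a * a <= b * i)%N by exact: leq_divM.
    nia.
  rewrite -(subnKC le) iotaD count_cat.
  rewrite (eq_in_count (a2 := predT)); last by move=> j; rewrite mem_iota /=; lia.
  rewrite count_predT size_iota (eq_in_count (a2 := pred0)) ?count_pred0 ?addn0 //.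
  by move=> j; rewrite mem_iota /=; lia.
move=> op oq cpq; rewrite key // key //; last by rewrite coprime_sym.
rewrite [X in (_ + X)%N]exchange_big /= -big_split /=.
rewrite (eq_big_seq (fun=> q./2)); last first.
  move=> i; rewrite mem_iota => Hi; rewrite -big_split /=.
  rewrite (eq_big_seq (fun=> 1%N)) ?sum1_size ?size_iota // => j; rewrite mem_iota => Hj.
  case: ltngtP => // E; exfalso.
  have : (p %| q * i)%N by rewrite -E dvdn_mulr.
  have hp : p = p./2.*2.+1 by rewrite -[LHS]odd_double_half op.
  by rewrite Gauss_dvdr // => /dvdn_leq; lia.
by rewrite big_const_seq count_predT size_iota iter_addn_0 mulnC.
Qed.

Lemma legendre_reciprocity (p q : nat) : prime p -> prime q -> odd p -> odd q ->
  p != q -> legendre p q * legendre q p = (-1) ^+ (p./2 * q./2)%N.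
Proof.
move=> pp pq op oq npq.
have cpq : coprime p q by rewrite prime_coprime // dvdn_prime2.
have nq : ~~ (q %| p)%N by rewrite dvdn_prime2 // eq_sym.
have np : ~~ (p %| q)%N by rewrite dvdn_prime2.
rewrite (legendre_gauss pp op np) (legendre_gauss pq oq nq) -exprD -[LHS]signr_odd oddD.
rewrite (gauss_parity pp) // (gauss_parity pq) //.
by rewrite -oddD signr_odd addnC floor_sum.
Qed.

(** * Jacobi symbols *)

Lemma prod_logn_eq (R : comNzRingType) (f : nat -> R) (n : nat) (s : seq nat) :
  uniq s -> {subset primes n <= s} ->
  \prod_(p <- primes n) f p ^+ logn p n = \prod_(p <- s) f p ^+ logn p n.
Proof.
move=> us sub.
have -> : \prod_(p <- s) f p ^+ logn p n
        = \prod_(p <- s | p \in primes n) f p ^+ logn p n.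
  rewrite [RHS]big_mkcond; apply: eq_bigr => p _; case: ifPn => // np.
  by move: np; rewrite -logn_gt0 lt0n negbK => /eqP ->; rewrite expr0.
have pe : perm_eq (primes n) [seq p <- s | p \in primes n]; last first.
  by rewrite -[RHS]big_filter (perm_big _ pe).
apply: uniq_perm; [exact: primes_uniq|exact: filter_uniq|].
by move=> p; rewrite mem_filter; case Hp : (p \in primes n) => //=; rewrite (sub _ Hp).
Qed.

Lemma jacobi_n1 (a : int) : jacobi a 1 = 1.
Proof. by rewrite /jacobi big_nil. Qed.

Lemma jacobiMr (a : int) (m n : nat) : (0 < m)%N -> (0 < n)%N ->
  jacobi a (m * n) = jacobi a m * jacobi a n.
Proof.
move=> m0 n0; rewrite /jacobi.
pose s := primes (m * n).
have us : uniq s by exact: primes_uniq.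
have sm : {subset primes m <= s} by move=> p Hp; rewrite /s primesM // Hp.
have sn : {subset primes n <= s} by move=> p Hp; rewrite /s primesM // Hp orbT.
rewrite (prod_logn_eq _ us sm) (prod_logn_eq _ us sn) -big_split /=.
by apply: eq_bigr => p _; rewrite lognM // exprD.
Qed.

Lemma odd_prime_dvd (n p : nat) : odd n -> p \in primes n -> prime p /\ odd p.
Proof.
rewrite mem_primes => on /and3P [pp n0 pn]; split=> //.
by apply: dvdn_odd on.
Qed.

Lemma jacobiMl (a b : int) (n : nat) : odd n ->
  jacobi (a * b) n = jacobi a n * jacobi b n.
Proof.
move=> on; rewrite /jacobi -big_split /=.
apply: eq_big_seq => p /(odd_prime_dvd on) [pp op].
by rewrite legendreM // exprMn.
Qed.

Lemma jacobi_modP (a b : int) (n : nat) : odd n -> (n %| a - b)%Z ->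
  jacobi a n = jacobi b n.
Proof.
move=> on nab; apply: eq_big_seq => p Hp.
have [pp op] := odd_prime_dvd on Hp.
rewrite (legendre_modP pp op (b := b)) //; apply: dvdz_trans nab.
by move: Hp; rewrite mem_primes => /and3P [].
Qed.

Lemma jacobi_eq0 (a : int) (n : nat) : odd n ->
  (jacobi a n == 0) = ~~ coprime `|a| n.
Proof.
move=> on; have n0 : (0 < n)%N by case: n on.
rewrite /jacobi; apply/idP/idP.
  rewrite prodf_seq_eq0 => /hasP [p Hp /=].
  have [pp op] := odd_prime_dvd on Hp.
  rewrite expf_eq0 => /andP [_]; rewrite legendre_eq0 // => pa.
  apply/negP => /(coprime_dvdl pa); rewrite prime_coprime //.
  by move: Hp; rewrite mem_primes => /and3P [_ _ ->].
move=> nc; have g1 : (1 < gcdn `|a| n)%N.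
  by rewrite ltn_neqAle eq_sym nc gcdn_gt0 n0 orbT.
have pp := pdiv_prime g1; have pg := pdiv_dvd (gcdn `|a| n).
set p := pdiv _ in pp pg.
have pn : p \in primes n.
  by rewrite mem_primes pp n0 (dvdn_trans pg) // dvdn_gcdr.
have [_ op] := odd_prime_dvd on pn.
rewrite (bigD1_seq p) //= ?primes_uniq // mulf_eq0 expf_eq0 logn_gt0 pn /=.
rewrite legendre_eq0 // (_ : (p %| a)%Z) //.
by apply: (dvdn_trans pg); rewrite dvdn_gcdl.
Qed.

Lemma jacobi_cases (a : int) (n : nat) :
  [\/ jacobi a n = 0, jacobi a n = 1 | jacobi a n = -1].
Proof.
rewrite /jacobi; elim: (primes n) => [|p s IH].
  by rewrite big_nil; constructor 2.
rewrite big_cons; elim: (logn p n) => [|k]; first by rewrite expr0 mul1r.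
rewrite exprS -mulrA; move: (_ * \prod_(_ <- _) _) => x.
have := legendre_cases p a.
by case=> ->; case=> ->;
    rewrite ?mul0r ?mulr0 ?mul1r ?mulr1 ?mulrNN ?mulr1;
    (try by constructor 1); (try by constructor 2); constructor 3.
Qed.

Lemma jacobi_sqr (a : int) (n : nat) : odd n -> coprime `|a| n ->
  jacobi a n * jacobi a n = 1.
Proof.
move=> on c; have := jacobi_eq0 a on; rewrite c /=.
by have := jacobi_cases a n; case=> ->; rewrite ?eqxx //= ?mulr1 ?mulrNN.
Qed.

Lemma jacobi1l (n : nat) : odd n -> jacobi 1 n = 1.
Proof.
move=> on; have := @jacobi_sqr 1 n on (coprime1n n).
by rewrite -jacobiMl // mulr1.
Qed.

Lemma jacobi_norm_le1 (a : int) (n : nat) : `|jacobi a n| <= 1.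
Proof. by have := jacobi_cases a n; case=> ->. Qed.

Lemma odd_prime_ind (P : nat -> Prop) : P 1%N ->
  (forall p n, prime p -> odd p -> odd n -> P n -> P (p * n)%N) ->
  forall n, odd n -> P n.
Proof.
move=> P1 PM n; have [k] := ubnP n; elim: k n => // k IH n lt on.
have [n1|n1] := leqP n 1; first by have -> : n = 1%N by case: n on n1 {lt} => [|[]].
have pp := pdiv_prime n1; have /dvdnP [m E] := pdiv_dvd n.
move: pp E; set p := pdiv n => pp E.
have [om op] : odd m /\ odd p by move: on; rewrite E oddM => /andP.
have p1 := prime_gt1 pp.
rewrite E mulnC; apply: PM => //; apply: IH => //.
have : (0 < m)%N by case: (m) om.
nia.
Qed.

Lemma jacobi_prime (a : int) (p : nat) : prime p -> jacobi a p = legendre a p.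
Proof. by move=> pp; rewrite /jacobi primes_prime // big_seq1 logn_prime // eqxx expr1. Qed.

Lemma jacobiN1 (n : nat) : odd n -> jacobi (-1) n = (-1) ^+ n./2.
Proof.
elim/odd_prime_ind: n / => [|p n pp op on IH]; first by rewrite jacobi_n1.
rewrite jacobiMr ?(prime_gt0 pp) ?odd_gt0 //.
rewrite IH jacobi_prime // legendreN1 // -exprD -[LHS]signr_odd -[RHS]signr_odd.
congr (_ ^+ nat_of_bool _).
have := odd_double_half n; have := odd_double_half p; rewrite on op => <- <-.
move: (p./2) (n./2) => x y; rewrite !oddD.
have -> : ((true + x.*2) * (true + y.*2) = true + (x + y + x * y.*2).*2)%N by lia.
by lia.
Qed.

Lemma jacobi2 (n : nat) : odd n -> jacobi 2 n = (-1) ^+ ((n %% 8 == 3) || (n %% 8 == 5))%N.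
Proof.
elim/odd_prime_ind: n / => [|p n pp op on IH]; first by rewrite jacobi_n1.
rewrite jacobiMr ?(prime_gt0 pp) ?odd_gt0 //.
rewrite IH jacobi_prime // legendre2 //.
have -> : (-1) ^+ (p./2 - p./2./2)%N = (-1) ^+ ((p %% 8 == 3) || (p %% 8 == 5))%N :> int.
  rewrite -[LHS]signr_odd; congr (_ ^+ nat_of_bool _); lia.
rewrite -signr_addb; congr (_ ^+ nat_of_bool _).
have : (p %% 8 = 1 \/ p %% 8 = 3 \/ p %% 8 = 5 \/ p %% 8 = 7)%N by lia.
have : (n %% 8 = 1 \/ n %% 8 = 3 \/ n %% 8 = 5 \/ n %% 8 = 7)%N by lia.
by rewrite -(modnMm p n 8) => -[->|[->|[->|->]]] [->|[->|[->|->]]].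
Qed.

Lemma jacobi_reciprocity (m n : nat) : odd m -> odd n ->
  jacobi m n = (-1) ^+ (m./2 * n./2)%N * jacobi n m.
Proof.
move=> om on; have [c|nc] := boolP (coprime m n); last first.
  have /eqP -> : jacobi m n == 0 by rewrite jacobi_eq0.
  have /eqP -> : jacobi n m == 0 by rewrite jacobi_eq0 // coprime_sym.
  by rewrite mulr0.
(* For coprime arguments the symbols are signs, so the law follows from this symmetric form, which
   is multiplicative in [m] and in [n]; induction on both reduces it to primes. *)
suff H : jacobi m n * jacobi n m = (-1) ^+ (m./2 * n./2)%N.
  by rewrite -H -mulrA jacobi_sqr ?mulr1 // coprime_sym.
have half (x y : nat) : odd x -> odd y -> odd ((x * y)./2) = odd x./2 (+) odd y./2 by lia.
have step x y z : odd x -> odd y -> odd z ->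
    (-1) ^+ ((x * y)./2 * z./2)%N = (-1) ^+ (x./2 * z./2) * (-1) ^+ (y./2 * z./2) :> int.
  move=> ox oy oz; rewrite -exprD -[LHS]signr_odd -[RHS]signr_odd; congr (_ ^+ nat_of_bool _).
  by rewrite oddD !oddM half //; case: (odd _); case: (odd _); case: (odd _).
elim/odd_prime_ind: m / om c => [|p m pp op om IH] c.
  by rewrite mul0n jacobi_n1 mulr1 jacobi1l.
have [cp cm] : coprime p n /\ coprime m n by move: c; rewrite coprimeMl => /andP.
have m0 : (0 < m)%N by case: (m) om.
have p0 := prime_gt0 pp.
rewrite PoszM jacobiMl // jacobiMr // step // -IH // mulrACA; congr (_ * _).
elim/odd_prime_ind: n / on c cp cm {IH} => [|q n qp oq on IH] c cp cm.
  by rewrite muln0 jacobi_n1 mul1r jacobi1l.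
have n0 : (0 < n)%N by case: (n) on.
have q0 := prime_gt0 qp.
move: c cp cm; rewrite !coprimeMr => /andP [cq cn] /andP [cpq cpn] /andP [cmq cmn].
rewrite PoszM jacobiMl // jacobiMr // mulnC step // ![(_./2 * p./2)%N]mulnC -IH // mulrACA.
congr (_ * _); rewrite !jacobi_prime // legendre_reciprocity //.
by apply: contraTneq cpq => ->; rewrite /coprime gcdnn; case: eqP qp => // ->.
Qed.

Lemma nonsquare_logn (n : nat) : (0 < n)%N -> ~ (exists s, n = s * s)%N ->
  exists2 p, p \in primes n & odd (logn p n).
Proof.
move=> n0 ns; apply/hasP; apply/negPn; rewrite -all_predC; apply/negP => /allP H.
apply: ns; exists (\prod_(p <- primes n) p ^ (logn p n)./2)%N.
rewrite -big_split /= {1}(prod_prime_decomp n0) prime_decompE big_map /=.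
apply: eq_big_seq => p /H /= e.
by rewrite -expnD addnn even_halfK.
Qed.

(** Otherwise Euler's criterion would make all [p - 1] nonzero residues roots of ['X^(p./2) - 1]. *)
Lemma legendre_nonresidue (p : nat) : prime p -> odd p ->
  exists2 a : nat, (0 < a)%N & legendre a p = -1.
Proof.
move=> pp op; have ph := p_half op; have p1 := prime_gt1 pp.
pose s := [seq (i%:R : 'F_p) | i <- iota 1 p.-1].
have us : uniq s.
  rewrite map_inj_in_uniq ?iota_uniq // => i j; rewrite !mem_iota => Hi Hj E.
  have : ((i%:R : 'F_p) : nat) = ((j%:R : 'F_p) : nat) by rewrite E.
  by rewrite !val_Fp_nat // !modn_small //; lia.
have [/existsP [i /eqP E]|/existsPn H] := boolP [exists i : 'I_p, legendre i p == -1].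
  exists i => //; rewrite lt0n; apply: contra_eqN E => /eqP ->.
  by rewrite /legendre dvdz0.
have := @max_poly_roots 'F_p ('X^(p./2) - 1) s.
rewrite size_XnsubC; last lia.
move=> W; suff: false by [].
have {W} : (size s < p./2.+1)%N.
  apply: W us; first by rewrite -size_poly_eq0 size_XnsubC //; lia.
  rewrite all_map; apply/allP => i Hi /=; rewrite rootE !hornerE.
  rewrite -[(i : nat)%:R]/((i : int)%:~R : 'F_p) -legendre_euler //.
  move: Hi; rewrite mem_iota => Hi.
  have ip : (i < p)%N by lia.
  have := H (Ordinal ip); rewrite /=.
  case: (legendre_cases p i) => L; rewrite L ?subrr ?eqxx //.
  have := legendre_eq0 p i; rewrite L eqxx => /esym /dvdn_leq /=; lia.
by rewrite size_map size_iota; lia.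
Qed.

(** Chinese remainders: take a nonresidue modulo a prime of odd exponent [e] in [n], and 1 modulo
    the rest, so that the symbol is [(-1) ^+ e]. Scaling by such an [a] makes complete sums
    vanish. *)
Lemma jacobi_nonresidue (n : nat) : odd n -> ~ (exists s, n = s * s)%N ->
  exists a : nat, coprime a n /\ jacobi a n = -1.
Proof.
move=> on ns; have n0 := odd_gt0 on.
have [p pn ol] := nonsquare_logn n0 ns.
have [pp op] := odd_prime_dvd on pn.
have [b b0 lb] := legendre_nonresidue pp op.
have [m cpm E] := pfactor_coprime pp n0.
set e := logn p n in E ol.
have cpem : coprime (p ^ e) m.
  by case: (e) => [|e']; rewrite ?coprime1n ?coprime_pexpl.
have om : odd m by move: on; rewrite E oddM => /andP [].
pose a := chinese (p ^ e) m b 1.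
have e0 : (0 < e)%N by case: (e) ol.
have ap : (p %| a%:Z - b%:Z)%Z.
  apply: (@dvdz_trans (p ^ e)%N%:Z).
    by rewrite dvdzE /=; case: (e) e0 => // e' _; rewrite expnS dvdn_mulr.
  rewrite -eqz_mod_dvd; apply/eqP.
  by rewrite !modz_nat /a (chinese_modl cpem).
have am : (m %| a%:Z - 1%:Z)%Z.
  by rewrite -eqz_mod_dvd; apply/eqP; rewrite !modz_nat /a (chinese_modr cpem).
have jam : jacobi a m = 1 by rewrite (jacobi_modP om am) jacobi1l.
have jap : jacobi a (p ^ e) = -1.
  rewrite /jacobi primesX // primes_prime // big_seq1 lognX logn_prime // eqxx muln1.
  by rewrite (legendre_modP pp op ap) lb -signr_odd ol.
have ja : jacobi a n = -1.
  have -> : jacobi a n = jacobi a (m * p ^ e)%N by rewrite -E.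
  by rewrite jacobiMr ?expn_gt0 ?(prime_gt0 pp) ?odd_gt0 // jam jap mul1r.
exists a; split=> //.
by have := jacobi_eq0 a on; rewrite ja /= => /esym/negbFE.
Qed.

(** * The Jacobi-Kubota symbol of a product *)

Definition mod4_3 (x : int) : bool := (x %% 4)%Z == 3.
Definition mod8_35 (x : int) : bool := ((x %% 8)%Z == 3) || ((x %% 8)%Z == 5).
(* Product of the Hilbert symbols at 2 (for odd arguments) and at infinity. *)
Definition hilb (x y : int) : bool :=
  (mod4_3 x && mod4_3 y) (+) ((x < 0) && (y < 0)).

Lemma odd_abszD (x y : int) : odd `|x + y| = odd `|x| (+) odd `|y|.
Proof. lia. Qed.

Lemma odd_abszB (x y : int) : odd `|x - y| = odd `|x| (+) odd `|y|.
Proof. lia. Qed.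

Lemma odd_abszM (x y : int) : odd `|x * y| = odd `|x| && odd `|y|.
Proof. by rewrite abszM oddM. Qed.

Lemma mod4_3M (x y : int) : odd `|x| -> odd `|y| ->
  mod4_3 (x * y) = mod4_3 x (+) mod4_3 y.
Proof.
move=> ox oy; rewrite /mod4_3 -modzMm.
have [->|->] : (x %% 4)%Z = 1 \/ (x %% 4)%Z = 3 by lia.
  by have [->|->] : (y %% 4)%Z = 1 \/ (y %% 4)%Z = 3 by lia.
by have [->|->] : (y %% 4)%Z = 1 \/ (y %% 4)%Z = 3 by lia.
Qed.

Lemma mod8_35M (x y : int) : odd `|x| -> odd `|y| ->
  mod8_35 (x * y) = mod8_35 x (+) mod8_35 y.
Proof.
move=> ox oy; rewrite /mod8_35 -modzMm.
have : (x %% 8)%Z = 1 \/ (x %% 8)%Z = 3 \/ (x %% 8)%Z = 5 \/ (x %% 8)%Z = 7 by lia.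
have : (y %% 8)%Z = 1 \/ (y %% 8)%Z = 3 \/ (y %% 8)%Z = 5 \/ (y %% 8)%Z = 7 by lia.
by case=> [->|[->|[->|->]]]; case=> [->|[->|[->|->]]].
Qed.

Lemma jacobiN1_abs (x : int) : odd `|x| ->
  jacobi (-1) `|x| = (-1) ^+ (mod4_3 x (+) (x < 0)).
Proof.
move=> ox; rewrite jacobiN1 // -[LHS]signr_odd; congr (_ ^+ nat_of_bool _).
rewrite /mod4_3; case: (ltrP x 0); lia.
Qed.

Lemma jacobi2_abs (x : int) : odd `|x| -> jacobi 2 `|x| = (-1) ^+ mod8_35 x.
Proof.
by move=> ox; rewrite jacobi2 //; congr (_ ^+ nat_of_bool _); rewrite /mod8_35; lia.
Qed.

Lemma jacobi_abs_sign (x y : int) : odd `|y| ->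
  jacobi x `|y| = (-1) ^+ ((x < 0) && (mod4_3 y (+) (y < 0))) * jacobi `|x| `|y|.
Proof.
move=> oy; case: (ltrP x 0) => x0 /=; last first.
  by rewrite expr0 mul1r; congr jacobi; lia.
by rewrite -jacobiN1_abs // -jacobiMl //; congr jacobi; lia.
Qed.

(** Passing to absolute values on top costs symbols of -1, which depend on the class mod 4 and on
    the sign. All terms mixing a class with a sign cancel, leaving the two parts of [hilb]. *)
Lemma jacobi_hilb (x y : int) : odd `|x| -> odd `|y| ->
  jacobi x `|y| = (-1) ^+ hilb x y * jacobi y `|x|.
Proof.
move=> ox oy; rewrite jacobi_abs_sign // [jacobi y _]jacobi_abs_sign //.
rewrite jacobi_reciprocity // -[_ ^+ (_ * _)%N]signr_odd !mulrA -!signr_addb.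
congr (_ ^+ nat_of_bool _ * _).
rewrite /hilb.
have -> : odd (`|x|./2 * `|y|./2) = (mod4_3 x (+) (x < 0)) && (mod4_3 y (+) (y < 0)).
  rewrite oddM /mod4_3; congr (_ && _).
    by case: (ltrP x 0); lia.
  by case: (ltrP y 0); lia.
by case: (mod4_3 x); case: (mod4_3 y); case: (x < 0); case: (y < 0).
Qed.

Definition oddpart2 (b : int) : int := (b %/ (2 ^ logn 2 `|b|)%N%:Z)%Z.

Lemma oddpart2E (b : int) : b != 0 ->
  b = (2 ^ logn 2 `|b|)%N%:Z * oddpart2 b /\ odd `|oddpart2 b|.
Proof.
move=> b0; have ab : (0 < `|b|)%N by rewrite absz_gt0.
have dv : ((2 ^ logn 2 `|b|)%N%:Z %| b)%Z by rewrite dvdzE /= pfactor_dvdnn.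
have E : b = (2 ^ logn 2 `|b|)%N%:Z * oddpart2 b.
  by rewrite mulrC /oddpart2 divzK.
split=> //; have [m com Em] := @pfactor_coprime 2 `|b| isT ab.
have : (`|b| = 2 ^ logn 2 `|b| * `|oddpart2 b|)%N by rewrite {1}E abszM.
rewrite {1}Em mulnC => /eqP; rewrite eqn_pmul2l ?expn_gt0 // => /eqP <-.
by move: com; rewrite coprime2n.
Qed.

(* The sign collected by the reciprocity steps below. *)
Definition jk_bit (u8 : int) (nu : bool) (a8 : int) (na : bool) (r8 : int)
    (nr : bool) (b : int) : bool :=
  let be := oddpart2 b in
  let nb := b < 0 in
  (mod4_3 u8 (+) nu) (+)
  (odd (logn 2 `|b|) && (mod8_35 u8 (+) (mod8_35 a8 (+) mod8_35 r8))) (+)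
  (((mod4_3 u8 (+) mod4_3 be) && mod4_3 r8) (+) ((nu (+) nb) && nr)) (+)
  ((mod4_3 u8 && mod4_3 be) (+) (nu && nb)) (+)
  ((mod4_3 a8 && mod4_3 be) (+) (na && nb)).

Lemma jacobiX (x : int) (t n : nat) : odd n -> jacobi (x ^+ t) n = jacobi x n ^+ t.
Proof.
move=> on; elim: t => [|t IH]; first by rewrite !expr0 jacobi1l.
by rewrite !exprS jacobiMl // IH.
Qed.

Lemma jacobi_eq_mod (x y n k : int) : odd `|n| -> x - y = k * n ->
  jacobi x `|n| = jacobi y `|n|.
Proof.
move=> on E; apply: jacobi_modP => //.
have -> : (`|n| %| x - y)%Z = (n %| x - y)%Z by [].
by apply/dvdzP; exists k.
Qed.

Lemma mod4_3_mod8 (x : int) : mod4_3 (x %% 8)%Z = mod4_3 x.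
Proof. by rewrite /mod4_3; lia. Qed.

Lemma mod4_3_sumsq (u v : int) : odd `|u| -> ~~ odd `|v| ->
  mod4_3 (u * u + v * v) = false.
Proof.
move=> ou ev.
have [m Em] : exists m, v = 2 * m by exists (v %/ 2)%Z; lia.
have [k Ek] : exists k, u = 2 * k + 1 by exists (u %/ 2)%Z; lia.
rewrite /mod4_3 Em Ek.
have -> : (2 * k + 1) * (2 * k + 1) + 2 * m * (2 * m) =
   (k * k + k + m * m) * 4 + 1 :> int by ring.
by rewrite modzMDl.
Qed.

(* Here [g] is the gcd of [u] and [b], and the key relation is
   [u' s = v r' + q b'], whence [(s/r') = (u'/r') (q b'/r')]. *)
Lemma jacobi_symbol_coprime (u' g v a b'' : int) (t : nat) :
  let u := g * u' in let b' := 2 ^+ t * b'' in let b := g * b' in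
  let r' := u' * a - v * b' in let r := g * r' in
  let s := v * a + u * b in let q := u * u + v * v in
  0 < g -> odd `|g| -> odd `|u'| -> odd `|b''| -> odd `|a| -> ~~ odd `|v| ->
  ~~ odd `|b| -> coprime `|u| `|v| -> coprime `|a| `|b| -> coprime `|u'| `|b'| ->
  jacobi s `|r| = (-1) ^+
    ((mod4_3 u' (+) (u' < 0)) (+)
    (odd t && (mod8_35 u' (+) mod8_35 r' (+) mod8_35 a)) (+)
    hilb u' r' (+) hilb b'' r' (+) hilb u' b'' (+) hilb a b'' (+) hilb a g)
   * jacobi v `|u| * jacobi b `|a| * jacobi r `|q|.
Proof.
move=> u b' b r' r s q g0 og ou' ob'' oa ev eb cuv cab cub.
have ou : odd `|u| by rewrite abszM oddM og ou'.
have eb' : ~~ odd `|b'| by move: eb; rewrite abszM oddM og.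
have or' : odd `|r'| by rewrite odd_abszB !odd_abszM ou' oa (negPf ev).
have orr : odd `|r| by rewrite odd_abszM og or'.
have oq : odd `|q|.
  by rewrite odd_abszD [odd `|u * u|]odd_abszM ou [odd `|v * v|]odd_abszM (negPf ev).
have q4 : mod4_3 q = false by exact: mod4_3_sumsq.
have q0 : (q < 0) = false by rewrite ltNge addr_ge0 // -expr2 sqr_ge0.
have cgv : coprime `|g| `|v| by move: cuv; rewrite abszM coprimeMl => /andP [].
have cu'v : coprime `|u'| `|v| by move: cuv; rewrite abszM coprimeMl => /andP [].
have cab' : coprime `|a| `|b'| by move: cab; rewrite abszM coprimeMr => /andP [].
have cag : coprime `|a| `|g| by move: cab; rewrite abszM coprimeMr => /andP [].
have cu'b'' : coprime `|u'| `|b''|.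
  by move: cub; rewrite abszM coprimeMr => /andP [].
have cu'r' : coprime `|u'| `|r'|.
  rewrite /coprime.
  have -> : gcdn `|u'| `|r'| = gcdn `|u'| `|v * b'|.
    have := gcdzMDl a u' (- (v * b')).
    rewrite (_ : a * u' + - (v * b') = r'); last by rewrite /r'; ring.
    by rewrite gcdzN; move=> [].
  by rewrite -/(coprime _ _) abszM coprimeMr cub cu'v.
have cb''r' : coprime `|b''| `|r'|.
  rewrite /coprime.
  have -> : gcdn `|b''| `|r'| = gcdn `|b''| `|u' * a|.
    have := gcdzMDl (- (v * 2 ^+ t)) b'' (u' * a).
    rewrite (_ : - (v * 2 ^+ t) * b'' + u' * a = r'); last by rewrite /r' /b'; ring.
    by move=> [].
  rewrite -/(coprime _ _) abszM coprimeMr coprime_sym cu'b'' coprime_sym.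
  by move: cab'; rewrite abszM coprimeMr => /andP [].
have Js_g : jacobi s `|g| = jacobi v `|g| * jacobi a `|g|.
  rewrite -jacobiMl //; apply: (@jacobi_eq_mod _ _ _ (u' * b)) => //.
  by rewrite /s /u; ring.
have Jus : jacobi u' `|r'| * jacobi s `|r'| = jacobi q `|r'| * jacobi b' `|r'|.
  rewrite -!jacobiMl //; apply: (@jacobi_eq_mod _ _ _ v) => //.
  by rewrite /s /q /r' /u /b; ring.
have Jur2 : jacobi u' `|r'| * jacobi u' `|r'| = 1 by exact: jacobi_sqr.
have Js_r' : jacobi s `|r'| = jacobi u' `|r'| * (jacobi q `|r'| * jacobi b' `|r'|).
  by rewrite -Jus mulrA Jur2 mul1r.
have Jq : jacobi q `|r'| = jacobi r' `|q|.
  by rewrite jacobi_hilb // /hilb q4 q0 expr0 mul1r.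
(* Since [g] divides [u], the norm [q] is congruent to [v * v] modulo [g]. *)
have Jg : jacobi g `|q| = 1.
  rewrite jacobi_hilb // /hilb q4 q0 !andbF expr0 mul1r.
  rewrite (@jacobi_eq_mod q (v * v) g (u' * u)) //; last first.
    by rewrite /q /u; ring.
  by rewrite jacobiMl // jacobi_sqr // coprime_sym.
have Jr : jacobi r `|q| = jacobi r' `|q| by rewrite jacobiMl // Jg mul1r.
have J1 : jacobi u' `|r'| = (-1) ^+ hilb u' r' * ((-1) ^+ (mod4_3 u' (+) (u' < 0)) *
   (jacobi v `|u'| * ((-1) ^+ (odd t && mod8_35 u') * jacobi b'' `|u'|))).
  rewrite jacobi_hilb //; congr (_ * _).
  rewrite (@jacobi_eq_mod r' (-1 * (v * (2 ^+ t * b''))) u' a) //; last first.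
    by rewrite /r' /b'; ring.
  rewrite jacobiMl // jacobiN1_abs // jacobiMl // jacobiMl // jacobiX // jacobi2_abs //.
  by rewrite -exprM mulnC -[X in _ * (_ * (X * _))]signr_odd oddM oddb.
have J2 : jacobi b' `|r'| = (-1) ^+ (odd t && mod8_35 r') * ((-1) ^+ hilb b'' r' *
   (jacobi u' `|b''| * jacobi a `|b''|)).
  rewrite jacobiMl // jacobiX // jacobi2_abs // -exprM mulnC -[X in X * _]signr_odd oddM oddb.
  congr (_ * _); rewrite jacobi_hilb //; congr (_ * _).
  rewrite -jacobiMl //; apply: (@jacobi_eq_mod _ _ _ (- (v * 2 ^+ t))) => //.
  by rewrite /r' /b'; ring.
have J3 : jacobi b'' `|u'| * jacobi u' `|b''| = (-1) ^+ hilb u' b''.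
  by rewrite [jacobi u' _]jacobi_hilb // mulrCA jacobi_sqr ?mulr1 // coprime_sym.
have J4 : jacobi b `|a| = jacobi g `|a| * ((-1) ^+ (odd t && mod8_35 a) * jacobi b'' `|a|).
  rewrite jacobiMl // jacobiMl // jacobiX // jacobi2_abs //.
  by rewrite -exprM mulnC -[X in _ * (X * _)]signr_odd oddM oddb.
have J5 : jacobi v `|u| = jacobi v `|g| * jacobi v `|u'|.
  by rewrite abszM jacobiMr // ?odd_gt0.
rewrite [in LHS]abszM jacobiMr ?odd_gt0 // Js_g Js_r' Jq J1 J2 Jr J4 J5.
rewrite [jacobi a `|g|]jacobi_hilb // [jacobi a `|b''|]jacobi_hilb //.
have -> : (odd t && (mod8_35 u' (+) mod8_35 r' (+) mod8_35 a)) =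
 (odd t && mod8_35 u') (+) (odd t && mod8_35 r') (+) (odd t && mod8_35 a).
  by case: (odd t).
move: J3; move: (hilb u' b'') (hilb a g) (hilb a b'') (hilb u' r') (hilb b'' r').
move=> h3 h1 h2 h4 h5 J3.
rewrite !signr_addb -J3.
have sq (c : bool) : (-1) ^+ c * (-1) ^+ c = 1 :> int by case: c.
have := sq (odd t && mod8_35 a).
move: (jacobi v _) (jacobi v _) (jacobi g _) (jacobi _ `|q|) (jacobi b'' `|a|).
move: (jacobi b'' _) (jacobi u' _).
move: (_ ^+ (odd t && mod8_35 a)) (_ ^+ (odd t && mod8_35 u')) (_ ^+ (odd t && mod8_35 r')).
move: (_ ^+ h1) (_ ^+ h2) (_ ^+ h4) (_ ^+ h5).
move: (_ ^+ mod4_3 u') (_ ^+ (u' < 0)%R).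
move=> x1 x2 x3 x4 x5 x6 x7 x8 x9 x10 x11 x12 x13 x14 x15 x16 sqa.
(* [x7] is the sign of [odd t && mod8_35 a]; it occurs both in the stated sign and in [J4], hence as
   a square. *)
transitivity ((x7 * x7) * (x1 * x2 * x3 * x4 * x5 * x6 * x8 * x9 * x10 * x11 * x12 * x13 * x14 * x15 * x16)).
  by rewrite sqa; ring.
ring.
Qed.

(** The gcd [g] of [u] and [b] ties the two factors together, but its contributions cancel: the sign
    involves only residues mod 8, signs and [b]. This is what makes the separation of variables
    possible. *)
Lemma jacobi_symbol (u v a b : int) :
  odd `|u| -> odd `|a| -> ~~ odd `|v| -> ~~ odd `|b| -> b != 0 ->
  let r := u * a - v * b in let s := v * a + u * b in
  jacobi s `|r| =
    (-1) ^+ jk_bit (u %% 8)%Z (u < 0) (a %% 8)%Z (a < 0) (r %% 8)%Z (r < 0) b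
    * jacobi v `|u| * jacobi b `|a| * jacobi r `|u * u + v * v|.
Proof.
move=> ou oa ev eb b0 r s.
have orr : odd `|r| by rewrite odd_abszB !odd_abszM ou oa (negPf ev).
(* A common factor of [u], [v] or of [a], [b] divides both [r] and [s], so the two sides vanish
   together. *)
have comdiv (x : nat) : (1 < x)%N -> (x %| r)%Z -> (x %| s)%Z -> jacobi s `|r| = 0.
  move=> x1 xr xs; apply/eqP; rewrite jacobi_eq0 //; apply/negP => c.
  have : (x %| gcdn `|s| `|r|)%N by rewrite dvdn_gcd; apply/andP.
  by move: c; rewrite /coprime => /eqP -> /dvdn_leq; lia.
have gcd1 (x y : int) : odd `|x| -> ~~ coprime `|x| `|y| ->
   exists k : nat, [/\ (1 < k)%N, (k %| x)%Z & (k %| y)%Z].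
  move=> ox; rewrite /coprime => ne; exists (gcdn `|x| `|y|).
  rewrite !dvdzE /= dvdn_gcdl dvdn_gcdr; split=> //.
  by rewrite ltn_neqAle eq_sym ne gcdn_gt0 odd_gt0.
have [cuv|ncuv] := boolP (coprime `|u| `|v|); last first.
  have /eqP -> : jacobi v `|u| == 0 by rewrite jacobi_eq0 // coprime_sym.
  rewrite mulr0 !mul0r.
  have [k [k1 ku kv]] := gcd1 u v ou ncuv.
  by apply: (comdiv k) => //; [rewrite rpredB|rewrite rpredD] => //; rewrite ?dvdz_mulr.
have [cab|ncab] := boolP (coprime `|a| `|b|); last first.
  have /eqP -> : jacobi b `|a| == 0 by rewrite jacobi_eq0 // coprime_sym.
  rewrite mulr0 !mul0r.
  have [k [k1 ku kv]] := gcd1 a b oa ncab.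
  by apply: (comdiv k) => //; [rewrite rpredB|rewrite rpredD] => //; rewrite ?dvdz_mull.
set g : int := gcdz u b.
have g0 : 0 < g by rewrite /g ltz_nat gcdn_gt0 odd_gt0.
have gu : (g %| u)%Z := dvdz_gcdl u b.
have gb : (g %| b)%Z := dvdz_gcdr u b.
set u' := (u %/ g)%Z; set b' := (b %/ g)%Z.
have Eu : u = g * u' by rewrite mulrC divzK.
have Eb : b = g * b' by rewrite mulrC divzK.
have og : odd `|g| by move: ou; rewrite Eu abszM oddM => /andP [].
have ou' : odd `|u'| by move: ou; rewrite Eu abszM oddM => /andP [].
have b'0 : b' != 0 by apply: contraNneq b0 => b'0; rewrite Eb b'0 mulr0.
have [Eb' ob''] := oddpart2E b'0.
set t := logn 2 `|b'| in Eb'; set b'' := oddpart2 b' in Eb' ob''.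
have Et : logn 2 `|b| = t.
  have lg : logn 2 `|g| = 0%N by rewrite logn_coprime // coprime2n.
  have g1 : (0 < `|g|)%N by rewrite odd_gt0.
  have b1 : (0 < `|b'|)%N by rewrite absz_gt0.
  by rewrite Eb abszM (lognM _ g1 b1) lg.
have Ebe : oddpart2 b = g * b''.
  have [E _] := oddpart2E b0; move: E; rewrite Et {1}Eb {1}Eb' mulrCA.
  have nz : (2 ^ t)%N%:Z != 0 by rewrite eqz_nat expn_eq0.
  by move/(mulfI nz).
have P2 : (2 ^ t)%N%:Z = 2 ^+ t by rewrite -[in RHS](intz 2) -natrX natz.
have cub' : coprime `|u'| `|b'|.
  have g1 : (0 < `|g|)%N by rewrite odd_gt0.
  have : gcdn `|g * u'| `|g * b'| = `|g|%N by rewrite -Eu -Eb.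
  by rewrite !abszM -muln_gcdr -[RHS]muln1 => /eqP; rewrite eqn_pmul2l.
have := @jacobi_symbol_coprime u' g v a b'' t.
cbv zeta; rewrite -P2 -Eb' -Eu -Eb -/s.
have -> : g * (u' * a - v * b') = r by rewrite /r [in RHS]Eu [in RHS]Eb; ring.
move=> -> //; congr (_ ^+ nat_of_bool _ * _ * _ * _).
set r' := u' * a - v * b'.
have Er : r = g * r' by rewrite /r' /r [in LHS]Eu [in LHS]Eb; ring.
have or' : odd `|r'| by move: orr; rewrite Er abszM oddM => /andP [].
have m8 x : mod8_35 (x %% 8)%Z = mod8_35 x by rewrite /mod8_35 modz_mod.
have m4 := mod4_3_mod8.
have ng : (g < 0) = false by rewrite ltNge ltW.
have nM x : (g * x < 0) = (x < 0) by rewrite pmulr_rlt0.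
rewrite /jk_bit /hilb Ebe Et !m8 !m4 Er Eu.
have -> : (b < 0) = (b'' < 0).
  by rewrite Eb nM Eb' pmulr_rlt0 // ltz_nat expn_gt0.
rewrite !mod4_3M // !mod8_35M // !nM ng !andbF.
case: (odd t) => /=; last first.
  by case: (mod4_3 u'); case: (u' < 0); case: (mod4_3 g); case: (mod4_3 b'');
    case: (b'' < 0); case: (mod4_3 r'); case: (r' < 0); case: (mod4_3 a); case: (a < 0).
have -> : mod8_35 g (+) mod8_35 u' (+) (mod8_35 a (+) (mod8_35 g (+) mod8_35 r')) =
   mod8_35 u' (+) mod8_35 r' (+) mod8_35 a.
  by case: (mod8_35 g); case: (mod8_35 u'); case: (mod8_35 r'); case: (mod8_35 a).
move: (_ (+) mod8_35 a) => e.
by case: (mod4_3 u'); case: (u' < 0); case: (mod4_3 g); case: (mod4_3 b'');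
    case: (b'' < 0); case: (mod4_3 r'); case: (r' < 0); case: (mod4_3 a); case: (a < 0); case: e.
Qed.

(** * Large sieve by powering *)

Lemma sum_norm_sqr_le (R : realFieldType) (I : Type) (s : seq I) (f : I -> R) :
  (\sum_(x <- s) `|f x|) ^+ 2 <= (size s)%:R * \sum_(x <- s) f x ^+ 2.
Proof.
rewrite expr2 mulr_suml.
have -> : (size s)%:R * \sum_(x <- s) f x ^+ 2 =
  \sum_(x <- s) \sum_(y <- s) (f x ^+ 2 + f y ^+ 2) / 2%:R.
  under [in RHS]eq_bigr do
    rewrite -mulr_suml big_split /= big_const_seq count_predT iter_addr_0.
  rewrite -mulr_suml big_split /= sumrMnl big_const_seq count_predT iter_addr_0.
  by rewrite -[X in _ = (X + _) / _]mulr_natl -[X in _ = (_ + X) / _]mulr_natl; field.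
apply: ler_sum => x _; rewrite mulr_sumr; apply: ler_sum => y _.
rewrite -[f x ^+ 2]real_normK ?num_real // -[f y ^+ 2]real_normK ?num_real // ler_pdivlMr //.
by have := sqr_ge0 (`|f x| - `|f y|); rewrite !expr2; nra.
Qed.

Lemma ler_sum_subset (R : realFieldType) (T : eqType) (s1 s2 : seq T) (f : T -> R) :
  uniq s1 -> {subset s1 <= s2} -> (forall x, 0 <= f x) ->
  \sum_(x <- s1) f x <= \sum_(x <- s2) f x.
Proof.
move=> u1 sub f0.
have [s3 pe] : exists s3, perm_eq (undup s2) (s1 ++ s3).
  exists [seq x <- undup s2 | x \notin s1].
  apply: uniq_perm; first exact: undup_uniq.
    rewrite cat_uniq u1 filter_uniq ?undup_uniq // andbT.
    by apply/hasPn => x; rewrite mem_filter => /andP [].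
  move=> x; rewrite mem_cat mem_filter mem_undup.
  by case H : (x \in s1) => //=; rewrite sub.
apply: (@le_trans _ _ (\sum_(x <- undup s2) f x)).
  by rewrite (perm_big _ pe) /= big_cat /= lerDl sumr_ge0.
elim: s2 {sub s3 pe} => [|x s IH]; first by rewrite big_nil.
rewrite /=; case: ifP => _; rewrite !big_cons ?lerD2l //.
by apply: le_trans IH _; rewrite lerDr.
Qed.

Section Power.
Variables (R : realFieldType) (G : pzRingType) (I : Type).
Variables (Zs : seq G) (Box : nat -> seq G) (kap : I -> G -> R) (sig : I -> R).
Variables (D : R).
(* [Box j] contains the products of [j + 1] elements of [Zs]. *)
Hypothesis kapM : forall w x z, kap w x * kap w z = sig w * kap w (x * z).
Hypothesis uBox : forall j, uniq (Box j).
Hypothesis Box0 : Box 0%N = Zs.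
Hypothesis BoxM : forall j x z, x \in Box j -> z \in Zs -> x * z \in Box j.+1.
Hypothesis D0 : 0 <= D.

(** By [kapM] each further factor is absorbed into a single variable [y]. Its coefficient collects
    the factorizations [x * z == y], at most [D] of them at each of the [k] stages, whatever [beta]
    is. *)
Lemma power_expand (beta : G -> R) (k : nat) :
  (forall j y, (j < k)%N -> y \in Box j.+1 ->
    \sum_(x <- Box j) \sum_(z <- Zs) (x * z == y)%:R <= D) ->
  (forall z, z \in Zs -> `|beta z| <= 1) ->
  exists2 B : G -> R, (forall y, y \in Box k -> `|B y| <= D ^+ k) &
    forall w, (\sum_(z <- Zs) beta z * kap w z) ^+ k.+1
      = sig w ^+ k * \sum_(y <- Box k) B y * kap w y.
Proof.
move=> BoxD b1; elim: k BoxD => [|k IH] BoxD.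
  by exists beta => [y|w]; rewrite ?Box0 ?expr0 ?expr1 ?mul1r //; apply: b1.
have [|B HB EB] := IH; first by move=> j y jk; apply: BoxD; exact: ltnW.
exists (fun y => \sum_(x <- Box k) \sum_(z <- Zs) (x * z == y)%:R * (B x * beta z)).
  move=> y yB; apply: le_trans (ler_norm_sum _ _ _) _.
  apply: (@le_trans _ _ (\sum_(x <- Box k) \sum_(z <- Zs) (x * z == y)%:R * D ^+ k)).
    rewrite big_seq [leRHS]big_seq; apply: ler_sum => x xB.
    apply: le_trans (ler_norm_sum _ _ _) _.
    rewrite big_seq [leRHS]big_seq; apply: ler_sum => z zZ.
    rewrite !normrM ger0_norm ?ler0n // ler_wpM2l ?ler0n //.
    rewrite -[leRHS]mulr1; apply: ler_pM; rewrite ?normr_ge0 ?HB ?b1 //.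
  under eq_bigr do rewrite -mulr_suml.
  rewrite -mulr_suml exprS; apply: ler_wpM2r; first exact: exprn_ge0.
  exact: BoxD.
move=> w; rewrite exprS EB mulrCA [sig w ^+ k.+1]exprSr -mulrA; congr (_ * _).
rewrite mulrC mulr_suml.
have E x z : x \in Box k -> z \in Zs ->
   B x * kap w x * (beta z * kap w z) =
   sig w * \sum_(y <- Box k.+1) (x * z == y)%:R * (B x * beta z) * kap w y.
  move=> xB zZ; rewrite (bigD1_seq (x * z)) ?BoxM //= eqxx mul1r.
  rewrite [X in _ + X]big1 ?addr0; last first.
    by move=> y; rewrite eq_sym => /negPf ->; rewrite !mul0r.
  by rewrite mulrACA kapM; ring.
transitivity (\sum_(x <- Box k) \sum_(z <- Zs) sig w * \sum_(y <- Box k.+1)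
    (x * z == y)%:R * (B x * beta z) * kap w y).
  rewrite big_seq [RHS]big_seq; apply: eq_bigr => x xB.
  rewrite mulr_sumr big_seq [RHS]big_seq; apply: eq_bigr => z zZ.
  exact: E.
under eq_bigr do rewrite -mulr_sumr.
rewrite -mulr_sumr; congr (_ * _).
transitivity (\sum_(x <- Box k) \sum_(y <- Box k.+1) \sum_(z <- Zs)
    (x * z == y)%:R * (B x * beta z) * kap w y).
  by apply: eq_bigr => x _; rewrite exchange_big.
rewrite exchange_big /=; apply: eq_bigr => y _.
by rewrite mulr_suml; apply: eq_bigr => x _; rewrite mulr_suml.
Qed.

(** Duality: the signs [e w] make the moment linear in the kernel, the sums over [w] and [y] are
    exchanged, the coefficients of [y] are bounded by their maximum, and Cauchy's inequality over
    [y] leaves sums free of [beta]. *)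
Lemma power_moment (beta : G -> R) (k : nat) (W : seq I) (Big : seq G) :
  (forall j y, (j < k)%N -> y \in Box j.+1 ->
    \sum_(x <- Box j) \sum_(z <- Zs) (x * z == y)%:R <= D) ->
  (forall z, z \in Zs -> `|beta z| <= 1) ->
  {subset Box k <= Big} -> (forall w, `|sig w| <= 1) ->
  (\sum_(w <- W) `|\sum_(z <- Zs) beta z * kap w z| ^+ k.+1) ^+ 2 <=
  (D ^+ k) ^+ 2 * ((size Big)%:R * \sum_(w1 <- W) \sum_(w2 <- W)
      `|\sum_(y <- Big) kap w1 y * kap w2 y|).
Proof.
move=> BoxD b1 sub s1.
have [B HB EB] := power_expand BoxD b1.
pose S w := \sum_(z <- Zs) beta z * kap w z.
pose e w := Num.sg (S w ^+ k.+1) * sig w ^+ k.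
have e1 w : `|e w| <= 1.
  rewrite /e normrM normrX -[leRHS]mul1r; apply: ler_pM => //.
  - by rewrite exprn_ge0.
  - by case: sgrP => _; rewrite ?normr0 ?normr1 ?normrN1.
  - by rewrite exprn_ile1.
pose T y := \sum_(w <- W) e w * kap w y.
have ES : \sum_(w <- W) `|S w| ^+ k.+1 = \sum_(y <- Box k) B y * T y.
  transitivity (\sum_(w <- W) e w * \sum_(y <- Box k) B y * kap w y).
    apply: eq_bigr => w _; by rewrite -normrX normrEsg /e -mulrA -EB.
  under eq_bigr do rewrite mulr_sumr.
  rewrite exchange_big /=; apply: eq_bigr => y _; rewrite mulr_sumr.
  by apply: eq_bigr => w _; ring.
have L1 : \sum_(w <- W) `|S w| ^+ k.+1 <= D ^+ k * \sum_(y <- Box k) `|T y|.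
  rewrite ES mulr_sumr big_seq [leRHS]big_seq; apply: ler_sum => y yB.
  apply: le_trans (ler_norm _) _; rewrite normrM.
  by apply: ler_wpM2r => //; exact: HB.
apply: (@le_trans _ _ ((D ^+ k * \sum_(y <- Box k) `|T y|) ^+ 2)).
  rewrite ler_pXn2r // ?nnegrE ?sumr_ge0 // => [w _|]; first exact: exprn_ge0.
  by rewrite mulr_ge0 ?exprn_ge0 ?sumr_ge0.
rewrite exprMn; apply: ler_wpM2l; first exact: sqr_ge0.
apply: le_trans (sum_norm_sqr_le _ _) _.
apply: ler_pM; rewrite ?ler0n //.
- by apply: sumr_ge0 => y _; exact: sqr_ge0.
- by rewrite ler_nat; apply: uniq_leq_size.
(* Once squares have made all terms nonnegative, [y] may range over a full box, where the inner sums
   are close to complete ones. *)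
apply: (@le_trans _ _ (\sum_(y <- Big) T y ^+ 2)).
  by apply: ler_sum_subset => // y; exact: sqr_ge0.
have -> : \sum_(y <- Big) T y ^+ 2 = \sum_(w1 <- W) \sum_(w2 <- W)
    e w1 * e w2 * \sum_(y <- Big) kap w1 y * kap w2 y.
  transitivity (\sum_(y <- Big) \sum_(w1 <- W) \sum_(w2 <- W)
      e w1 * e w2 * (kap w1 y * kap w2 y)).
    apply: eq_bigr => y _; rewrite expr2 /T mulr_suml; apply: eq_bigr => w1 _.
    by rewrite mulr_sumr; apply: eq_bigr => w2 _; ring.
  rewrite exchange_big /=; apply: eq_bigr => w1 _; rewrite exchange_big /=.
  by apply: eq_bigr => w2 _; rewrite mulr_sumr.
apply: ler_sum => w1 _; apply: ler_sum => w2 _.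
apply: le_trans (ler_norm _) _; rewrite normrM normrM -[leRHS]mul1r.
apply: ler_wpM2r => //; rewrite -[leRHS]mul1r.
by apply: ler_pM.
Qed.
End Power.

(** Above the threshold [tau] the factor [(t / tau) ^+ k] is at least 1. *)
Lemma truncated_power (R : realFieldType) (t tau : R) (k : nat) : 0 <= t -> 0 < tau ->
  t <= tau + t ^+ k.+1 / tau ^+ k.
Proof.
move=> t0 tau0; have [le|/ltW le] := lerP t tau.
  by apply: le_trans le _; rewrite lerDl divr_ge0 ?exprn_ge0 // ltW.
apply: (@le_trans _ _ (t ^+ k.+1 / tau ^+ k)); last by rewrite lerDr ltW.
rewrite ler_pdivlMr ?exprn_gt0 // exprS ler_wpM2l //.
by rewrite lerXn2r // nnegrE ltW.
Qed.

(** Values above [tau] are bounded by their high power, summed over all labels; values below [tau]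
    need no such sum. Hence [#|Lb|] multiplies only the term divided by [tau ^+ k]. *)
Lemma label_bound (R : realFieldType) (I G : Type) (W : seq I) (Zs : seq G)
    (kap : I -> G -> R) (Lb : finType) (l : I -> Lb) (beta : Lb -> G -> R)
    (V tau : R) (k : nat) : 0 < tau ->
  (forall i, \sum_(w <- W) `|\sum_(z <- Zs) beta i z * kap w z| ^+ k.+1 <= V) ->
  \sum_(w <- W) `|\sum_(z <- Zs) beta (l w) z * kap w z| <=
  (size W)%:R * tau + #|Lb|%:R * V / tau ^+ k.
Proof.
move=> tau0 HV.
apply: (@le_trans _ _ (\sum_(w <- W) (tau +
   `|\sum_(z <- Zs) beta (l w) z * kap w z| ^+ k.+1 / tau ^+ k))).
  by apply: ler_sum => w _; apply: truncated_power.
rewrite big_split /= big_const_seq count_predT iter_addr_0 mulr_natl lerD2l.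
rewrite -mulr_suml ler_wpM2r ?invr_ge0 ?exprn_ge0 ?(ltW tau0) //.
apply: (@le_trans _ _ (\sum_(w <- W) \sum_(i : Lb)
   `|\sum_(z <- Zs) beta i z * kap w z| ^+ k.+1)).
  apply: ler_sum => w _; rewrite (bigD1 (l w)) //= lerDl sumr_ge0 // => i _.
  exact: exprn_ge0.
rewrite exchange_big /= -sumr_const mulr_suml; apply: ler_sum => i _.
by rewrite mul1r.
Qed.

(* Truncations that form a chain are classified by the cardinality of the
   retained set, up to [B]. *)
Lemma chain_count (T : Type) (s : seq T) (P Q : pred T) (B : nat) : (0 < B)%N ->
  (forall z, P z -> Q z) \/ (forall z, Q z -> P z) ->
  (count P s %/ B = count Q s %/ B)%N ->
  (count (fun z => P z != Q z) s < B)%N.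
Proof.
move=> B0.
wlog PQ : P Q / (forall z, P z -> Q z).
  move=> H [PQ|QP] E; first by apply: H => //; left.
  rewrite (eq_count (a2 := fun z => Q z != P z)); last by move=> z; rewrite eq_sym.
  by apply: H => //; left.
move=> _ E.
have : (count Q s = count P s + count (fun z => P z != Q z) s)%N.
  elim: s {E} => //= z s ->; have := PQ z; case: (P z); case: (Q z) => //=; lia.
have := divn_eq (count P s) B; have := divn_eq (count Q s) B.
have := ltn_pmod (count P s) B0; have := ltn_pmod (count Q s) B0.
rewrite E; nia.
Qed.

(** * The complex modulus as a real number *)

Section NormC.
Variable R : realType.
Local Notation nc := (@ComplexField.Normc.normc R).
Implicit Types x y : R[i].

Lemma normcE x : `|x| = (nc x)%:C%C.
Proof. by []. Qed.

Lemma normc_ge0 x : 0 <= nc x.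
Proof. by case: x => a b; exact: sqrtr_ge0. Qed.

Lemma normcM x y : nc (x * y) = nc x * nc y.
Proof. exact: ComplexField.Normc.normcM. Qed.

Lemma normcD x y : nc (x + y) <= nc x + nc y.
Proof. by rewrite -lecR rmorphD /= -!normcE ler_normD. Qed.

Lemma normcN x : nc (- x) = nc x.
Proof. by apply: complexI; rewrite -!normcE normrN. Qed.

Lemma normcB x y : nc (x - y) <= nc x + nc y.
Proof. by rewrite -[nc y]normcN normcD. Qed.

Lemma normc_distC x y : nc (x - y) = nc (y - x).
Proof. by rewrite -normcN opprB. Qed.

Lemma normcR (r : R) : nc r%:C%C = `|r|.
Proof. by rewrite /nc /= expr0n addr0 sqrtr_sqr. Qed.

Lemma normcX x n : nc (x ^+ n) = nc x ^+ n.
Proof.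
elim: n => [|n IH]; first by rewrite !expr0 ComplexField.Normc.normc1.
by rewrite !exprS normcM IH.
Qed.

Lemma normc_sum (T : Type) (s : seq T) (P : pred T) (f : T -> R[i]) :
  nc (\sum_(x <- s | P x) f x) <= \sum_(x <- s | P x) nc (f x).
Proof.
elim/big_rec2: _ => [|x r z _ H]; first by rewrite ComplexField.Normc.normc0.
by apply: le_trans (normcD _ _) _; rewrite lerD2l.
Qed.

Lemma normc_Re x : `|complex.Re x| <= nc x.
Proof.
case: x => a b /=; rewrite -sqrtr_sqr ler_sqrt ?lerDl ?sqr_ge0 //.
by rewrite addr_ge0 ?sqr_ge0.
Qed.

Lemma normc_Im x : `|complex.Im x| <= nc x.
Proof.
case: x => a b /=; rewrite -sqrtr_sqr ler_sqrt ?lerDr ?sqr_ge0 //.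
by rewrite addr_ge0 ?sqr_ge0.
Qed.

Lemma normc_ReIm x : nc x <= `|complex.Re x| + `|complex.Im x|.
Proof.
case: x => a b /=.
rewrite -[leRHS]ger0_norm ?addr_ge0 // -sqrtr_sqr ler_sqrt ?sqr_ge0 //.
have := normr_ge0 a; have := normr_ge0 b.
by rewrite -[a ^+ 2]real_normK ?num_real // -[b ^+ 2]real_normK ?num_real // !expr2; nra.
Qed.

Lemma Re_sum (T : Type) (s : seq T) (f : T -> R[i]) :
  complex.Re (\sum_(x <- s) f x) = \sum_(x <- s) complex.Re (f x).
Proof. by elim/big_rec2: _ => [|x r [a b] _ <-] //=; case: (f x). Qed.

Lemma Im_sum (T : Type) (s : seq T) (f : T -> R[i]) :
  complex.Im (\sum_(x <- s) f x) = \sum_(x <- s) complex.Im (f x).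
Proof. by elim/big_rec2: _ => [|x r [a b] _ <-] //=; case: (f x). Qed.

Lemma ReM (r : R) x : complex.Re (r%:C%C * x) = r * complex.Re x.
Proof. by case: x => a b /=; rewrite mul0r subr0. Qed.

Lemma ImM (r : R) x : complex.Im (r%:C%C * x) = r * complex.Im x.
Proof. by case: x => a b /=; rewrite mul0r addr0. Qed.

(* Each weight [g w] is replaced by the weight of one representative of its
   label, so that only [#|Lb|] different weights remain. *)
Lemma approx_bound (I G : eqType) (W : seq I) (Zs : seq G)
    (kap : I -> G -> R) (Lb : finType) (l : I -> Lb) (g : I -> G -> R[i])
    (V tau E : R) (k : nat) : 0 < tau ->
  (forall w z, w \in W -> z \in Zs -> `|kap w z| <= 1) ->
  (forall w z, w \in W -> z \in Zs -> nc (g w z) <= 1) ->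
  (forall beta : G -> R, (forall z, z \in Zs -> `|beta z| <= 1) ->
    \sum_(w <- W) `|\sum_(z <- Zs) beta z * kap w z| ^+ k.+1 <= V) ->
  (forall w w', w \in W -> w' \in W -> l w = l w' ->
    \sum_(z <- Zs) nc (g w z - g w' z) <= E) ->
  \sum_(w <- W) nc (\sum_(z <- Zs) (kap w z)%:C%C * g w z) <=
  (size W)%:R * E + 2 * ((size W)%:R * tau + #|Lb|%:R * V / tau ^+ k).
Proof.
move=> tau0 kap1 g1 HV HE.
case EW : W => [|w0 W0].
  rewrite big_nil !mul0r !add0r mulr_ge0 // divr_ge0 ?exprn_ge0 ?(ltW tau0) //.
  rewrite mulr_ge0 //.
  by have := HV (fun=> 0) (fun _ _ => _); rewrite EW big_nil; apply; rewrite normr0.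
rewrite -EW; have w0W : w0 \in W by rewrite EW mem_head.
(* The first member of [W] with label [i]; if there is none, [nth] falls back on [w0], which also
   lies in [W]. *)
pose rp i := nth w0 W (find (fun w => l w == i) W).
have rpW i : rp i \in W.
  have [lt|ge] := ltnP (find (fun w => l w == i) W) (size W); first exact: mem_nth.
  by rewrite /rp nth_default.
have rpl w : w \in W -> l w = l (rp (l w)).
  move=> wW; have h : has (fun w' => l w' == l w) W by apply/hasP; exists w.
  by have /eqP := nth_find w0 h.
have b1 i z : z \in Zs -> `|complex.Re (g (rp i) z)| <= 1.
  by move=> zZ; apply: le_trans (normc_Re _) _; apply: g1.
have b2 i z : z \in Zs -> `|complex.Im (g (rp i) z)| <= 1.
  by move=> zZ; apply: le_trans (normc_Im _) _; apply: g1.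
(* Real and imaginary parts of the weights are two families of real coefficients, whence the factor
   2. *)
have L1 := label_bound l tau0 (fun i => HV _ (b1 i)).
have L2 := label_bound l tau0 (fun i => HV _ (b2 i)).
apply: (@le_trans _ _ (\sum_(w <- W) (E +
   (`|\sum_(z <- Zs) complex.Re (g (rp (l w)) z) * kap w z| +
    `|\sum_(z <- Zs) complex.Im (g (rp (l w)) z) * kap w z|)))); last first.
  rewrite !big_split /= big_const_seq count_predT iter_addr_0.
  rewrite -[E *+ _]mulr_natl lerD2l mulr_natl mulr2n; exact: lerD.
rewrite big_seq [leRHS]big_seq; apply: ler_sum => w wW.
have -> : \sum_(z <- Zs) (kap w z)%:C%C * g w z =
  \sum_(z <- Zs) (kap w z)%:C%C * (g w z - g (rp (l w)) z)
  + \sum_(z <- Zs) (kap w z)%:C%C * g (rp (l w)) z.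
  by rewrite -big_split /=; apply: eq_bigr => z _; rewrite -mulrDr subrK.
apply: le_trans (normcD _ _) _; apply: lerD.
  apply: le_trans (normc_sum _ _ _) _; apply: le_trans (HE _ _ wW (rpW (l w)) (rpl _ wW)).
  rewrite big_seq [leRHS]big_seq; apply: ler_sum => z zZ.
  rewrite normcM normcR -[leRHS]mul1r; apply: ler_wpM2r; first exact: normc_ge0.
  exact: kap1.
apply: le_trans (normc_ReIm _) _; rewrite Re_sum Im_sum.
rewrite le_eqVlt; apply/orP; left; apply/eqP.
by congr (_ + _); congr (Num.norm _); apply: eq_bigr => z _; rewrite ?ReM ?ImM mulrC.
Qed.
End NormC.

(** * Vaughan's identity *)

Section Vaughan.
Variable R : realType.

Definition moebius (n : nat) : R :=
  if all (fun p => logn p n == 1%N) (primes n) then (-1) ^+ size (primes n) else 0.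

Lemma moebius_norm n : `|moebius n| <= 1.
Proof.
rewrite /moebius; case: ifP => _; last by rewrite normr0.
by rewrite normrX normrN1 expr1n.
Qed.

Lemma moebiusM_prime p n : prime p -> (0 < n)%N -> ~~ (p %| n)%N ->
  moebius (p * n) = - moebius n.
Proof.
move=> pp n0 pn; have p0 := prime_gt0 pp.
have pe : perm_eq (primes (p * n)) (p :: primes n).
  apply: uniq_perm; rewrite ?primes_uniq //=.
    by rewrite mem_primes pp n0 (negPf pn) primes_uniq.
  by move=> q; rewrite primesM // inE primes_prime // inE.
rewrite /moebius (perm_all _ pe) (perm_size pe) /= exprS mulN1r.
have lp : logn p n = 0%N.
  by apply/eqP; rewrite -leqn0 leqNgt logn_gt0 mem_primes pp n0.
rewrite lognM // lp logn_prime // eqxx /=.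
have -> : all (fun q => logn q (p * n) == 1%N) (primes n) = all (fun q => logn q n == 1%N) (primes n).
  apply: eq_in_all => q qn; rewrite lognM // logn_prime //.
  have [E|//] := eqVneq q p; exfalso; move: qn pn; rewrite E mem_primes.
  by move=> /and3P [_ _ ->].
by case: all; rewrite ?oppr0.
Qed.

Lemma moebius_sqr p n : prime p -> (0 < n)%N -> (p %| n)%N -> moebius (p * n) = 0.
Proof.
move=> pp n0 pn; have p0 := prime_gt0 pp; rewrite /moebius.
suff -> : all (fun q => logn q (p * n) == 1%N) (primes (p * n)) = false by [].
apply/negP => /allP /(_ p); rewrite mem_primes pp muln_gt0 p0 n0 dvdn_mulr //= => /(_ isT).
rewrite lognM // logn_prime // eqxx.
have : (0 < logn p n)%N by rewrite logn_gt0 mem_primes pp n0.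
lia.
Qed.

Lemma divisors1 : divisors 1 = [:: 1%N].
Proof. by []. Qed.

Lemma divisors_sum_split (p n : nat) (f : nat -> R) : prime p -> (0 < n)%N -> (p %| n)%N ->
  \sum_(d <- divisors n) f d =
  \sum_(d <- divisors n | ~~ (p %| d)%N) f d + \sum_(d <- divisors (n %/ p)) f (p * d)%N.
Proof.
move=> pp n0 pn; have p0 := prime_gt0 pp.
rewrite (bigID (fun d => p %| d)%N) /= addrC; congr (_ + _).
rewrite -big_filter.
have pe : perm_eq [seq d <- divisors n | (p %| d)%N] [seq (p * d)%N | d <- divisors (n %/ p)].
  apply: uniq_perm; first by rewrite filter_uniq ?divisors_uniq.
    by rewrite map_inj_uniq ?divisors_uniq // => x y /eqP; rewrite eqn_pmul2l // => /eqP.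
  move=> d; rewrite mem_filter -dvdn_divisors //.
  have np0 : (0 < n %/ p)%N by rewrite divn_gt0 // dvdn_leq.
  apply/andP/seq.mapP => [[/dvdnP [e ->] dn]|[e]].
    exists e; last by rewrite mulnC.
    by rewrite -dvdn_divisors // dvdn_divRL.
  rewrite -dvdn_divisors // dvdn_divRL // => en ->.
  by rewrite dvdn_mulr // mulnC.
by rewrite (perm_big _ pe) big_map.
Qed.

Lemma coprime_divisors_perm (p n : nat) : prime p -> (0 < n)%N -> (p %| n)%N ->
  perm_eq [seq d <- divisors n | ~~ (p %| d)%N] [seq d <- divisors (n %/ p) | ~~ (p %| d)%N].
Proof.
move=> pp n0 pn; have p0 := prime_gt0 pp.
have np0 : (0 < n %/ p)%N by rewrite divn_gt0 // dvdn_leq.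
apply: uniq_perm; rewrite ?filter_uniq ?divisors_uniq // => d.
rewrite !mem_filter -!dvdn_divisors //; case pd : (p %| d)%N => //=.
apply/idP/idP => dn; last by apply: dvdn_trans dn _; rewrite dvdn_div.
by rewrite dvdn_divRL // Gauss_dvd ?dn // coprime_sym prime_coprime // pd.
Qed.

Lemma coprime_divisors_sum (p n : nat) (f : nat -> R) : prime p -> (0 < n)%N -> (p %| n)%N ->
  \sum_(d <- divisors n | ~~ (p %| d)%N) f d =
  \sum_(d <- divisors (n %/ p) | ~~ (p %| d)%N) f d.
Proof.
move=> pp n0 pn; rewrite -[LHS]big_filter -[RHS]big_filter.
exact: perm_big (coprime_divisors_perm pp n0 pn).
Qed.

(** For a prime [p] dividing [n], the divisors [d] prime to [p] cancel against [p * d]; at the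
    remaining ones [moebius] is zero. *)
Lemma moebius_sum n : (0 < n)%N -> \sum_(d <- divisors n) moebius d = (n == 1%N)%:R.
Proof.
move=> n0; have [->|n1] := eqVneq n 1%N; first by rewrite divisors1 big_seq1.
have g1 : (1 < n)%N by lia.
set p := pdiv n; have pp : prime p := pdiv_prime g1.
have p0 := prime_gt0 pp.
have pn : (p %| n)%N := pdiv_dvd n.
have np0 : (0 < n %/ p)%N by rewrite divn_gt0 // dvdn_leq.
rewrite (divisors_sum_split _ pp n0 pn).
have -> : \sum_(d <- divisors (n %/ p)) moebius (p * d) =
  - \sum_(d <- divisors (n %/ p) | ~~ (p %| d)%N) moebius d.
  rewrite -sumrN [RHS]big_mkcond big_seq [RHS]big_seq; apply: eq_bigr => d.
  rewrite -dvdn_divisors // => dn; have d0 := dvdn_gt0 np0 dn.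
  by case: ifPn => pd; [exact: moebiusM_prime|rewrite moebius_sqr // -[(_ %| _)%N]negbK].
by rewrite (coprime_divisors_sum _ pp n0 pn) subrr.
Qed.

(** Induction on [n], removing a prime [p]: at [p * d] the value is that at [d] when [p] divides
    [d], it is [ln p] for [d = 1], and it is 0 otherwise. The divisors prime to [p] supply what is
    missing from the sum for [n %/ p]. *)
Lemma von_mangoldt_sum n : (0 < n)%N ->
  \sum_(d <- divisors n) von_mangoldt R d = ln (n%:R : R).
Proof.
have [k] := ubnP n; elim: k n => // k IH n lt n0.
have [->|n1] := eqVneq n 1%N; first by rewrite divisors1 big_seq1 ln1.
have g1 : (1 < n)%N by lia.
set p := pdiv n; have pp : prime p := pdiv_prime g1.
have p0 := prime_gt0 pp; have p1 := prime_gt1 pp.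
have pn : (p %| n)%N := pdiv_dvd n.
have np0 : (0 < n %/ p)%N by rewrite divn_gt0 // dvdn_leq.
rewrite (divisors_sum_split _ pp n0 pn).
have E d : (0 < d)%N -> von_mangoldt R (p * d) =
   (if (d == 1%N) then ln (p%:R : R) else 0) + (if (p %| d)%N then von_mangoldt R d else 0).
  move=> d0; have [->|d1] := eqVneq d 1%N.
    by rewrite muln1 dvdn1 gtn_eqF // /von_mangoldt primes_prime // addr0.
  rewrite add0r; case: ifPn => pd.
    rewrite /von_mangoldt; suff -> : primes (p * d) = primes d by [].
    apply/eq_primes => q; rewrite primesM // primes_prime // inE.
    by case: eqP => // ->; rewrite mem_primes pp d0 pd.
  have pe : perm_eq (primes (p * d)) (p :: primes d).
    apply: uniq_perm; rewrite ?primes_uniq //=.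
      by rewrite mem_primes pp d0 (negPf pd) primes_uniq.
    by move=> q; rewrite primesM // inE primes_prime // inE.
  have := perm_size pe; rewrite /von_mangoldt.
  case: (primes (p * d)) => [|q [|q' s]] //= [sd].
  have : (0 < size (primes d))%N.
    have g : (1 < d)%N by lia.
    by rewrite (@leq_trans (size [:: pdiv d])) //; apply: uniq_leq_size => // x;
      rewrite inE => /eqP ->; rewrite mem_primes pdiv_prime // d0 pdiv_dvd.
  by rewrite -sd.
have -> : \sum_(d <- divisors (n %/ p)) von_mangoldt R (p * d) =
   ln (p%:R : R) + \sum_(d <- divisors (n %/ p) | (p %| d)%N) von_mangoldt R d.
  transitivity (\sum_(d <- divisors (n %/ p)) ((if (d == 1%N) then ln (p%:R : R) else 0)
     + (if (p %| d)%N then von_mangoldt R d else 0))).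
    rewrite big_seq [RHS]big_seq; apply: eq_bigr => d; rewrite -dvdn_divisors // => dn.
    by rewrite E // (dvdn_gt0 np0 dn).
  rewrite big_split /= -!big_mkcond /=; congr (_ + _).
  rewrite -[LHS]big_filter filter_pred1_uniq ?big_seq1 ?divisors_uniq //.
  by rewrite -dvdn_divisors // dvd1n.
have -> : \sum_(d <- divisors n | ~~ (p %| d)%N) von_mangoldt R d =
  \sum_(d <- divisors (n %/ p) | ~~ (p %| d)%N) von_mangoldt R d.
  exact: coprime_divisors_sum.
have Em : \sum_(d <- divisors (n %/ p)) von_mangoldt R d = ln ((n %/ p)%:R : R).
  by apply: IH => //; rewrite -ltnS; apply: leq_trans lt; rewrite ltnS ltn_Pdiv.
have Eln : ln (n%:R : R) = ln (p%:R : R) + ln ((n %/ p)%:R : R).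
  by rewrite -lnM ?posrE ?ltr0n // -natrM mulnC divnK.
rewrite Eln -Em [X in _ = _ + X](bigID (fun d => p %| d)%N) /=.
by rewrite addrCA; congr (_ + _); rewrite addrC.
Qed.

Lemma divisors_dvd_perm (p n : nat) : (0 < n)%N -> (p %| n)%N ->
  perm_eq [seq d <- divisors n | (p %| d)%N] [seq (p * d)%N | d <- divisors (n %/ p)].
Proof.
move=> n0 pn; have p0 := dvdn_gt0 n0 pn.
apply: uniq_perm; first by rewrite filter_uniq ?divisors_uniq.
  by rewrite map_inj_uniq ?divisors_uniq // => x y /eqP; rewrite eqn_pmul2l // => /eqP.
move=> d; rewrite mem_filter -dvdn_divisors //.
have np0 : (0 < n %/ p)%N by rewrite divn_gt0 // dvdn_leq.
apply/andP/seq.mapP => [[/dvdnP [e ->] dn]|[e]].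
  exists e; last by rewrite mulnC.
  by rewrite -dvdn_divisors // dvdn_divRL.
rewrite -dvdn_divisors // dvdn_divRL // => en ->.
by rewrite dvdn_mulr // mulnC.
Qed.

Lemma divisors_sum_exchange (n : nat) (F : nat -> nat -> R) : (0 < n)%N ->
  \sum_(j <- divisors n) \sum_(l <- divisors (n %/ j)) F j l =
  \sum_(l <- divisors n) \sum_(j <- divisors (n %/ l)) F j l.
Proof.
move=> n0.
have E (f : nat -> nat -> R) : \sum_(j <- divisors n) \sum_(l <- divisors (n %/ j)) f j l =
  \sum_(j <- divisors n) \sum_(l <- divisors n) if (j * l %| n)%N then f j l else 0.
  rewrite big_seq [RHS]big_seq; apply: eq_bigr => j; rewrite -dvdn_divisors // => jn.
  have j0 := dvdn_gt0 n0 jn.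
  have nj0 : (0 < n %/ j)%N by rewrite divn_gt0 // dvdn_leq.
  rewrite -big_mkcond -[RHS]big_filter; apply: perm_big; apply: uniq_perm.
  - exact: divisors_uniq.
  - by rewrite filter_uniq ?divisors_uniq.
  move=> l; rewrite mem_filter -!dvdn_divisors // dvdn_divRL // mulnC.
  by case H : (j * l %| n)%N => //=; rewrite (dvdn_trans _ H) ?dvdn_mull.
rewrite E (E (fun l j => F j l)) exchange_big /=.
by apply: eq_bigr => l _; apply: eq_bigr => j _; rewrite mulnC.
Qed.

Lemma divisors_sum_quotient (n : nat) (F : nat -> nat -> R) : (0 < n)%N ->
  \sum_(m <- divisors n) \sum_(l <- divisors m) F (m %/ l)%N l =
  \sum_(l <- divisors n) \sum_(j <- divisors (n %/ l)) F j l.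
Proof.
move=> n0.
transitivity (\sum_(m <- divisors n) \sum_(l <- divisors n) if (l %| m)%N then F (m %/ l)%N l else 0).
  rewrite big_seq [RHS]big_seq; apply: eq_bigr => m; rewrite -dvdn_divisors // => mn.
  have m0 := dvdn_gt0 n0 mn.
  rewrite -big_mkcond -[RHS]big_filter; apply: perm_big; apply: uniq_perm.
  - exact: divisors_uniq.
  - by rewrite filter_uniq ?divisors_uniq.
  move=> l; rewrite mem_filter -!dvdn_divisors //.
  by case H : (l %| m)%N => //=; rewrite (dvdn_trans H).
rewrite exchange_big /= big_seq [RHS]big_seq; apply: eq_bigr => l.
rewrite -dvdn_divisors // => ln; have l0 := dvdn_gt0 n0 ln.
rewrite -big_mkcond -[LHS]big_filter (perm_big _ (divisors_dvd_perm n0 ln)) /= big_map.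
by apply: eq_bigr => j _; rewrite mulKn.
Qed.

(** Dirichlet convolution of the Moebius and von Mangoldt functions, both cut off at [U]; it lives
    on [m <= U * U]. *)
Definition vaughan_a (U m : nat) : R :=
  \sum_(l <- divisors m) if (l <= U)%N && (m %/ l <= U)%N
    then moebius (m %/ l) * von_mangoldt R l else 0.

(** Dirichlet convolution of the constant 1 with the part of the Moebius function beyond [U]. *)
Definition vaughan_b (U m : nat) : R :=
  \sum_(j <- divisors m) if (U < j)%N then moebius j else 0.

(** As sums over pairs with [j * l] dividing [n], the last three terms carry the indicators of
    [j <= U], of [j, l <= U] (subtracted) and of [j, l > U]. Together they give the indicator of
    [l > U], and by [moebius_sum] the sum over [j] leaves only [l = n]. *)
Lemma vaughan_pointwise (U n : nat) : (0 < n)%N ->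
  von_mangoldt R n = (if (n <= U)%N then von_mangoldt R n else 0)
   + (\sum_(j <- divisors n) if (j <= U)%N then moebius j * ln ((n %/ j)%N%:R : R) else 0)
   - \sum_(m <- divisors n) vaughan_a U m
   + \sum_(l <- divisors n) if (U < l)%N && (U < n %/ l)%N
        then vaughan_b U (n %/ l) * von_mangoldt R l else 0.
Proof.
move=> n0; pose L := von_mangoldt R.
have E1 : (\sum_(j <- divisors n) if (j <= U)%N then moebius j * ln ((n %/ j)%N%:R : R) else 0)
  = \sum_(l <- divisors n) \sum_(j <- divisors (n %/ l)) (if (j <= U)%N then moebius j * L l else 0).
  rewrite -divisors_sum_exchange // big_seq [RHS]big_seq; apply: eq_bigr => j.
  rewrite -dvdn_divisors // => jn; have j0 := dvdn_gt0 n0 jn.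
  have nj0 : (0 < n %/ j)%N by rewrite divn_gt0 // dvdn_leq.
  case: ifP => _; last by rewrite big1.
  by rewrite -mulr_sumr von_mangoldt_sum.
have E2 : \sum_(m <- divisors n) vaughan_a U m
  = \sum_(l <- divisors n) \sum_(j <- divisors (n %/ l))
      (if (l <= U)%N && (j <= U)%N then moebius j * L l else 0).
  by rewrite -divisors_sum_quotient.
have E3 : \sum_(l <- divisors n) (if (U < l)%N && (U < n %/ l)%N
        then vaughan_b U (n %/ l) * von_mangoldt R l else 0)
  = \sum_(l <- divisors n) \sum_(j <- divisors (n %/ l))
      (if (U < l)%N && (U < j)%N then moebius j * L l else 0).
  rewrite big_seq [RHS]big_seq; apply: eq_bigr => l; rewrite -dvdn_divisors // => ln.
  have l0 := dvdn_gt0 n0 ln.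
  have nl0 : (0 < n %/ l)%N by rewrite divn_gt0 // dvdn_leq.
  have [Ul|] := ltnP U l; last by move=> _ /=; rewrite big1.
  have [Un|Un] := ltnP U (n %/ l) => /=.
    rewrite /vaughan_b mulr_suml; apply: eq_bigr => j _.
    by case: ifP => // _; rewrite mul0r.
  rewrite big_seq big1 // => j; rewrite -dvdn_divisors // => /(dvdn_leq nl0) jn.
  by rewrite ltnNge (leq_trans jn Un).
rewrite E1 E2 E3 -addrA -addrA -sumrN -!big_split /=.
rewrite [X in _ = _ + X](_ : _ = if (n <= U)%N then 0 else L n).
  by case: ifP; rewrite ?addr0 ?add0r.
transitivity (\sum_(l <- divisors n) (if (U < l)%N && (n %/ l == 1)%N then L l else 0)).
  rewrite big_seq [RHS]big_seq; apply: eq_bigr => l; rewrite -dvdn_divisors // => ln.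
  have l0 := dvdn_gt0 n0 ln.
  have nl0 : (0 < n %/ l)%N by rewrite divn_gt0 // dvdn_leq.
  rewrite -sumrN -!big_split /=; case: ltnP => Ul /=.
    rewrite (eq_bigr (fun j => moebius j * L l)); last first.
      by move=> j _; case: ltnP => _ /=; rewrite ?oppr0 ?add0r ?addr0.
    by rewrite -mulr_suml moebius_sum //; case: eqP => _; rewrite ?mul1r ?mul0r.
  by apply: big1 => j _; case: ltnP => _ /=; rewrite ?oppr0 ?add0r ?addr0 ?addrN ?addr0.
have ne l : l \in divisors n -> (n %/ l == 1)%N = (l == n).
  rewrite -dvdn_divisors // => ln; have l0 := dvdn_gt0 n0 ln.
  apply/eqP/eqP => [E|->]; last by rewrite divnn n0.
  by rewrite -(divnK ln) E mul1n.
rewrite (eq_big_seq (fun l => if (l == n) then (if (U < n)%N then L n else 0) else 0)); last first.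
  by move=> l ln; rewrite ne //; case: eqP => [->|]; rewrite ?andbT ?andbF.
rewrite -big_mkcond -[LHS]big_filter filter_pred1_uniq ?divisors_uniq ?big_seq1 //; last first.
  by rewrite -dvdn_divisors.
by rewrite ltnNge; case: leqP.
Qed.

Lemma divisor_sum_swap (X : nat) (G : nat -> nat -> R[i]) :
  \sum_(1 <= n < X.+1) \sum_(m <- divisors n) G m (n %/ m)%N =
  \sum_(1 <= m < X.+1) \sum_(1 <= n < (X %/ m).+1) G m n.
Proof.
transitivity (\sum_(1 <= n < X.+1) \sum_(1 <= m < X.+1)
    if (m %| n)%N then G m (n %/ m)%N else 0).
  rewrite big_seq [RHS]big_seq; apply: eq_bigr => n; rewrite mem_index_iota => Hn.
  rewrite -big_mkcond -[RHS]big_filter; apply: perm_big; apply: uniq_perm.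
  - exact: divisors_uniq.
  - by rewrite filter_uniq ?iota_uniq.
  move=> m; rewrite mem_filter -dvdn_divisors ?mem_index_iota; last lia.
  case H : (m %| n)%N => //=.
  have := dvdn_leq _ H; have := @dvdn_gt0 m n _ H; lia.
rewrite exchange_big /= big_seq [RHS]big_seq; apply: eq_bigr => m.
rewrite mem_index_iota => Hm; have m0 : (0 < m)%N by lia.
rewrite -big_mkcond -[LHS]big_filter.
have pe : perm_eq [seq n <- index_iota 1 X.+1 | (m %| n)%N]
   [seq (m * n)%N | n <- index_iota 1 (X %/ m).+1].
  apply: uniq_perm; first by rewrite filter_uniq ?iota_uniq.
    by rewrite map_inj_uniq ?iota_uniq // => x y /eqP; rewrite eqn_pmul2l // => /eqP.
  move=> n; rewrite mem_filter mem_index_iota.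
  apply/andP/seq.mapP => [[/dvdnP [e ->] Hn]|[e]].
    exists e; last by rewrite mulnC.
    rewrite mem_index_iota ltnS leq_divRL //; nia.
  by rewrite mem_index_iota ltnS leq_divRL // => He ->; rewrite dvdn_mulr //; split => //; nia.
rewrite (perm_big _ pe) /= big_map; apply: eq_bigr => n _.
by rewrite mulKn.
Qed.

Local Open Scope complex_scope.

Lemma vaughan_identity (U X : nat) (f : nat -> R[i]) :
  \sum_(1 <= n < X.+1) (von_mangoldt R n)%:C * f n =
  \sum_(1 <= n < X.+1) (if (n <= U)%N then von_mangoldt R n else 0)%:C * f n
  + \sum_(1 <= m < X.+1) \sum_(1 <= n < (X %/ m).+1)
      (if (m <= U)%N then moebius m * ln (n%:R : R) else 0)%:C * f (m * n)%N
  - \sum_(1 <= m < X.+1) \sum_(1 <= n < (X %/ m).+1) (vaughan_a U m)%:C * f (m * n)%N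
  + \sum_(1 <= m < X.+1) \sum_(1 <= n < (X %/ m).+1)
      (if (U < n)%N && (U < m)%N then vaughan_b U m * von_mangoldt R n else 0)%:C * f (m * n)%N.
Proof.
rewrite -!divisor_sum_swap -sumrN -!big_split /=.
rewrite big_seq [RHS]big_seq; apply: eq_bigr => n; rewrite mem_index_iota => Hn.
have n0 : (0 < n)%N by lia.
have K (h : nat -> R) : \sum_(m <- divisors n) (h m)%:C * f (m * (n %/ m))%N
   = (\sum_(m <- divisors n) h m)%:C * f n.
  rewrite rmorph_sum mulr_suml big_seq [RHS]big_seq; apply: eq_bigr => m.
  by rewrite -dvdn_divisors // => mn; rewrite mulnC divnK.
rewrite (K (fun m => if (m <= U)%N then moebius m * ln ((n %/ m)%N%:R : R) else 0)) K.
rewrite (K (fun m => if (U < n %/ m)%N && (U < m)%N then vaughan_b U m * von_mangoldt R (n %/ m) else 0)).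
rewrite -mulrDl -mulrBl -mulrDl -rmorphD -rmorphB -rmorphD; congr (_%:C * _).
rewrite {1}(vaughan_pointwise U n0); congr (_ + _).
(* The outer divisor is now the argument of [vaughan_b] instead of that of [von_mangoldt]; the
   constraint [l == n %/ j] turns both single sums into one double sum whose order can be
   exchanged. *)
have := @divisors_sum_exchange n (fun j l => if (l == n %/ j)%N && (U < l)%N && (U < j)%N then vaughan_b U j * von_mangoldt R l else 0) n0.
have S1 (s : seq nat) a (F : nat -> R) : uniq s -> a \in s ->
    \sum_(l <- s) (if (l == a) then F l else 0) = F a.
  by move=> us aS; rewrite -big_mkcond -[LHS]big_filter filter_pred1_uniq // big_seq1.
rewrite big_seq (eq_bigr (fun j => if (U < n %/ j)%N && (U < j)%N then vaughan_b U j * von_mangoldt R (n %/ j) else 0)); last first.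
  move=> j; rewrite -dvdn_divisors // => jn; have j0 := dvdn_gt0 n0 jn.
  have nj0 : (0 < n %/ j)%N by rewrite divn_gt0 // dvdn_leq.
  rewrite -[RHS](S1 (divisors (n %/ j)) (n %/ j)%N (fun l => if (U < l)%N && (U < j)%N then vaughan_b U j * von_mangoldt R l else 0)) ?divisors_uniq //.
    by apply: eq_bigr => l _; case: eqP.
  by rewrite -dvdn_divisors.
rewrite -big_seq => ->.
rewrite big_seq [RHS]big_seq; apply: eq_bigr => l.
rewrite -dvdn_divisors // => ln; have l0 := dvdn_gt0 n0 ln.
have nl0 : (0 < n %/ l)%N by rewrite divn_gt0 // dvdn_leq.
rewrite -[LHS](S1 (divisors (n %/ l)) (n %/ l)%N (fun j => if (U < l)%N && (U < j)%N then vaughan_b U j * von_mangoldt R l else 0)) ?divisors_uniq //.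
  rewrite big_seq [RHS]big_seq; apply: eq_bigr => j; rewrite -dvdn_divisors // => jn.
  have jln : (j * l %| n)%N by move: jn; rewrite dvdn_divRL.
  have j0 := dvdn_gt0 nl0 jn.
  suff -> : (l == n %/ j)%N = (j == n %/ l)%N by case: eqP.
  have jn' : (j %| n)%N by apply: dvdn_trans jln; exact: dvdn_mulr.
  by rewrite (eqn_div _ j0 jn') (eqn_div _ l0 ln) mulnC.
by rewrite -dvdn_divisors.
Qed.

Lemma von_mangoldt_ge0 n : 0 <= von_mangoldt R n.
Proof.
rewrite /von_mangoldt; case E : (primes n) => [|p [|]] //.
apply: ln_ge0; rewrite ler1n prime_gt0 //.
have : p \in primes n by rewrite E mem_head.
by rewrite mem_primes => /andP [].
Qed.

Lemma von_mangoldt_le n : (0 < n)%N -> von_mangoldt R n <= ln (n%:R : R).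
Proof.
move=> n0; rewrite -von_mangoldt_sum // (bigD1_seq n) ?divisors_uniq //=; last first.
  by rewrite -dvdn_divisors.
by rewrite lerDl sumr_ge0 // => d _; exact: von_mangoldt_ge0.
Qed.

Lemma vaughan_a_le U m : (0 < m)%N -> `|vaughan_a U m| <= ln (m%:R : R).
Proof.
move=> m0; rewrite -von_mangoldt_sum //; apply: le_trans (ler_norm_sum _ _ _) _.
apply: ler_sum => l _; case: ifP => _; last by rewrite normr0 von_mangoldt_ge0.
rewrite normrM (ger0_norm (von_mangoldt_ge0 _)) -[leRHS]mul1r.
by apply: ler_wpM2r; [exact: von_mangoldt_ge0|exact: moebius_norm].
Qed.

Lemma vaughan_a_eq0 U m : (0 < m)%N -> (U * U < m)%N -> vaughan_a U m = 0.
Proof.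
move=> m0 Um; rewrite /vaughan_a big_seq big1 // => l; rewrite -dvdn_divisors // => lm.
case: ifP => // /andP [lU mlU]; have := divnK lm => E; exfalso.
by move: Um; rewrite -E ltnNge leq_mul.
Qed.

Lemma vaughan_b_le U m : `|vaughan_b U m| <= (size (divisors m))%:R.
Proof.
rewrite /vaughan_b; apply: le_trans (ler_norm_sum _ _ _) _.
rewrite -sum1_size natr_sum; apply: ler_sum => j _.
by case: ifP => _; [exact: moebius_norm|rewrite normr0].
Qed.
End Vaughan.

Local Open Scope complex_scope.

(** * Gaussian integers *)

Section GaussianIntegers.
Implicit Types z w x y : gaussInt.

Definition gsqn z : nat := (`|complex.Re z| ^ 2 + `|complex.Im z| ^ 2)%N.

Arguments gsqn z%_R.

Lemma gaussE (a b c d : int) :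
  ((a +i* b : gaussInt) * (c +i* d : gaussInt)) = ((a * c - b * d) +i* (a * d + b * c)).
Proof. by []. Qed.

Lemma gaussDE (a b c d : int) :
  ((a +i* b : gaussInt) + (c +i* d : gaussInt)) = ((a + c) +i* (b + d)).
Proof. by []. Qed.

Lemma gaussNE (a b : int) : - (a +i* b : gaussInt) = ((- a) +i* (- b)).
Proof. by []. Qed.

Lemma gauss_natE (n : nat) : n%:R = (n%:Z +i* 0) :> gaussInt.
Proof.
elim: n => // n IH; rewrite -natr1 IH -[1%R : gaussInt]/(1 +i* 0) gaussDE addr0.
by congr (_ +i* _); lia.
Qed.

Lemma gauss1E : 1 = (1 +i* 0) :> gaussInt. Proof. by []. Qed.

Lemma gsqnE (a b : int) : (gsqn (a +i* b))%:Z = a * a + b * b.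
Proof. by rewrite /gsqn /=; lia. Qed.

Lemma mul_gconj z : z * gconj z = (gsqn z)%:R.
Proof.
case: z => a b; rewrite gauss_natE gsqnE /gconj gaussE.
by congr (_ +i* _); ring.
Qed.

Lemma gconjM z w : gconj (z * w) = gconj z * gconj w.
Proof.
by case: z => a b; case: w => c d; rewrite /gconj !gaussE; congr (_ +i* _); ring.
Qed.

Lemma gconjD z w : gconj (z + w) = gconj z + gconj w.
Proof.
by case: z => a b; case: w => c d; rewrite /gconj !gaussDE; congr (_ +i* _); ring.
Qed.

Lemma gconjK z : gconj (gconj z) = z.
Proof. by case: z => a b; rewrite /gconj opprK. Qed.

Lemma gconj_nat n : gconj n%:R = n%:R.
Proof. by rewrite gauss_natE /gconj oppr0. Qed.

Lemma gsqnM z w : gsqn (z * w) = (gsqn z * gsqn w)%N.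
Proof.
apply/eqP; rewrite -eqz_nat PoszM; case: z => a b; case: w => c d.
by rewrite gaussE !gsqnE; apply/eqP; ring.
Qed.

Lemma leq_expr2w (m n e : nat) : (m <= n)%N -> (m ^ e <= n ^ e)%N.
Proof. by move=> h; elim: e => // e IH; rewrite !expnS leq_mul. Qed.

Lemma gsqnX z e : gsqn (z ^+ e) = (gsqn z ^ e)%N.
Proof. by elim: e => // e IH; rewrite exprS gsqnM IH expnS. Qed.

Lemma gsqn_conj z : gsqn (gconj z) = gsqn z.
Proof. by case: z => a b; rewrite /gsqn /= abszN. Qed.

Lemma gsqn_nat n : gsqn n%:R = (n ^ 2)%N.
Proof. by rewrite gauss_natE /gsqn /= exp0n // addn0. Qed.

Lemma gsqn_eq0 z : (gsqn z == 0%N) = (z == 0).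
Proof.
case: z => a b; rewrite /gsqn /= addn_eq0 !expn_eq0 /= !andbT !absz_eq0.
by rewrite eq_complex.
Qed.

Lemma gsqn_gt0 z : (0 < gsqn z)%N = (z != 0).
Proof. by rewrite lt0n gsqn_eq0. Qed.

Lemma gmul_eq0 z w : (z * w == 0) = (z == 0) || (w == 0).
Proof. by rewrite -!gsqn_eq0 gsqnM muln_eq0. Qed.

Lemma gmulfI z : z != 0 -> injective ( *%R z).
Proof.
move=> z0 x y /eqP; rewrite -subr_eq0 -mulrBr gmul_eq0 (negPf z0) subr_eq0.
by move/eqP.
Qed.

(** * Divisibility and Euclidean division in the Gaussian integers *)

Definition gdvd z w : Prop := exists x, w = x * z.

Lemma gdvd_refl z : gdvd z z. Proof. by exists 1; rewrite mul1r. Qed.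
Lemma gdvd_trans z w x : gdvd z w -> gdvd w x -> gdvd z x.
Proof. by move=> [u ->] [v ->]; exists (v * u); rewrite mulrA. Qed.
Lemma gdvd_mull z w x : gdvd z w -> gdvd z (x * w).
Proof. by move=> [u ->]; exists (x * u); rewrite mulrA. Qed.
Lemma gdvd_mulr z w x : gdvd z w -> gdvd z (w * x).
Proof. by rewrite mulrC; exact: gdvd_mull. Qed.
Lemma gdvdD z w x : gdvd z w -> gdvd z x -> gdvd z (w + x).
Proof. by move=> [u ->] [v ->]; exists (u + v); rewrite mulrDl. Qed.
Lemma gdvd_norm z w : gdvd z w -> (gsqn z %| gsqn w)%N.
Proof. by move=> [u ->]; rewrite gsqnM dvdn_mull. Qed.

Lemma gdvd_norm_le z w : w != 0 -> gdvd z w -> (gsqn z <= gsqn w)%N.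
Proof. by move=> w0 /gdvd_norm /dvdn_leq; apply; rewrite gsqn_gt0. Qed.

Lemma int_round (a : int) (n : nat) : (0 < n)%N ->
  exists k : int, (2 * `|(a - k * n%:Z)%R| <= n)%N.
Proof.
move=> n0; have nz : n%:Z != 0 by rewrite eqz_nat -lt0n.
have := divz_eq a n; have := modz_ge0 a nz.
have := ltz_pmod a (n0 : 0 < n%:Z).
set q := (a %/ n)%Z; set r := (a %% n)%Z => lt ge E.
have [le|gt] := leP (2 * r) n.
  by exists q; rewrite {1}E addrAC subrr add0r; lia.
by exists (q + 1); rewrite {1}E mulrDl mul1r opprD addrACA subrr add0r; lia.
Qed.

(** Both coordinates of [z * gconj w / gsqn w] are rounded; the error has norm at most 1/2. *)
Lemma geuclid z w : w != 0 -> exists q, (gsqn (z - q * w) < gsqn w)%N.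
Proof.
move=> w0; have n0 : (0 < gsqn w)%N by rewrite gsqn_gt0.
have [k1 H1] := int_round (complex.Re (z * gconj w)) n0.
have [k2 H2] := int_round (complex.Im (z * gconj w)) n0.
exists (k1 +i* k2); set r := z - _.
have Er : r * gconj w = z * gconj w - (k1 +i* k2 : gaussInt) * (gsqn w)%:R.
  by rewrite /r mulrBl -mulrA mul_gconj.
have : (gsqn (r * gconj w) * 2 <= gsqn w ^ 2)%N.
  rewrite Er; move: H1 H2; case: (z * gconj w) => a b /= H1 H2.
  rewrite gauss_natE gaussE gaussNE gaussDE mulr0 subr0 mulr0 add0r /gsqn /=.
  rewrite -/(gsqn w).
  move: (gsqn w) n0 H1 H2 => n n0; move: `|_|%N `|_|%N => X Y.
  by rewrite -!mulnn; nia.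
rewrite gsqnM gsqn_conj; nia.
Qed.

Lemma gbezout z w : exists d, [/\ gdvd d z, gdvd d w & exists x y, d = x * z + y * w].
Proof.
have [n] := ubnP (gsqn w); elim: n z w => // n IH z w lt.
have [->|w0] := eqVneq w 0.
  exists z; split; [exact: gdvd_refl|by exists 0; rewrite mul0r|].
  by exists 1, 0; rewrite mul1r mul0r addr0.
have [q Hq] := geuclid z w0.
have [|d [dw dr [x [y E]]]] := IH w (z - q * w); first by apply: leq_trans Hq _.
exists d; split=> //.
  by rewrite -[z](subrK (q * w)); apply: gdvdD => //; apply: gdvd_mull.
exists y, (x - y * q); rewrite E; ring.
Qed.

Definition gunit z : bool := gsqn z == 1%N.

Lemma gcoprime_cancel z w x : (exists u v, u * z + v * w = 1) ->
  gdvd z (w * x) -> gdvd z x.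
Proof.
move=> [u [v E]] [y Ey]; exists (u * x + v * y).
transitivity ((u * z + v * w) * x); first by rewrite E mul1r.
by rewrite [LHS]mulrDl -[v * w * x]mulrA Ey; ring.
Qed.

Definition gintbox (n : nat) : seq int :=
  [seq (i%:Z - n%:Z) | i <- iota 0 (2 * n).+1].

Lemma mem_gintbox n (a : int) : (a \in gintbox n) = (`|a| <= n)%N.
Proof.
apply/idP/idP.
  by case/seq.mapP => i; rewrite mem_iota => Hi ->; lia.
move=> Ha; apply/seq.mapP; exists (`|(a + n%:Z)%R|)%N; last by lia.
by rewrite mem_iota; lia.
Qed.

Lemma gintbox_uniq n : uniq (gintbox n).
Proof. by rewrite map_inj_uniq ?iota_uniq // => i j; lia. Qed.

Lemma size_gintbox n : size (gintbox n) = (2 * n).+1.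
Proof. by rewrite size_map size_iota. Qed.

Definition gbox (n : nat) : seq gaussInt :=
  [seq (a +i* b) | a <- gintbox n, b <- gintbox n].

Lemma mem_gbox n z : (z \in gbox n) = (`|complex.Re z| <= n)%N && (`|complex.Im z| <= n)%N.
Proof.
case: z => a b; rewrite -!mem_gintbox /=; apply/allpairsP/andP.
  by move=> [[c d] /= [Hc Hd [-> ->]]].
by move=> [Ha Hb]; exists (a, b).
Qed.

Lemma gbox_uniq n : uniq (gbox n).
Proof. by apply: allpairs_uniq; rewrite ?gintbox_uniq // => -[a b] [c d] _ _ [-> ->]. Qed.

Lemma size_gbox n : size (gbox n) = ((2 * n).+1 ^ 2)%N.
Proof. by rewrite size_allpairs !size_gintbox. Qed.

Lemma gsqn_box z n : (gsqn z <= n ^ 2)%N -> z \in gbox n.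
Proof.
rewrite mem_gbox /gsqn => H.
move: H; move: `|_|%N `|_|%N => X Y; rewrite -!mulnn => H.
by apply/andP; split; nia.
Qed.

(** * Divisors, primes and the divisor bound *)

Definition gdvdb z w : bool := `[< gdvd z w >].

Arguments gdvdb (z w)%_R.

Definition gdivisors z : seq gaussInt := [seq x <- gbox (gsqn z) | gdvdb x z].

Lemma gdivisorsP z w : z != 0 -> reflect (gdvd w z) (w \in gdivisors z).
Proof.
move=> z0; rewrite mem_filter; apply: (iffP andP) => [[/asboolP]|] // H.
split; first exact/asboolP.
apply: gsqn_box; apply: leq_trans (gdvd_norm_le z0 H) _.
by rewrite -mulnn leq_pmull // gsqn_gt0.
Qed.

Lemma gdivisors_uniq z : uniq (gdivisors z).
Proof. by rewrite filter_uniq ?gbox_uniq. Qed.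

Definition gdivcount z : nat := size (gdivisors z).

Arguments gdivcount z%_R.

(** A nonunit divisor of least norm: its gcd with any [w] is either a unit or of no smaller norm,
    hence associated to [p]. Primality takes the Bezout form used by [gdivcount_peel]. *)
Lemma gprime_exists z : z != 0 -> ~~ gunit z ->
  exists p, [/\ gdvd p z, (1 < gsqn p)%N &
    forall w, gdvd p w \/ exists u v, u * p + v * w = 1].
Proof.
move=> z0 nu.
have ex : exists n, [exists i : 'I_(size (gdivisors z)),
    let x := nth 0 (gdivisors z) i in (1 < gsqn x)%N && (gsqn x == n)].
  have zd : z \in gdivisors z by apply/gdivisorsP => //; exact: gdvd_refl.
  exists (gsqn z); apply/existsP.
  have lt : (index z (gdivisors z) < size (gdivisors z))%N by rewrite index_mem.
  exists (Ordinal lt); rewrite /= nth_index // eqxx andbT.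
  by move: nu; rewrite /gunit; have := gsqn_gt0 z; rewrite z0; lia.
have [n /existsP [i /andP [p1 /eqP pn]] Hmin] := ex_minnP ex.
set p := nth 0 _ i in p1 pn.
have pz : gdvd p z by apply/gdivisorsP => //; exact: mem_nth.
exists p; split=> // w; have [d [dp dw [x [y E]]]] := gbezout p w.
have p0 : p != 0 by rewrite -gsqn_gt0; lia.
have [du|ndu] := boolP (gunit d).
  right; exists (gconj d * x), (gconj d * y).
  by move/eqP: du => du; rewrite -!mulrA -mulrDr -E mulrC mul_gconj du.
left; have : (gsqn p <= gsqn d)%N.
  rewrite pn; apply: Hmin; apply/existsP.
  have dd : d \in gdivisors z by apply/gdivisorsP => //; exact: gdvd_trans dp pz.
  have lt : (index d (gdivisors z) < size (gdivisors z))%N by rewrite index_mem.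
  exists (Ordinal lt); rewrite /= nth_index // eqxx andbT.
  have d0 : d != 0 by case: dp p0 => c ->; rewrite gmul_eq0 negb_or => /andP [].
  by move: ndu; rewrite /gunit; have := gsqn_gt0 d; rewrite d0; lia.
move=> le; case: dp => c Ec; have : gunit c.
  have := gsqnM c d; rewrite -Ec => En; rewrite /gunit.
  have c0 : c != 0 by move: p0; rewrite Ec gmul_eq0 negb_or => /andP [].
  have := gsqn_gt0 c; rewrite c0; move/negbT: (erefl false) => _.
  move: p1; nia.
move=> cu; apply: gdvd_trans dw; rewrite Ec; exists (gconj c).
by rewrite mulrA [gconj c * c]mulrC mul_gconj (eqP cu) mul1r.
Qed.

Lemma gdvd_exp_max p z : z != 0 -> (1 < gsqn p)%N ->
  exists e, exists2 w, z = p ^+ e * w & ~ gdvd p w.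
Proof.
move=> z0 p1; have [n] := ubnP (gsqn z); elim: n z z0 => // n IH z z0 lt.
have [[x E]|nd] := pselect (gdvd p z); last by exists 0%N, z; rewrite ?expr0 ?mul1r.
have x0 : x != 0 by move: z0; rewrite E gmul_eq0 negb_or => /andP [].
have [|e [w Ew nw]] := IH x x0.
  have := gsqn_gt0 x; rewrite x0; have := gsqnM x p; rewrite -E; nia.
by exists e.+1, w => //; rewrite E Ew exprS; ring.
Qed.

(** A divisor is [p ^+ i * y] with [p] not dividing [y]; then [y] is prime to [p ^+ e], so it
    divides [w], and [i <= e]. *)
Lemma gdivcount_peel p e w : w != 0 -> (1 < gsqn p)%N ->
  (forall x, gdvd p x \/ exists u v, u * p + v * x = 1) -> ~ gdvd p w ->
  (gdivcount (p ^+ e * w) <= e.+1 * gdivcount w)%N.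
Proof.
move=> w0 p1 pp npw; have p0 : p != 0 by rewrite -gsqn_gt0; lia.
have z0 : p ^+ e * w != 0.
  by rewrite -gsqn_gt0 gsqnM gsqnX muln_gt0 expn_gt0 !gsqn_gt0 p0 w0.
rewrite /gdivcount -(size_iota 0 e.+1) -(size_allpairs (fun i x => p ^+ i * x)).
apply: uniq_leq_size => [|x]; first exact: gdivisors_uniq.
move/(gdivisorsP _ z0) => xd.
have x0 : x != 0 by case: xd z0 => c ->; rewrite gmul_eq0 negb_or => /andP [].
have [i [y Ey npy]] := gdvd_exp_max x0 p1.
have copy j : exists u v, u * y + v * p ^+ j = 1.
  have [/npy //|[u [v E]]] := pp y.
  elim: j => [|j [u' [v' E']]]; first by exists 0, 1; rewrite mul0r mul1r add0r expr0.
  exists (u' + v' * p ^+ j * v), (v' * u).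
  rewrite exprS -E' -[v' * p ^+ j in RHS]mulr1 -E; ring.
have yw j : gdvd y (p ^+ j * w) -> gdvd y w.
  by move=> H; apply: gcoprime_cancel H.
have ywd : gdvd y w.
  apply: (yw e); apply: gdvd_trans xd; rewrite Ey; exact: gdvd_mull (gdvd_refl _).
have ie : (i <= e)%N.
  rewrite leqNgt; apply/negP => ei; apply: npw.
  case: xd => c; rewrite Ey -(subnKC ei) exprD exprSr => E.
  exists (c * y * p ^+ (i - e.+1)).
  apply: (@gmulfI (p ^+ e)).
    by rewrite -gsqn_gt0 gsqnX expn_gt0 gsqn_gt0 p0.
  by rewrite E; ring.
by apply/allpairsP; exists (i, y); split; [rewrite mem_iota /= add0n ltnS|exact/gdivisorsP|].
Qed.

(** The left side is at most the falling factorial of [e + j], that is [j!] times a binomial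
    coefficient, and the latter is at most [2 ^ (e + j)]. *)
Lemma pow_le_exp2 (j e : nat) : (e.+1 ^ j <= j`! * 2 ^ j * 2 ^ e)%N.
Proof.
have H : (e.+1 ^ j <= (e + j) ^_ j)%N.
  elim: j => [|j IH]; first by rewrite ffactn0.
  rewrite expnS addnS ffactSS; apply: leq_mul => //; lia.
apply: leq_trans H _; rewrite -bin_ffact mulnC -mulnA leq_mul2l; apply/orP; right.
rewrite -expnD addnC [(j + e)%N]addnC.
have -> : (2 ^ (e + j) = \sum_(i < (e + j).+1) 'C(e + j, i))%N.
  by rewrite -[2%N]/(1 + 1)%N expnDn; apply: eq_bigr => i _; rewrite !exp1n !muln1.
have jl : (j < (e + j).+1)%N by lia.
by rewrite (bigD1 (Ordinal jl)) //= leq_addr.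
Qed.

(** All divisors in the box are counted, not only primes: peeling off a power of a small prime still
    lowers the count, as that prime leaves it, and the size of the box bounds it uniformly. *)
Definition gsmall (B : nat) z : nat := count (fun x => gdvdb x z) (gbox B).

(* A prime power [p ^ e] with norm of [p] at least [2 ^ j] costs nothing, since
   [(e + 1) ^ j <= 2 ^ (j * e)]; each of the finitely many other primes costs a
   constant factor. *)
Lemma gdivcount_bound_aux (j : nat) z : z != 0 ->
  (gdivcount z ^ j <= 5 ^ (2 * j) * (j`! * 2 ^ j) ^ gsmall (2 ^ j) z * gsqn z)%N.
Proof.
have [n] := ubnP (gsqn z); elim: n z => // n IH z lt z0.
have A0 : (0 < j`! * 2 ^ j)%N by rewrite muln_gt0 fact_gt0 expn_gt0.
have [u|nu] := boolP (gunit z).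
  have d9 : (gdivcount z <= 5 ^ 2)%N.
    rewrite /gdivcount size_filter; apply: leq_trans (count_size _ _) _.
    by rewrite size_gbox (eqP u).
  rewrite (eqP u) muln1; apply: leq_trans (leq_pmulr _ _); last by rewrite expn_gt0 A0.
  by rewrite expnM leq_expr2w.
have [p [pz p1 pp]] := gprime_exists z0 nu.
have [e [w Ew npw]] := gdvd_exp_max z0 p1.
have w0 : w != 0 by move: z0; rewrite Ew gmul_eq0 negb_or => /andP [].
have e0 : (0 < e)%N.
  by case: e Ew => // Ew; exfalso; apply: npw; move: pz; rewrite Ew expr0 mul1r.
have Nz : gsqn z = (gsqn p ^ e * gsqn w)%N by rewrite Ew gsqnM gsqnX.
have pe : (1 < gsqn p ^ e)%N by rewrite -(exp1n e) ltn_exp2r.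
have ltw : (gsqn w < n)%N.
  have := gsqn_gt0 w; rewrite w0; move: lt; rewrite Nz; nia.
have := IH w ltw w0; set K := (5 ^ _)%N; set A := (j`! * 2 ^ j)%N => H.
have sub x : gdvdb x w -> gdvdb x z.
  by move/asboolP => xw; apply/asboolP; rewrite Ew; exact: gdvd_mull.
have s1 : (gsmall (2 ^ j) w <= gsmall (2 ^ j) z)%N by exact: sub_count.
have step : (e.+1 ^ j * A ^ gsmall (2 ^ j) w <= A ^ gsmall (2 ^ j) z * gsqn p ^ e)%N.
  have [big|small] := leqP (2 ^ j) (gsqn p).
    rewrite mulnC; apply: leq_mul; first by rewrite leq_pexp2l.
    apply: leq_trans (_ : (2 ^ j) ^ e <= _)%N; last by rewrite leq_exp2r.
    by rewrite -expnM mulnC expnM; apply: leq_expr2w; exact: ltn_expl.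
  have s2 : (gsmall (2 ^ j) w < gsmall (2 ^ j) z)%N.
    have pb : p \in gbox (2 ^ j).
      by apply: gsqn_box; rewrite -mulnn; apply: leq_trans (ltnW small) _; rewrite leq_pmull ?expn_gt0.
    rewrite /gsmall -!size_filter.
    have u1 : uniq (p :: [seq x <- gbox (2 ^ j) | gdvdb x w]).
      rewrite cons_uniq filter_uniq ?gbox_uniq // andbT mem_filter negb_and.
      by apply/orP; left; apply/negP => /asboolP.
    apply: (uniq_leq_size u1) => x; rewrite inE => /orP [/eqP ->|].
      by rewrite mem_filter pb andbT; apply/asboolP.
    by rewrite !mem_filter => /andP [/sub -> ->].
  apply: leq_trans (_ : A * 2 ^ e * A ^ gsmall (2 ^ j) w <= _)%N.
    by rewrite leq_mul2r pow_le_exp2 orbT.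
  rewrite mulnAC -expnS; apply: leq_mul; first by rewrite leq_pexp2l.
  by rewrite leq_exp2r.
rewrite Nz Ew; apply: leq_trans (_ : (e.+1 * gdivcount w) ^ j <= _)%N.
  by apply: leq_expr2w; exact: gdivcount_peel.
rewrite -Ew expnMn.
apply: leq_trans (_ : e.+1 ^ j * (K * A ^ gsmall (2 ^ j) w * gsqn w) <= _)%N.
  by rewrite leq_mul2l H orbT.
have -> : (e.+1 ^ j * (K * A ^ gsmall (2 ^ j) w * gsqn w) =
   (e.+1 ^ j * A ^ gsmall (2 ^ j) w) * (K * gsqn w))%N by ring.
have -> : (K * A ^ gsmall (2 ^ j) z * (gsqn p ^ e * gsqn w) =
   (A ^ gsmall (2 ^ j) z * gsqn p ^ e) * (K * gsqn w))%N by ring.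
by rewrite leq_mul2r step orbT.
Qed.

(** The divisor bound: the number of divisors grows more slowly than any positive power of the
    norm. *)
Lemma gdivcount_bound (j : nat) : exists C, forall z, z != 0 ->
  (gdivcount z ^ j <= C * gsqn z)%N.
Proof.
exists (5 ^ (2 * j) * (j`! * 2 ^ j) ^ size (gbox (2 ^ j)))%N => z z0.
apply: leq_trans (gdivcount_bound_aux j z0) _; rewrite leq_mul2r leq_mul2l leq_pexp2l.
- by rewrite !orbT.
- by rewrite muln_gt0 fact_gt0 expn_gt0.
- exact: count_size.
Qed.

End GaussianIntegers.

(** * Primary Gaussian integers *)

Section PrimaryElements.
Implicit Types z w x y : gaussInt.

Definition primaryb z : bool :=
  let: r +i* s := z in (2 %| r - 1)%Z && (4 %| s - (r - 1))%Z.

Lemma primaryP z : reflect (primary z) (primaryb z).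
Proof.
have E : 2 * (1 + (0 +i* 1 : gaussInt)) = (2 +i* 2) by [].
case: z => r s; rewrite /primary /gcong E /primaryb.
apply: (iffP andP) => [[/dvdzP [a Ha] /dvdzP [b Hb]]|[[a b]]].
  exists ((a + b) +i* b); rewrite gauss1E gaussNE gaussDE gaussE.
  by congr (_ +i* _); lia.
rewrite gauss1E gaussNE gaussDE gaussE => -[H1 H2].
by split; apply/dvdzP; [exists (a - b)|exists b]; lia.
Qed.

Lemma primary_parity (r s : int) : primaryb (r +i* s) -> odd `|r| /\ ~~ odd `|s|.
Proof. by move=> /andP []; lia. Qed.

Lemma primary_norm_odd z : primaryb z -> odd (gsqn z).
Proof.
case: z => r s /primary_parity [or es].
by rewrite /gsqn /= oddD !oddX /= or (negPf es).
Qed.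

Lemma primary_neq0 z : primaryb z -> z != 0.
Proof. by move/primary_norm_odd; rewrite -gsqn_gt0; exact: odd_gt0. Qed.

Lemma primaryM z w : primaryb z -> primaryb w -> primaryb (z * w).
Proof.
move=> /primaryP [a Ha] /primaryP [b Hb]; apply/primaryP.
exists (a * w + b); rewrite mulrDr -Hb mulrA -Ha; ring.
Qed.

Lemma primary_divr z w : primaryb w -> primaryb (w * z) -> primaryb z.
Proof.
move=> /primaryP [a Ha] /primaryP [b Hb]; apply/primaryP.
exists (b - a * z); rewrite mulrBr -Hb mulrA -Ha; ring.
Qed.

Lemma primary_associate z : odd (gsqn z) -> exists2 e, gunit e & primaryb (e * z).
Proof.
case: z => a b; rewrite /gsqn /= oddD !oddX /= => o.
have [oa|ea] := boolP (odd `|a|).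
  have eb : ~~ odd `|b| by move: o; rewrite oa; case: odd.
  have [H|H] := boolP (4 %| b - (a - 1))%Z.
    by exists 1 => //; rewrite mul1r /primaryb H andbT; lia.
  by exists (-1) => //; rewrite mulN1r gaussNE /primaryb; lia.
have ob : odd `|b| by move: o; rewrite (negPf ea).
have [H|H] := boolP (4 %| a - (- b - 1))%Z.
  by exists (0 +i* 1) => //; rewrite gaussE /primaryb; lia.
by exists (0 +i* -1) => //; rewrite gaussE /primaryb; lia.
Qed.

Lemma gunit_cases c : gunit c -> [\/ c = 1, c = -1, c = (0 +i* 1) | c = (0 +i* -1)].
Proof.
case: c => a b; rewrite /gunit /gsqn /= => H.
have : (`|a| ^ 2 + `|b| ^ 2 = 1)%N by exact/eqP.
have [a0|a0] := eqVneq a 0.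
  rewrite a0 /= => E; have : (`|b| = 1)%N by move: E; rewrite -mulnn; nia.
  move=> Eb; have [->|->] : b = 1 \/ b = -1 by lia.
    by constructor 3.
  by constructor 4.
move=> E; have [Ea b0] : (`|a| = 1)%N /\ (`|b| = 0)%N by move: E; rewrite -!mulnn; nia.
have -> : b = 0 by lia.
have [->|->] : a = 1 \/ a = -1 by lia.
  by constructor 1.
by constructor 2.
Qed.

Lemma primary_unit_eq c w : gunit c -> primaryb w -> primaryb (c * w) -> c = 1.
Proof.
move=> /gunit_cases; case: w => a b.
case=> -> //; rewrite ?mulN1r ?gaussNE ?gaussE /primaryb; lia.
Qed.

(** * Primitive elements and their factorization by norm *)

Definition gprim z : bool := coprime `|complex.Re z| `|complex.Im z|.

Lemma gprim_dvd_nat z (n : nat) : gprim z -> gdvd n%:R z -> n = 1%N.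
Proof.
case: z => r s; rewrite /gprim /= => c [[a b]].
rewrite gauss_natE gaussE mulr0 subr0 mulr0 add0r => -[Er Es].
have : (n %| gcdn `|r| `|s|)%N by rewrite dvdn_gcd Er Es !abszM !dvdn_mull.
by rewrite (eqP c) dvdn1 => /eqP.
Qed.

(** With [x * r + y * s = 1], the combination of [z + gconj z] with coefficient [x] and
    [z - gconj z] with coefficient [-iy] equals 2. Subtracting it [k] times from
    [z * gconj z = 2 * k + 1] gives 1. *)
Lemma gprim_conj_bezout z : gprim z -> odd (gsqn z) ->
  exists u v, u * z + v * gconj z = 1.
Proof.
case: z => r s; rewrite /gprim /= => c o.
have [[x y] /= E] : exists xy : int * int, xy.1 * r + xy.2 * s = 1.
  have := Bezoutz r s => -[x [y E]]; exists (x, y) => /=; rewrite E.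
  by rewrite /gcdz (eqP c).
have [k Ek] : exists k : int, r * r + s * s = 2 * k + 1.
  by exists ((gsqn (r +i* s))./2)%:Z; rewrite -gsqnE; lia.
exists ((r - k * x) +i* (- s + k * y)), ((- (k * x)) +i* (- (k * y))).
rewrite !gaussE gaussDE gauss1E; congr (_ +i* _); last by ring.
transitivity (r * r + s * s - 2 * k * (x * r + y * s)); first by ring.
by rewrite Ek E; ring.
Qed.

(** Primitivity makes [z] and [gconj w] coprime, as the norm of a common divisor would divide
    [w * z]. So [w] is a combination of [w * z] and [m], both divisible by [w']; equal norms and
    primarity do the rest. *)
Lemma primary_factor_inj w z w' z' (m : nat) : primaryb w -> primaryb w' ->
  gsqn w = m -> gsqn w' = m -> w * z = w' * z' -> gprim (w * z) -> w = w'.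
Proof.
move=> pw pw' Nw Nw' E pr.
have key a b a' b' : gsqn a = m -> gsqn a' = m -> a * b = a' * b' ->
    gprim (a * b) -> gdvd a' a.
  move=> Na Na' Eab prab; have [d [[z1 Ez] [w1 Ew] [x [y Ed]]]] := gbezout b (gconj a).
  have du : gunit d.
    apply/eqP/(gprim_dvd_nat prab); exists (gconj w1 * z1).
    rewrite -[a]gconjK Ew gconjM Ez -mul_gconj; ring.
  have one : gconj d * x * b + gconj d * y * gconj a = 1.
    by rewrite -!mulrA -mulrDr -Ed mulrC mul_gconj (eqP du).
  have -> : a = gconj d * x * (a * b) + gconj d * y * m%:R.
    by rewrite -Na -mul_gconj -[LHS]mulr1 -one; ring.
  apply: gdvdD; first by rewrite Eab; apply/gdvd_mull/gdvd_mulr/gdvd_refl.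
  by rewrite -Na' -mul_gconj; apply/gdvd_mull/gdvd_mulr/gdvd_refl.
have [c Ec] := key _ _ _ _ Nw Nw' E pr.
have m0 : (0 < m)%N by rewrite -Nw gsqn_gt0 primary_neq0.
have cu : gunit c.
  have := gsqnM c w'; rewrite -Ec Nw Nw' => /eqP.
  by rewrite -{1}[m]mul1n eqn_pmul2r // eq_sym.
have := @primary_unit_eq c w' cu pw'; rewrite -Ec => /(_ pw) c1.
by rewrite Ec c1 mul1r.
Qed.

(** The factor is a gcd [d] of [z] and [m]. Its norm divides [m], because [d] and [gconj d] are
    coprime divisors of [m]; conversely [m] divides it, as is seen by expanding [(x * z + y * m)]
    times its conjugate. *)
Lemma primary_factor_exists z (m n : nat) : primaryb z -> gprim z ->
  gsqn z = (m * n)%N -> (0 < m)%N -> (0 < n)%N ->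
  exists w x, [/\ z = w * x, primaryb w, primaryb x, gsqn w = m & gsqn x = n].
Proof.
move=> pz prz Nz m0 n0; have oz := primary_norm_odd pz.
have [d [dz dm [x [y Ed]]]] := gbezout z m%:R.
have [u [v Euv]] := gprim_conj_bezout prz oz.
have [u' [v' Euv']] : exists u v, u * d + v * gconj d = 1.
  case: dz => a Ea; exists (u * a), (v * gconj a).
  by rewrite -Euv Ea gconjM; ring.
have d1 : gdvd (gsqn d)%:R m%:R.
  have [a Ea] := dm.
  have Ea' : m%:R = gconj a * gconj d by rewrite -gconjM -Ea gconj_nat.
  exists (u' * gconj a + v' * a).
  transitivity (u' * m%:R * d + v' * m%:R * gconj d).
    by transitivity ((u' * d + v' * gconj d) * m%:R); [rewrite Euv' mul1r|ring].
  have -> : u' * m%:R * d = u' * (gconj a * gconj d) * d by rewrite -Ea'.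
  have -> : v' * m%:R * gconj d = v' * (a * d) * gconj d by rewrite -Ea.
  by rewrite -mul_gconj; ring.
have d2 : gdvd m%:R (gsqn d)%:R.
  rewrite -mul_gconj Ed gconjD !gconjM gconj_nat.
  exists (x * gconj x * n%:R + x * z * gconj y + y * gconj x * gconj z + y * gconj y * m%:R).
  have zz : z * gconj z = m%:R * n%:R by rewrite mul_gconj Nz natrM.
  transitivity (x * gconj x * (z * gconj z) + x * z * gconj y * m%:R
     + y * m%:R * (gconj x * gconj z) + y * m%:R * (gconj y * m%:R)); first by ring.
  by rewrite zz; ring.
have Nd : gsqn d = m.
  apply/eqP; rewrite eqn_dvd -(@dvdn_pexp2r _ _ 2) // -[X in _ && X](@dvdn_pexp2r _ _ 2) //.
  by rewrite -!gsqn_nat !gdvd_norm.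
have od : odd (gsqn d) by move: oz; rewrite Nz Nd oddM => /andP [].
have [e eu pe] := primary_associate od.
have [x0 Ex] : gdvd (e * d) z.
  have [a Ea] := dz; exists (a * gconj e).
  rewrite Ea -[in LHS](mulr1 a) -[1 in LHS]/(1%:R : gaussInt) -(eqP eu) -mul_gconj; ring.
exists (e * d), x0.
have Ez : z = e * d * x0 by rewrite Ex mulrC.
have Ned : gsqn (e * d) = m by rewrite gsqnM (eqP eu) mul1n.
split=> //; first by apply: primary_divr pe _; rewrite -Ez.
by have /eqP := Nz; rewrite Ez gsqnM Ned eqn_pmul2l // => /eqP.
Qed.

Definition plist (n : nat) : seq gaussInt :=
  [seq z <- gbox n | primaryb z && (gsqn z == n)].

Lemma plistP n z : reflect (primaryb z /\ gsqn z = n) (z \in plist n).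
Proof.
rewrite mem_filter; apply: (iffP andP) => [[/andP [? /eqP]]|[pz Nz]] //.
split; first by rewrite pz Nz eqxx.
apply: gsqn_box; rewrite Nz -mulnn leq_pmull // -Nz gsqn_gt0.
exact: primary_neq0.
Qed.

Lemma plist_uniq n : uniq (plist n).
Proof. by rewrite filter_uniq ?gbox_uniq. Qed.

Lemma size_plist_le n : (0 < n)%N -> (size (plist n) <= gdivcount n%:R)%N.
Proof.
move=> n0; apply: uniq_leq_size; first exact: plist_uniq.
move=> x /plistP [px Nx]; apply/gdivisorsP.
  by rewrite -gsqn_eq0 gsqn_nat expn_eq0 negb_and -lt0n n0.
by rewrite -Nx -mul_gconj; exists (gconj x); rewrite mulrC.
Qed.

(** * The character [psi] and the multiplicative structure of [lambda] *)

Section Psi.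
Variable R : realType.
Local Notation nc := (@ComplexField.Normc.normc R).
Variables (chi : gaussInt -> R[i]) (k : int) (d : nat).
Hypothesis d0 : (1 <= d)%N.
Hypothesis hchi : gauss_character (4 * d)%:R chi.

Lemma lambdaE n : lambda chi k n = \sum_(z <- plist n) psi chi k z * jacobi_kubota R z.
Proof.
rewrite /lambda.
have -> : [set z : gaussInt | z * gconj z = n%:R /\ primary z]%classic = [set` plist n]%classic; last first.
  by rewrite -fsbig_seq ?plist_uniq.
apply/seteqP; split => z /=.
  move=> [Ez /primaryP pz]; apply/plistP; split => //.
  move: Ez; rewrite mul_gconj !gauss_natE => -[]; lia.
by move/plistP => [pz Nz]; split; [rewrite mul_gconj Nz|exact/primaryP].
Qed.

Lemma jacobi_kubota_prim z : primaryb z -> ~~ gprim z -> jacobi_kubota R z = 0.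
Proof.
case: z => r s /primary_parity [or _]; rewrite /gprim /= => nc.
have /eqP -> : jacobi s `|r| == 0 by rewrite jacobi_eq0 // coprime_sym.
by rewrite mulr0.
Qed.

(* Only primitive products matter, and a primitive primary element of norm
   [m * n] has exactly one factorization with norms [m] and [n]. *)
Lemma lambda_mul (m n : nat) : (0 < m)%N -> (0 < n)%N ->
  lambda chi k (m * n) = \sum_(w <- plist m) \sum_(z <- plist n)
    psi chi k (w * z) * jacobi_kubota R (w * z).
Proof.
move=> m0 n0; rewrite lambdaE; pose F z := psi chi k z * jacobi_kubota R z.
have E1 (s : seq gaussInt) : all primaryb s -> \sum_(z <- s) F z = \sum_(z <- s | gprim z) F z.
  move=> /allP ps; rewrite [RHS]big_mkcond big_seq [RHS]big_seq; apply: eq_bigr => z zs.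
  by case: ifPn => // np; rewrite /F jacobi_kubota_prim ?mulr0 ?ps.
pose L := [seq w * z | w <- plist m, z <- plist n].
have -> : \sum_(w <- plist m) \sum_(z <- plist n) psi chi k (w * z) * jacobi_kubota R (w * z)
   = \sum_(z <- L) F z by rewrite big_allpairs_dep.
rewrite (E1 (plist _)); last by apply/allP => z /plistP [].
rewrite (E1 L); last first.
  by apply/allP => z /allpairsP [[w x] /= [/plistP [pw _] /plistP [px _] ->]]; exact: primaryM.
rewrite -[LHS]big_filter -[RHS]big_filter; apply: perm_big; apply: uniq_perm.
- by rewrite filter_uniq ?plist_uniq.
- rewrite /L; set s1 := plist m; set s2 := plist n.
  have -> : [seq z <- [seq w * z | w <- s1, z <- s2] | gprim z]
    = [seq p.1 * p.2 | p <- [seq p <- [seq (w, z) | w <- s1, z <- s2] | gprim (p.1 * p.2)]].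
    transitivity [seq z <- [seq p.1 * p.2 | p <- [seq (w, z) | w <- s1, z <- s2]] | gprim z].
      by congr (seq.filter _ _); rewrite map_allpairs.
    by rewrite filter_map.
  rewrite map_inj_in_uniq; last first.
    move=> [w z] [w' z']; rewrite !mem_filter /=.
    move=> /andP [pr /allpairsP [[a b] /= [/plistP [pa Na] /plistP [pb Nb] [Ea Eb]]]].
    move=> /andP [_ /allpairsP [[a' b'] /= [/plistP [pa' Na'] /plistP [pb' Nb'] [Ea' Eb']]]] E.
    move: pr E; rewrite Ea Eb Ea' Eb' => pr E.
    have Ew : a = a' by apply: (primary_factor_inj pa pa' Na Na' E).
    by rewrite Ew; congr (_, _); move: E; rewrite Ew; apply: gmulfI; exact: primary_neq0.
  by rewrite filter_uniq // allpairs_uniq ?plist_uniq // => -[a b] [a' b'] _ _ [-> ->].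
move=> z; rewrite (mem_filter gprim) (mem_filter gprim); case pr : (gprim z) => //=; apply/idP/allpairsP.
  move/plistP => [pz Nz].
  have [w [x [Ez pw px Nw Nx]]] := primary_factor_exists pz pr Nz m0 n0.
  by exists (w, x); split=> //=; apply/plistP.
move=> [[w x] /= [/plistP [pw Nw] /plistP [px Nx] ->]].
by apply/plistP; split; [exact: primaryM|rewrite gsqnM Nw Nx].
Qed.

Lemma gcong_refl m z : gcong m z z.
Proof. by exists 0; rewrite subrr mulr0. Qed.

Lemma gcongM m z w x y : gcong m z w -> gcong m x y -> gcong m (z * x) (w * y).
Proof.
by move=> [a Ha] [b Hb]; exists (a * x + w * b); rewrite mulrDr [m * (a * x)]mulrA -Ha [m * (w * b)]mulrCA -Hb; ring.
Qed.

Lemma gcoprime_mul m z w : gcoprime (z * w) m <-> gcoprime z m /\ gcoprime w m.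
Proof.
split=> [[x H]|[[x Hx] [y Hy]]].
  split; [exists (w * x)|exists (z * x)]; first by rewrite mulrA.
  by rewrite mulrA [w * z]mulrC.
exists (x * y); have -> : z * w * (x * y) = (z * x) * (w * y) by ring.
by rewrite -[1]mulr1; exact: gcongM.
Qed.

Lemma chiM z w : chi (z * w) = chi z * chi w.
Proof.
have [c|nc] := pselect (gcoprime (z * w) (4 * d)%:R).
  by have [cz cw] := (gcoprime_mul _ _ _).1 c; exact: (gauss_characterM hchi).
rewrite (gauss_character_eq0 hchi nc).
have [cz|ncz] := pselect (gcoprime z (4 * d)%:R); last first.
  by rewrite (gauss_character_eq0 hchi ncz) mul0r.
have [cw|ncw] := pselect (gcoprime w (4 * d)%:R); last first.
  by rewrite (gauss_character_eq0 hchi ncw) mulr0.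
by exfalso; apply: nc; exact/gcoprime_mul.
Qed.

Lemma chi1 : chi 1 = 1.
Proof.
have c1 : gcoprime 1 (4 * d)%:R by exists 1; rewrite mulr1; exact: gcong_refl.
have := chiM 1 1; rewrite mulr1 -{1}[chi 1]mulr1.
by move/(mulfI (gauss_character_neq0 hchi c1)).
Qed.

Lemma gcong_nat_int (M : nat) (a b a' b' : int) :
  (M %| a - a')%Z -> (M %| b - b')%Z -> gcong M%:R (a +i* b) (a' +i* b').
Proof.
move=> /dvdzP [x Hx] /dvdzP [y Hy]; exists (x +i* y).
by rewrite gaussNE gaussDE gauss_natE gaussE Hx Hy; congr (_ +i* _); ring.
Qed.

(** Pigeonhole: two powers of [z] are congruent modulo [4 * d], so a nonzero value [chi z] is a root
    of unity. *)
Lemma chi_norm z : nc (chi z) <= 1.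
Proof.
have [c|ncz] := pselect (gcoprime z (4 * d)%:R); last first.
  by rewrite (gauss_character_eq0 hchi ncz) ComplexField.Normc.normc0.
set M := (4 * d)%N in c; have M0 : (0 < M)%N by rewrite muln_gt0.
pose res z := (`|(complex.Re z %% M)%Z|%N, `|(complex.Im z %% M)%Z|%N).
pose s := [seq res (z ^+ i) | i <- iota 0 (M * M).+1].
have nu : ~~ uniq s.
  apply/negP => us; have : (size s <= size [seq (i0, j0) | i0 <- iota 0 M, j0 <- iota 0 M])%N.
    apply: uniq_leq_size us _ => p /seq.mapP [i _ ->].
    have Mz : (M%:Z : int) != 0 by rewrite eqz_nat -lt0n.
    apply/allpairsP; exists (res (z ^+ i)); split; rewrite ?mem_iota //=.
      by have := ltz_pmod (complex.Re (z ^+ i)) (M0 : 0 < M%:Z);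
         have := modz_ge0 (complex.Re (z ^+ i)) Mz; lia.
    by have := ltz_pmod (complex.Im (z ^+ i)) (M0 : 0 < M%:Z);
       have := modz_ge0 (complex.Im (z ^+ i)) Mz; lia.
  by rewrite size_allpairs size_map !size_iota ltnn.
have /(uniqPn (0%N, 0%N)) [i [j [ij js E]]] := nu.
have {js E} E : res (z ^+ i) = res (z ^+ j).
  move: js E; rewrite size_map size_iota => js.
  by rewrite !(nth_map 0%N) ?size_iota ?nth_iota // (ltn_trans ij).
have cij : gcong M%:R (z ^+ i) (z ^+ j).
  have Mz : (M%:Z : int) != 0 by rewrite eqz_nat -lt0n.
  move: E; rewrite /res; case: (z ^+ i) (z ^+ j) => a b [a' b'] /= [Ea Eb].
  apply: gcong_nat_int; rewrite -eqz_mod_dvd; apply/eqP.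
    have := modz_ge0 a Mz; have := modz_ge0 a' Mz; lia.
  have := modz_ge0 b Mz; have := modz_ge0 b' Mz; lia.
have chiX n : chi (z ^+ n) = chi z ^+ n.
  by elim: n => [|n IH]; rewrite ?expr0 ?chi1 // !exprS chiM IH.
have := gauss_character_cong hchi cij; rewrite !chiX -(subnKC (ltnW ij)) exprD.
have nz := gauss_character_neq0 hchi c.
rewrite -{1}[chi z ^+ i]mulr1 => /mulfI; rewrite expf_eq0 (negPf nz) andbF => /(_ isT) /esym e1.
have : nc (chi z) ^+ (j - i) = 1 by rewrite -normcX e1 ComplexField.Normc.normc1.
move/eqP; rewrite pexpr_eq1 ?subn_eq0 ?normc_ge0 // -?lt0n ?subn_gt0 // => /eqP -> //.
Qed.

Definition gangle z : R[i] := gaussInt_to_complex R z / `|gaussInt_to_complex R z|.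

Lemma to_complexM z w : gaussInt_to_complex R (z * w) =
  gaussInt_to_complex R z * gaussInt_to_complex R w.
Proof.
case: z => a b; case: w => c e; rewrite gaussE /gaussInt_to_complex.
by simpc; rewrite !rmorphB !rmorphD !rmorphM.
Qed.

Lemma psiM z w : psi chi k (z * w) = psi chi k z * psi chi k w.
Proof.
by rewrite /psi chiM to_complexM normrM invfM mulrACA expfzMl mulrACA.
Qed.

Lemma normcXz (x : R[i]) (j : int) : nc x = 1 -> nc (x ^ j) = 1.
Proof.
move=> x1; case: j => n; first by rewrite -exprnP normcX x1 expr1n.
by rewrite NegzE -invr_expz -exprnP ComplexField.Normc.normcV normcX x1 expr1n invr1.
Qed.

Lemma gangle_norm z : z != 0 -> nc (gangle z) = 1.
Proof.
move=> z0; have nz : gaussInt_to_complex R z != 0.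
  case: z z0 => a b; rewrite !eq_complex /= !intr_eq0.
  by [].
rewrite /gangle ComplexField.Normc.normcM ComplexField.Normc.normcV normcE normcR.
rewrite ger0_norm ?normc_ge0 // divff //; apply: contra nz => /eqP.
by move/ComplexField.Normc.eq0_normc ->.
Qed.

Lemma psi_norm z : z != 0 -> nc (psi chi k z) <= 1.
Proof.
move=> z0; rewrite /psi normcM -/(gangle z) normcXz ?mulr1 ?chi_norm //.
exact: gangle_norm.
Qed.

Lemma jk_norm z : nc (jacobi_kubota R z) <= 1.
Proof.
case: z => r s; rewrite /jacobi_kubota normcM normcXz; last first.
  by rewrite /= expr0n /= add0r expr1n sqrtr1.
rewrite mul1r.
have -> : ((jacobi s `|r|)%:~R : R[i]) = ((jacobi s `|r|)%:~R : R)%:C by rewrite rmorph_int.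
by rewrite normcR -intr_norm -[leRHS]/(1%:~R) ler_int jacobi_norm_le1.
Qed.
End Psi.

End PrimaryElements.

(** * Complete sums of Jacobi symbols *)

Section Periodic.
Variable R : realType.

Lemma sum_iota_shift (f : nat -> R) (m n : nat) :
  \sum_(i <- iota m n) f i = \sum_(i <- iota 0 n) f (i + m)%N.
Proof. by rewrite -{1}[m]addn0 iotaDl big_map; apply: eq_bigr => i _; rewrite addnC. Qed.

Lemma periodic_sum_bound (f : nat -> R) (P n : nat) (c : R) : (0 < P)%N ->
  (forall i, f (i + P)%N = f i) -> \sum_(i <- iota 0 P) f i = 0 ->
  (forall i, `|f i| <= c) -> `|\sum_(i <- iota 0 n) f i| <= c * P%:R.
Proof.
move=> P0 fP f0 fc; have [k] := ubnP n; elim: k n => // k IH n lt.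
have c0 : 0 <= c by apply: le_trans (fc 0%N).
have [nP|Pn] := ltnP n P.
  apply: le_trans (ler_norm_sum _ _ _) _.
  apply: (@le_trans _ _ (\sum_(i <- iota 0 n) c)); first exact: ler_sum.
  rewrite big_const_seq count_predT size_iota iter_addr_0 -[c *+ n]mulr_natr.
  by apply: ler_wpM2l => //; rewrite ler_nat ltnW.
rewrite -(subnKC Pn) iotaD big_cat /= f0 add0r add0n sum_iota_shift.
under eq_bigr do rewrite fP.
by apply: IH; lia.
Qed.

Lemma periodic_reindex (f : nat -> R) (P : nat) (g : nat -> nat) : (0 < P)%N ->
  (forall i, f (i %% P)%N = f i) ->
  (forall i j, (i < P)%N -> (j < P)%N -> g i = g j %[mod P] -> i = j) ->
  \sum_(i <- iota 0 P) f (g i) = \sum_(i <- iota 0 P) f i.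
Proof.
move=> P0 fP ginj.
have pe : perm_eq [seq (g i %% P)%N | i <- iota 0 P] (iota 0 P).
  have un : uniq [seq (g i %% P)%N | i <- iota 0 P].
    by rewrite map_inj_in_uniq ?iota_uniq // => i j; rewrite !mem_iota => Hi Hj; apply: ginj; lia.
  apply: uniq_perm; rewrite ?iota_uniq //.
  have sub : {subset [seq (g i %% P)%N | i <- iota 0 P] <= iota 0 P}.
    by move=> x /seq.mapP [i _ ->]; rewrite mem_iota /= add0n ltn_pmod.
  by have [] := uniq_min_size un sub _; rewrite ?size_map.
by rewrite -[RHS](perm_big _ pe) big_map; apply: eq_bigr => i _; rewrite fP.
Qed.

Lemma periodic_modn (f : nat -> R) (P : nat) : (forall i, f (i + P)%N = f i) ->
  forall i, f (i %% P)%N = f i.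
Proof.
move=> fP i; rewrite [in RHS](divn_eq i P) addnC.
by elim: (i %/ P)%N => [|k IH]; rewrite ?mul0n ?addn0 // mulSn [(P + _)%N]addnC addnA fP.
Qed.

(** The range of [j] is cut into full periods, each giving a function of [i] with vanishing sum over
    a period, and a remainder shorter than [P]. Either part contributes at most [n * P]. *)
Lemma periodic_sum2_bound (f : nat -> nat -> R) (P n : nat) : (0 < P)%N ->
  (forall i j, f (i + P)%N j = f i j) -> (forall i j, f i (j + P)%N = f i j) ->
  \sum_(i <- iota 0 P) \sum_(j <- iota 0 P) f i j = 0 ->
  (forall i j, `|f i j| <= 1) ->
  `|\sum_(i <- iota 0 n) \sum_(j <- iota 0 n) f i j| <= 2 * n%:R * P%:R.
Proof.
move=> P0 fP1 fP2 f0 f1.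
pose g i := \sum_(j <- iota 0 P) f i j.
have gB i : `|g i| <= P%:R.
  apply: le_trans (ler_norm_sum _ _ _) _.
  apply: (@le_trans _ _ (\sum_(j <- iota 0 P) 1)); first exact: ler_sum.
  by rewrite big_const_seq count_predT size_iota iter_addr_0.
have rowE i (k r : nat) : \sum_(j <- iota 0 (k * P + r)) f i j =
   k%:R * g i + \sum_(j <- iota 0 r) f i j.
  elim: k => [|k IH]; first by rewrite mul0n add0n mul0r add0r.
  rewrite mulSn -addnA iotaD big_cat /= add0n [X in _ + X]sum_iota_shift.
  under [X in _ + X = _]eq_bigr do rewrite fP2.
  by rewrite IH addrA -[k.+1]add1n natrD mulrDl mul1r.
rewrite {2}(divn_eq n P).
under eq_bigr do rewrite rowE.
rewrite big_split /= -mulr_sumr; apply: le_trans (ler_normD _ _) _.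
have -> : 2 * n%:R * P%:R = n%:R * P%:R + n%:R * P%:R :> R by ring.
apply: lerD.
  rewrite normrM ger0_norm ?ler0n //.
  apply: (@le_trans _ _ ((n %/ P)%N%:R * (P%:R * P%:R))).
    apply: ler_wpM2l => //; apply: periodic_sum_bound => // i.
    by apply: eq_bigr => j _; rewrite fP1.
  rewrite mulrA; apply: ler_wpM2r; rewrite ?ler0n // -natrM ler_nat.
  exact: leq_divM.
apply: le_trans (ler_norm_sum _ _ _) _.
apply: (@le_trans _ _ (\sum_(i <- iota 0 n) P%:R)); last first.
  by rewrite big_const_seq count_predT size_iota iter_addr_0 -[_ *+ n]mulr_natl.
apply: ler_sum => i _; apply: le_trans (ler_norm_sum _ _ _) _.
apply: (@le_trans _ _ (\sum_(j <- iota 0 (n %% P)) 1)); first exact: ler_sum.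
by rewrite big_const_seq count_predT size_iota iter_addr_0 ler_nat ltnW // ltn_pmod.
Qed.

Definition issq (n : nat) : bool := [exists s : 'I_n.+1, (s * s == n)%N].

Lemma issqP n : reflect (exists s, n = s * s)%N (issq n).
Proof.
apply: (iffP existsP) => [[s /eqP <-]|[s E]]; first by exists s.
have lt : (s < n.+1)%N by rewrite E; nia.
by exists (Ordinal lt); rewrite /= E.
Qed.

(** If [m1 * m2 = s * s] then [s <= N], and [s] together with the divisor [m1] of [s * s] determines
    the pair. *)
Lemma square_pairs (N D : nat) :
  (forall s, (0 < s)%N -> (s <= N)%N -> (size (divisors (s * s)) <= D)%N) ->
  (\sum_(m1 <- iota 1 N) \sum_(m2 <- iota 1 N) issq (m1 * m2) <= N * D)%N.
Proof.
move=> HD.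
apply: (@leq_trans (\sum_(s <- iota 1 N) \sum_(m1 <- iota 1 N) \sum_(m2 <- iota 1 N) (s * s == m1 * m2))%N).
  rewrite [leqRHS]exchange_big /= big_seq [leqRHS]big_seq; apply: leq_sum => m1 H1.
  rewrite [leqRHS]exchange_big /= big_seq [leqRHS]big_seq; apply: leq_sum => m2 H2.
  case: issqP => // -[s E]; move: H1 H2; rewrite !mem_iota => H1 H2.
  have Hs : s \in iota 1 N.
    rewrite mem_iota; have : (s * s <= N * N)%N by rewrite -E leq_mul //; lia.
    have : (0 < s * s)%N by rewrite -E muln_gt0; lia.
    nia.
  by rewrite (bigD1_seq s) ?iota_uniq //= -E eqxx.
apply: (@leq_trans (\sum_(s <- iota 1 N) D)%N); last first.
  by rewrite big_const_seq count_predT size_iota iter_addn_0 mulnC.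
rewrite big_seq [leqRHS]big_seq; apply: leq_sum => s; rewrite mem_iota => Hs.
have s0 : (0 < s * s)%N by rewrite muln_gt0; lia.
apply: leq_trans (HD s _ _); [|lia|lia].
apply: (@leq_trans (\sum_(m1 <- iota 1 N) (m1 %| s * s))%N).
  rewrite big_seq [leqRHS]big_seq; apply: leq_sum => m1; rewrite mem_iota => H1.
  have m10 : (0 < m1)%N by lia.
  case H : (m1 %| s * s)%N; last first.
    rewrite big1 // => m2 _; apply/eqP; rewrite eqb0; apply/negP => /eqP E.
    by move: H; rewrite E dvdn_mulr.
  rewrite (eq_bigr (fun m2 => if (m2 == s * s %/ m1)%N then 1 else 0)%N); last first.
    move=> m2 _; rewrite eqn_div // mulnC eq_sym.
    by case: eqP.
  rewrite -big_mkcond sum1_count count_uniq_mem ?iota_uniq //.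
  exact: leq_b1.
rewrite (eq_bigr (fun m1 => if (m1 %| s * s)%N then 1 else 0)%N); last first.
  by move=> m1 _; case: (_ %| _)%N.
rewrite -big_mkcond sum1_count -size_filter; apply: uniq_leq_size.
  by rewrite filter_uniq ?iota_uniq.
by move=> m; rewrite mem_filter -dvdn_divisors // => /andP [].
Qed.

Lemma harmonic_ln (A : nat) : (0 < A)%N ->
  \sum_(i <- iota 1 A) (i%:R : R)^-1 <= 1 + ln (A%:R : R).
Proof.
elim: A => // -[_ _|A IH _]; first by rewrite /= big_seq1 invr1 ln1 addr0.
rewrite -[A.+2]addn1 iotaD big_cat /= big_seq1.
apply: le_trans (lerD (IH isT) (lexx _)) _.
rewrite -addrA lerD2l add1n addn1.
have -> : ln (A.+2%:R : R) = ln (A.+1%:R) - ln (A.+1%:R / A.+2%:R).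
  by rewrite ln_div ?posrE ?ltr0n // opprB addrCA subrr addr0.
rewrite lerD2l.
have : ln (A.+1%:R / A.+2%:R : R) <= A.+1%:R / A.+2%:R - 1.
  have := @le_ln1Dx R (A.+1%:R / A.+2%:R - 1); rewrite addrCA subrr addr0; apply.
  by rewrite ltrBDr addrC subrr divr_gt0 ?ltr0n.
have -> : A.+1%:R / A.+2%:R - 1 = - (A.+2%:R : R)^-1.
  have nz : (A.+2%:R : R) != 0 by rewrite pnatr_eq0.
  by apply: (mulIf nz); rewrite mulrBl divfK // mul1r mulNr mulVf // -[A.+2]addn1 natrD; ring.
by rewrite lerNr.
Qed.

(* Scaling by a nonresidue permutes the period and changes the sign. *)
Lemma jacobi_period_sum0 (n H : nat) : odd n -> ~~ issq n ->
  \sum_(i <- iota 0 n) ((jacobi (i%:Z - H%:Z) n)%:~R : R) = 0.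
Proof.
move=> on /negP ns; have n0 := odd_gt0 on.
have [t [ct jt]] := jacobi_nonresidue on (fun h => ns (introT (issqP n) h)).
pose f (i : nat) : R := (jacobi i n)%:~R.
have fP i : f (i + n)%N = f i.
  by rewrite /f (@jacobi_modP _ i) // PoszD addrAC subrr add0r.
have fm := periodic_modn fP.
(* Modulo [n], adding [H * n.-1] is subtracting [H], without leaving the natural numbers. *)
have E1 : \sum_(i <- iota 0 n) f (i + H * n.-1)%N = \sum_(i <- iota 0 n) f i.
  apply: periodic_reindex => // i j Hi Hj /eqP; rewrite eqn_modDr.
  by rewrite !modn_small // => /eqP.
have -> : \sum_(i <- iota 0 n) ((jacobi (i%:Z - H%:Z) n)%:~R : R) = \sum_(i <- iota 0 n) f i.
  rewrite -E1; apply: eq_bigr => i _; rewrite /f (@jacobi_modP _ (i + H * n.-1)%N) //.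
  have -> : i%:Z - H%:Z - (i + H * n.-1)%N%:Z = - (H%:Z * n%:Z) by nia.
  by rewrite rpredN dvdz_mull.
have E2 : \sum_(i <- iota 0 n) f (t * i)%N = \sum_(i <- iota 0 n) f i.
  apply: periodic_reindex => // i j Hi Hj.
  wlog ij : i j Hi Hj / (i <= j)%N.
    by move=> W E; case: (leqP i j) => [|/ltnW] L; [apply: W|apply/esym/W].
  move/esym/eqP; rewrite eqn_mod_dvd ?leq_mul2l ?ij ?orbT // -mulnBr Gauss_dvdr 1?coprime_sym //.
  have [lt|ge] := ltnP i j; last by lia.
  by move/dvdn_leq => /(_ _); rewrite subn_gt0 lt => /(_ isT); lia.
move: E2; have -> : \sum_(i <- iota 0 n) f (t * i)%N = - \sum_(i <- iota 0 n) f i.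
  by rewrite -sumrN; apply: eq_bigr => i _; rewrite /f PoszM jacobiMl // jt mulN1r rmorphN.
move=> /eqP; rewrite eq_sym -addr_eq0 -mulr2n mulrn_eq0 /= => /eqP //.
Qed.

Lemma jacobi_box_sum (n H : nat) : odd n -> ~~ issq n ->
  `|\sum_(y <- gintbox H) ((jacobi y n)%:~R : R)| <= n%:R.
Proof.
move=> on ns; rewrite big_map -[leRHS]mul1r.
apply: (periodic_sum_bound (f := fun i => (jacobi (i%:Z - H%:Z) n)%:~R)).
- exact: odd_gt0.
- move=> i; congr (_%:~R); apply: jacobi_modP => //.
  have -> : (i + n)%N%:Z - H%:Z - (i%:Z - H%:Z) = n%:Z by lia.
  exact: dvdzz.
- exact: jacobi_period_sum0.
- by move=> i; rewrite -intr_norm -[leRHS]/(1%:~R) ler_int jacobi_norm_le1.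
Qed.

(** Multiplying both coordinates by [t] multiplies both linear forms by [t], hence the product of
    symbols by [jacobi t (q1 * q2)]; a choice with value -1 makes the complete sum vanish. *)
Lemma jacobi_plane_sum (u1 v1 u2 v2 : int) (q1 q2 H : nat) : odd q1 -> odd q2 ->
  ~~ issq (q1 * q2) ->
  `|\sum_(z <- gbox H) ((jacobi (u1 * complex.Re z - v1 * complex.Im z) q1)%:~R *
      (jacobi (u2 * complex.Re z - v2 * complex.Im z) q2)%:~R : R)|
   <= 2 * (2 * H).+1%:R * (q1 * q2)%:R.
Proof.
move=> o1 o2 /negP ns; set P := (q1 * q2)%N.
have oP : odd P by rewrite oddM o1.
have P0 := odd_gt0 oP.
pose F (a b : int) : R := (jacobi (u1 * a - v1 * b) q1)%:~R * (jacobi (u2 * a - v2 * b) q2)%:~R.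
have Fmod (a b a' b' : int) : (P %| a - a')%Z -> (P %| b - b')%Z -> F a b = F a' b'.
  move=> Ha Hb.
  have dv (q : nat) : (q %| P)%N -> forall u v : int, (q %| u * a - v * b - (u * a' - v * b'))%Z.
    move=> qP u v.
    have -> : u * a - v * b - (u * a' - v * b') = u * (a - a') - v * (b - b') by ring.
    have qP' : (q%:Z %| P%:Z)%Z by rewrite dvdzE.
    by rewrite rpredB // dvdz_mull // (dvdz_trans qP').
  rewrite /F (jacobi_modP o1 (dv q1 _ u1 v1)) ?dvdn_mulr //.
  by rewrite (jacobi_modP o2 (dv q2 _ u2 v2)) ?dvdn_mull.
have F1 a b : `|F a b| <= 1.
  rewrite /F normrM -[leRHS]mul1r; apply: ler_pM => //;
  by rewrite -intr_norm -[leRHS]/(1%:~R) ler_int jacobi_norm_le1.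
pose f (i j : nat) := F (i%:Z - H%:Z) (j%:Z - H%:Z).
have -> : \sum_(z <- gbox H) ((jacobi (u1 * complex.Re z - v1 * complex.Im z) q1)%:~R *
      (jacobi (u2 * complex.Re z - v2 * complex.Im z) q2)%:~R : R) =
   \sum_(i <- iota 0 (2 * H).+1) \sum_(j <- iota 0 (2 * H).+1) f i j.
  rewrite /gbox big_allpairs_dep big_map; apply: eq_bigr => i _; rewrite big_map.
  by apply: eq_bigr => j _.
apply: periodic_sum2_bound => //; last by move=> i j; exact: F1.
- move=> i j; apply: Fmod; last by rewrite subrr dvdz0.
  by have -> : (i + P)%N%:Z - H%:Z - (i%:Z - H%:Z) = P%:Z by lia.
- move=> i j; apply: Fmod; first by rewrite subrr dvdz0.
  by have -> : (j + P)%N%:Z - H%:Z - (j%:Z - H%:Z) = P%:Z by lia.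
have [t [ct jt]] := jacobi_nonresidue oP (fun h => ns (introT (issqP _) h)).
have shift (g : int -> R) : (forall a a', (P %| a - a')%Z -> g a = g a') ->
    \sum_(i <- iota 0 P) g (i%:Z - H%:Z) = \sum_(i <- iota 0 P) g i%:Z.
  move=> gP; rewrite -[RHS](@periodic_reindex (fun i => g i%:Z) P (fun i => i + H * P.-1)%N) //.
  - apply: eq_bigr => i _; apply: gP.
    have -> : i%:Z - H%:Z - (i + H * P.-1)%N%:Z = - (H%:Z * P%:Z) by nia.
    by rewrite rpredN dvdz_mull.
  - by apply: periodic_modn => i; apply: gP; rewrite PoszD addrAC subrr add0r.
  - by move=> i j Hi Hj /eqP; rewrite eqn_modDr !modn_small // => /eqP.
have scale (g : int -> R) : (forall a a', (P %| a - a')%Z -> g a = g a') ->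
    \sum_(i <- iota 0 P) g (t%:Z * i%:Z) = \sum_(i <- iota 0 P) g i%:Z.
  move=> gP; rewrite -[RHS](@periodic_reindex (fun i => g i%:Z) P (fun i => t * i)%N) //.
  - by apply: periodic_modn => i; apply: gP; rewrite PoszD addrAC subrr add0r.
  move=> i j Hi Hj.
  wlog ij : i j Hi Hj / (i <= j)%N.
    by move=> W E; case: (leqP i j) => [|/ltnW] L; [apply: W|apply/esym/W].
  move/esym/eqP; rewrite eqn_mod_dvd ?leq_mul2l ?ij ?orbT // -mulnBr Gauss_dvdr 1?coprime_sym //.
  have [lt|ge] := ltnP i j; last by lia.
  by move/dvdn_leq => /(_ _); rewrite subn_gt0 lt => /(_ isT); lia.
have Fb a b b' : (P %| b - b')%Z -> F a b = F a b'.
  by move=> Hb; apply: Fmod => //; rewrite subrr dvdz0.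
have Fa a a' b : (P %| a - a')%Z -> F a b = F a' b.
  by move=> Ha; apply: Fmod => //; rewrite subrr dvdz0.
have E1 : \sum_(i <- iota 0 P) \sum_(j <- iota 0 P) f i j =
   \sum_(i <- iota 0 P) \sum_(j <- iota 0 P) F i%:Z j%:Z.
  transitivity (\sum_(i <- iota 0 P) \sum_(j <- iota 0 P) F (i%:Z - H%:Z) j%:Z).
    by apply: eq_bigr => i _; rewrite (shift (fun b => F _ b)) // => a a' /Fb.
  by rewrite (shift (fun a => \sum_(j <- iota 0 P) F a j%:Z)) // => a a' h;
     apply: eq_bigr => j _; exact: Fa.
have E2 : \sum_(i <- iota 0 P) \sum_(j <- iota 0 P) F i%:Z j%:Z =
   \sum_(i <- iota 0 P) \sum_(j <- iota 0 P) F (t%:Z * i%:Z) (t%:Z * j%:Z).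
  transitivity (\sum_(i <- iota 0 P) \sum_(j <- iota 0 P) F i%:Z (t%:Z * j%:Z)).
    by apply: eq_bigr => i _; rewrite (scale (fun b => F _ b)) // => a a' /Fb.
  by rewrite (scale (fun a => \sum_(j <- iota 0 P) F a (t%:Z * j%:Z))) // => a a' h;
     apply: eq_bigr => j _; exact: Fa.
have E3 a b : F (t%:Z * a) (t%:Z * b) = - F a b.
  rewrite /F.
  have -> : u1 * (t%:Z * a) - v1 * (t%:Z * b) = t%:Z * (u1 * a - v1 * b) by ring.
  have -> : u2 * (t%:Z * a) - v2 * (t%:Z * b) = t%:Z * (u2 * a - v2 * b) by ring.
  rewrite !jacobiMl // !rmorphM /= mulrACA -rmorphM /=.
  by rewrite -jacobiMr ?odd_gt0 // jt rmorphN mulN1r.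
have : \sum_(i <- iota 0 P) \sum_(j <- iota 0 P) F i%:Z j%:Z =
     - \sum_(i <- iota 0 P) \sum_(j <- iota 0 P) F i%:Z j%:Z.
  rewrite {1}E2 -sumrN; apply: eq_bigr => i _; rewrite -sumrN.
  by apply: eq_bigr => j _; exact: E3.
by rewrite E1 => /eqP; rewrite -addr_eq0 -mulr2n mulrn_eq0 /= => /eqP.
Qed.

End Periodic.

(** * Type I sums *)

Section TypeOne.
Variable R : realType.
Local Notation nc := (@ComplexField.Normc.normc R).

(** Residues and signs are separate arguments: two elements with the same data then have the same
    phase by mere rewriting. *)
Definition jk_phase (u8 : int) (nu : bool) (a8 : int) (na : bool) (r8 : int)
    (nr : bool) (b : int) : R[i] :=
  ('i : R[i]) ^ ((r8 - 1) %/ 2)%Z * (-1) ^+ jk_bit u8 nu a8 na r8 nr b.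

Lemma nc_i : nc 'i = 1.
Proof. by rewrite /= expr0n /= add0r expr1n sqrtr1. Qed.

Lemma nc_phase u8 nu a8 na r8 nr b : nc (jk_phase u8 nu a8 na r8 nr b) = 1.
Proof.
rewrite /jk_phase normcM normcXz ?nc_i // mul1r normcX normcN.
by rewrite ComplexField.Normc.normc1 expr1n.
Qed.

Lemma expi_mod8 (r : int) : odd `|r| ->
  ('i : R[i]) ^ ((r - 1) %/ 2)%Z = ('i : R[i]) ^ (((r %% 8)%Z - 1) %/ 2)%Z.
Proof.
move=> o; have ni : ('i : R[i]) != 0.
  by apply/eqP => E; have := nc_i; rewrite E ComplexField.Normc.normc0 => /eqP; rewrite eq_sym oner_eq0.
have -> : ((r - 1) %/ 2)%Z = (((r %% 8)%Z - 1) %/ 2)%Z + 4 * (r %/ 8)%Z by lia.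
rewrite expfzDr // -exprz_exp.
have -> : ('i : R[i]) ^ 4 = 1 by rewrite -exprnP (exprM _ 2 2) sqr_i sqrrN expr1n.
by rewrite exp1rz mulr1.
Qed.

Lemma gsqn_abs (u v : int) : gsqn (u +i* v) = `|(u * u + v * v)%R|%N.
Proof. by have := gsqnE u v; lia. Qed.

Lemma jk_mul (u v a b : int) : primaryb (u +i* v) -> primaryb (a +i* b) -> b != 0 ->
  let r := u * a - v * b in
  jacobi_kubota R ((u +i* v : gaussInt) * (a +i* b)) =
  jk_phase (u %% 8)%Z (u < 0) (a %% 8)%Z (a < 0) (r %% 8)%Z (r < 0) b *
  ((jacobi v `|u|)%:~R * (jacobi b `|a|)%:~R * (jacobi r (gsqn (u +i* v)))%:~R).
Proof.
move=> pu pa b0 r; have [ou ev] := primary_parity pu; have [oa eb] := primary_parity pa.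
have orr : odd `|r| by rewrite odd_abszB !odd_abszM ou oa (negPf ev).
rewrite gaussE /jacobi_kubota -/r [u * b + v * a]addrC (jacobi_symbol ou oa ev eb b0) -/r -gsqn_abs.
rewrite expi_mod8 // /jk_phase -!mulrA; congr (_ * _).
by rewrite !rmorphM /= rmorphXn rmorphN rmorph1.
Qed.

(** By cancellation each [z] occurs with at most one [x], so only the factors [z] of [y] have to be
    counted. *)
Lemma divisor_pairs_le (G : pzRingType) (s1 s2 : seq G) (y : G) :
  uniq s1 -> (forall z x x', z \in s2 -> x * z = x' * z -> x = x') ->
  \sum_(x <- s1) \sum_(z <- s2) (x * z == y)%:R <=
  (size [seq z <- s2 | has (fun x => x * z == y) s1])%:R :> R.
Proof.
move=> u1 canc; rewrite exchange_big /= size_filter -sum1_count natr_sum [leRHS]big_mkcond /=.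
rewrite big_seq [leRHS]big_seq; apply: ler_sum => z zs.
case: ifPn => [/hasP [x0 x0s /eqP E]|nh].
  rewrite (bigD1_seq x0) //= E eqxx big1 ?addr0 // => x nx.
  case: eqP => // E'; have := canc z x x0 zs; rewrite E E' => /(_ erefl) xx.
  by rewrite xx eqxx in nx.
rewrite big_seq big1 // => x xs; case: eqP => // E.
by case/negP: nh; apply/hasP; exists x => //; apply/eqP.
Qed.

Lemma sum_abs_box (A : nat) (F : nat -> R) : (forall n, 0 <= F n) ->
  \sum_(a <- [seq a <- gintbox A | a != 0]) F `|a|%N <= 2 * \sum_(m <- iota 1 A) F m.
Proof.
move=> F0; pose s2 : seq int := map Posz (iota 1 A) ++ map (fun i => - Posz i) (iota 1 A).
apply: (@le_trans _ _ (\sum_(a <- s2) F `|a|%N)).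
  apply: ler_sum_subset; rewrite ?filter_uniq ?gintbox_uniq // => a.
  rewrite mem_filter mem_gintbox mem_cat => /andP [a0 aA].
  apply/orP; have [ge|lt] := lerP 0 a; [left|right].
    by apply/seq.mapP; exists `|a|%N; rewrite ?mem_iota; lia.
  by apply/seq.mapP; exists `|a|%N; rewrite ?mem_iota; lia.
rewrite /s2 big_cat /= !big_map mulr_natl mulr2n.
by apply: lerD => //; under eq_bigr do rewrite abszN.
Qed.

(** Zero at even [a], so that multiplicativity in [b], available for odd moduli, holds for every
    [a]. *)
Definition kap1 (a b : int) : R := if odd `|a| then (jacobi b `|a|)%:~R else 0.

Lemma jacobi_intr_le1 (x : int) n : `|(jacobi x n)%:~R : R| <= 1.
Proof. by rewrite -intr_norm -[leRHS]/(1%:~R) ler_int jacobi_norm_le1. Qed.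

Lemma kap1_le1 a b : `|kap1 a b| <= 1.
Proof.
rewrite /kap1; case: ifP => _; last by rewrite normr0 ler01.
exact: jacobi_intr_le1.
Qed.

Lemma int_divisors_le (A : nat) (y : int) : y != 0 ->
  (size [seq z <- [seq b <- gintbox A | b != 0%R] | (z %| y)%Z] <= 2 * size (divisors `|y|))%N.
Proof.
move=> y0; pose s2 : seq int := map Posz (divisors `|y|) ++ map (fun i => - Posz i) (divisors `|y|).
apply: (@leq_trans (size s2)); last first.
  by rewrite size_cat !size_map mul2n addnn.
have ay : (0 < `|y|)%N by rewrite absz_gt0.
apply: uniq_leq_size; first by rewrite !filter_uniq ?gintbox_uniq.
move=> z; rewrite mem_filter => /andP [zy _]; rewrite mem_cat.
apply/orP; have [ge|lt] := lerP 0 z; [left|right]; apply/seq.mapP; exists `|z|%N; try lia.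
- by rewrite -dvdn_divisors.
- by rewrite -dvdn_divisors.
Qed.

(** The power 3 balances the two contributions: about [A] pairs with square product and sums of
    length [A ^ 3], against [A ^ 2] other pairs with sums at most [A ^ 2]. The result [A ^ 7] saves
    a factor [A] over the trivial [A ^ 8]. *)
Lemma typeI_moment (A D : nat) (beta : int -> R) : (0 < A)%N ->
  (forall n, (0 < n)%N -> (n <= A ^ 4)%N -> (2 * size (divisors n) <= D)%N) ->
  (forall b, b \in [seq b <- gintbox A | b != 0] -> `|beta b| <= 1) ->
  (\sum_(a <- [seq a <- gintbox A | odd `|a|])
     `|\sum_(b <- [seq b <- gintbox A | b != 0]) beta b * kap1 a b| ^+ 3) ^+ 2 <=
  63 * D%:R ^+ 5 * A%:R ^+ 7.
Proof.
move=> A0 HD b1; set W := [seq a <- gintbox A | odd `|a|]; set Zs := [seq b <- _ | _].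
pose Box j := [seq y <- gintbox (A ^ j.+1) | y != 0].
have D2 : (2 <= D)%N.
  by have := HD 1%N isT; rewrite expn_gt0 A0 /= => /(_ isT); rewrite /= muln1.
have mBox j y : (y \in Box j) = (y != 0) && (`|y| <= A ^ j.+1)%N.
  by rewrite mem_filter mem_gintbox.
have HV := @power_moment R int int Zs Box kap1 (fun=> 1) D%:R _ _ _ _ _ beta 2 W (gintbox (A ^ 3)).
have {}HV : (\sum_(w <- W) `|\sum_(z <- Zs) beta z * kap1 w z| ^+ 3) ^+ 2 <=
  (D%:R ^+ 2) ^+ 2 * ((size (gintbox (A ^ 3)))%:R *
     \sum_(w1 <- W) \sum_(w2 <- W) `|\sum_(y <- gintbox (A ^ 3)) kap1 w1 y * kap1 w2 y|).
  apply: HV.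
  - move=> w x z; rewrite /kap1; case: ifP => o; last by rewrite mul0r mulr0.
    by rewrite mul1r jacobiMl // rmorphM.
  - by move=> j; rewrite filter_uniq ?gintbox_uniq.
  - by rewrite /Box expn1.
  - move=> j x z; rewrite !mBox mem_filter mem_gintbox => /andP [x0 xA] /andP [z0 zA].
    by rewrite mulf_neq0 //= abszM [(A ^ j.+2)%N]expnSr leq_mul.
  - exact: ler0n.
  - move=> j y jk yB; move: (yB); rewrite mBox => /andP [y0 yA].
    apply: le_trans (divisor_pairs_le _ _ _) _.
    + by rewrite filter_uniq ?gintbox_uniq.
    + by move=> z x x'; rewrite mem_filter => /andP [z0 _]; apply: mulIf.
    rewrite ler_nat; apply: leq_trans (HD `|y|%N _ _); last 2 first.
    + by rewrite absz_gt0.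
    + by apply: leq_trans yA _; rewrite leq_pexp2l //; lia.
    apply: leq_trans (int_divisors_le A y0); rewrite !size_filter.
    apply: sub_count => z /hasP [x _ /eqP <-]; exact: dvdz_mull (dvdzz _).
  - exact: b1.
  - by move=> y; rewrite mBox mem_gintbox => /andP [].
  - by move=> _; rewrite normr1.
apply: le_trans HV _.
set N3 : R := (size (gintbox (A ^ 3)))%:R.
have A1 : 1 <= A%:R :> R by rewrite ler1n.
have D1 : 1 <= D%:R :> R by rewrite ler1n; lia.
have N3le : N3 <= 3 * A%:R ^+ 3.
  rewrite /N3 size_gintbox -natrX -natrM ler_nat; have := expn_gt0 A 3; lia.
have pair w1 w2 : w1 \in W -> w2 \in W ->
   `|\sum_(y <- gintbox (A ^ 3)) kap1 w1 y * kap1 w2 y| <=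
   (issq (`|w1| * `|w2|))%:R * N3 + A%:R ^+ 2.
  rewrite !mem_filter !mem_gintbox => /andP [o1 h1] /andP [o2 h2].
  have E : \sum_(y <- gintbox (A ^ 3)) kap1 w1 y * kap1 w2 y =
     \sum_(y <- gintbox (A ^ 3)) (jacobi y (`|w1| * `|w2|))%:~R.
    by apply: eq_bigr => y _; rewrite /kap1 o1 o2 -rmorphM -jacobiMr ?odd_gt0.
  rewrite E; have [sq|nsq] := boolP (issq _).
    rewrite mul1r; apply: ler_wpDr; first exact: sqr_ge0.
    apply: le_trans (ler_norm_sum _ _ _) _.
    apply: (@le_trans _ _ (\sum_(y <- gintbox (A ^ 3)) 1)).
      by apply: ler_sum => y _; exact: jacobi_intr_le1.
    by rewrite big_const_seq count_predT iter_addr_0.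
  rewrite mul0r add0r; apply: le_trans (jacobi_box_sum _ _ _ nsq) _; first by rewrite oddM o1.
  by rewrite -natrX ler_nat -mulnn leq_mul.
have sW : (size W)%:R <= 3 * A%:R :> R.
  rewrite -natrM ler_nat; apply: leq_trans (_ : size (gintbox A) <= _)%N.
    by rewrite size_filter count_size.
  by rewrite size_gintbox; lia.
have sumsq : \sum_(w1 <- W) \sum_(w2 <- W) (issq (`|w1| * `|w2|))%:R <= 4 * (A%:R * D%:R) :> R.
  have sub (F : nat -> R) : (forall n, 0 <= F n) ->
      \sum_(w <- W) F `|w|%N <= 2 * \sum_(m <- iota 1 A) F m.
    move=> F0; apply: le_trans (sum_abs_box _ F0); apply: ler_sum_subset => //.
      by rewrite filter_uniq ?gintbox_uniq.
    move=> a; rewrite !mem_filter => /andP [oa ->]; rewrite andbT.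
    by apply/eqP => a0; rewrite a0 in oa.
  apply: (@le_trans _ _ (2 * \sum_(m1 <- iota 1 A) (2 * \sum_(m2 <- iota 1 A) (issq (m1 * m2))%:R))).
    apply: le_trans (sub (fun m => \sum_(w2 <- W) (issq (m * `|w2|))%:R) _) _.
      by move=> n; apply: sumr_ge0.
    apply: ler_wpM2l => //; apply: ler_sum => m1 _.
    exact: (sub (fun m2 => (issq (m1 * m2))%:R)).
  rewrite -mulr_sumr mulrA -natrM; apply: ler_wpM2l => //.
  have := @square_pairs A D _; rewrite -(ler_nat R) natrM => /(_ _); move=> H.
  apply: le_trans (H _); last first.
    move=> s s0 sA; apply: leq_trans (HD (s * s)%N _ _); rewrite ?muln_gt0 ?s0 //.
      by rewrite leq_pmull.
    by apply: (@leq_trans (A ^ 2)); [rewrite -mulnn leq_mul|rewrite leq_pexp2l].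
  rewrite natr_sum; apply: ler_sum => m1 _; rewrite natr_sum; exact: lexx.
have tot : \sum_(w1 <- W) \sum_(w2 <- W) `|\sum_(y <- gintbox (A ^ 3)) kap1 w1 y * kap1 w2 y|
   <= 21 * D%:R * A%:R ^+ 4.
  apply: (@le_trans _ _ (\sum_(w1 <- W) \sum_(w2 <- W)
      ((issq (`|w1| * `|w2|))%:R * N3 + A%:R ^+ 2))).
    rewrite big_seq [leRHS]big_seq; apply: ler_sum => w1 h1.
    by rewrite big_seq [leRHS]big_seq; apply: ler_sum => w2 h2; exact: pair.
  under eq_bigr do rewrite big_split /= -mulr_suml.
  rewrite big_split /= -mulr_suml.
  apply: (@le_trans _ _ (4 * (A%:R * D%:R) * (3 * A%:R ^+ 3) + 3 * A%:R * (3 * A%:R * A%:R ^+ 2))).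
    apply: lerD; first by apply: ler_pM => //; apply: sumr_ge0 => ? _; apply: sumr_ge0.
    rewrite big_const_seq count_predT iter_addr_0 -[_ *+ size W]mulr_natl.
    apply: ler_pM => //; first by rewrite big_const_seq count_predT iter_addr_0 mulrn_wge0 ?sqr_ge0.
    rewrite big_const_seq count_predT iter_addr_0 -[_ *+ size W]mulr_natl.
    by apply: ler_wpM2r; rewrite ?sqr_ge0.
  have -> : 4 * (A%:R * D%:R) * (3 * A%:R ^+ 3) + 3 * A%:R * (3 * A%:R * A%:R ^+ 2)
     = (12 * D%:R + 9) * A%:R ^+ 4 :> R by ring.
  apply: ler_wpM2r; first by rewrite exprn_ge0.
  by lra.
apply: (@le_trans _ _ ((D%:R ^+ 2) ^+ 2 * (3 * A%:R ^+ 3 * (21 * D%:R * A%:R ^+ 4)))).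
  apply: ler_wpM2l; first exact: sqr_ge0.
  apply: ler_pM => //; apply: sumr_ge0 => ? _; exact: sumr_ge0.
by rewrite le_eqVlt; apply/orP; left; apply/eqP; ring.
Qed.

(** * Variation of the angle *)

Lemma unit_expz_dist (x y : R[i]) (k : int) : nc x = 1 -> nc y = 1 ->
  nc (x ^ k - y ^ k) <= `|k|%N%:R * nc (x - y).
Proof.
move=> x1 y1.
have nat n : nc (x ^+ n - y ^+ n) <= n%:R * nc (x - y).
  elim: n => [|n IH]; first by rewrite !expr0 subrr ComplexField.Normc.normc0 mul0r.
  have -> : x ^+ n.+1 - y ^+ n.+1 = x * (x ^+ n - y ^+ n) + (x - y) * y ^+ n.
    by rewrite !exprS; ring.
  apply: le_trans (normcD _ _) _; rewrite !normcM x1 mul1r normcX y1 expr1n mulr1.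
  by rewrite -addn1 natrD mulrDl mul1r; apply: lerD.
have nz z : nc z = 1 -> z != 0.
  by move=> z1; apply/eqP => E; move: z1; rewrite E ComplexField.Normc.normc0 => /eqP; rewrite eq_sym oner_eq0.
case: k => n; first by rewrite -!exprnP absz_nat.
rewrite NegzE abszN absz_nat -!invr_expz -!exprnP.
have -> : (x ^+ n.+1)^-1 - (y ^+ n.+1)^-1 = - (x ^+ n.+1 - y ^+ n.+1) * ((x ^+ n.+1)^-1 * (y ^+ n.+1)^-1).
  have nx : x ^+ n.+1 != 0 by rewrite expf_neq0 // nz.
  have ny : y ^+ n.+1 != 0 by rewrite expf_neq0 // nz.
  by field; rewrite nx ny.
rewrite normcM normcN normcM !ComplexField.Normc.normcV !normcX x1 y1 !expr1n invr1 !mulr1.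
exact: nat.
Qed.

Lemma unit_vector_dist (x y : R[i]) : x != 0 -> y != 0 ->
  nc (x / `|x| - y / `|y|) <= 2 * nc (x - y) / nc x.
Proof.
move=> x0 y0.
have pos z : z != 0 -> 0 < nc z.
  move=> z0; rewrite lt_neqAle normc_ge0 andbT eq_sym; apply/eqP => E.
  by move/eqP: z0; apply; exact: ComplexField.Normc.eq0_normc.
have px := pos _ x0; have py := pos _ y0.
have nx : (nc x)%:C != 0 by rewrite -normcE normr_eq0.
have ny : (nc y)%:C != 0 by rewrite -normcE normr_eq0.
have -> : x / `|x| - y / `|y| = (x - y) / (nc x)%:C + y * ((nc y - nc x)%:C / ((nc x)%:C * (nc y)%:C)).
  rewrite !normcE rmorphB /=; field; by rewrite nx ny.
apply: le_trans (normcD _ _) _.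
have V (r : R) : nc ((r%:C)^-1) = `|r|^-1 by rewrite ComplexField.Normc.normcV normcR.
rewrite !normcM V ComplexField.Normc.normcV normcM !normcR.
rewrite (gtr0_norm px) (gtr0_norm py).
have -> : 2 * nc (x - y) / nc x = nc (x - y) / nc x + nc (x - y) / nc x by ring.
rewrite lerD2l.
have -> : nc y * (`|nc y - nc x| / (nc x * nc y)) = `|nc y - nc x| / nc x.
  by field; rewrite !gt_eqF.
apply: ler_wpM2r; first by rewrite invr_ge0 ltW.
rewrite ler_norml; apply/andP; split.
  by rewrite lerNl opprB lerBlDr; have := normcD (x - y) y; rewrite subrK.
by rewrite lerBlDr normc_distC; have := normcD (y - x) x; rewrite subrK.
Qed.

(** The modulus of [a + ib] is bounded below by that of [b], independently of [a]; summing over [b]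
    later costs one harmonic sum. *)
Lemma gangle_expz_dist (a a' b : int) (k : int) : b != 0 ->
  nc (gangle R (a +i* b) ^ k - gangle R (a' +i* b) ^ k) <=
  2 * `|k|%N%:R * `|a - a'|%N%:R / `|b|%N%:R.
Proof.
move=> b0.
have nz (c : int) : (c +i* b : gaussInt) != 0 by rewrite eq_complex negb_and b0 orbT.
have nzc (c : int) : gaussInt_to_complex R (c +i* b) != 0.
  by rewrite eq_complex /= !intr_eq0 negb_and b0 orbT.
apply: le_trans (unit_expz_dist _ _ _) _; rewrite ?gangle_norm //.
rewrite -!mulrA mulrCA; apply: ler_wpM2l => //.
apply: le_trans (unit_vector_dist (nzc _) (nzc _)) _.
rewrite -mulrA; apply: ler_wpM2l => //.
have -> : gaussInt_to_complex R (a +i* b) - gaussInt_to_complex R (a' +i* b) = ((a - a')%:~R : R)%:C.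
  by rewrite /gaussInt_to_complex; simpc; rewrite rmorphB.
have ab (c : int) : (`|c|%N%:R : R) = `|c%:~R| by rewrite -intr_norm -abszE.
rewrite normcR !ab; apply: ler_wpM2l => //.
have bp : 0 < `|b%:~R : R| by rewrite normr_gt0 intr_eq0.
rewrite lef_pV2 ?posrE //; last first.
  by apply: lt_le_trans bp _; have := normc_Im (gaussInt_to_complex R (a +i* b)).
exact: (normc_Im (gaussInt_to_complex R (a +i* b))).
Qed.

End TypeOne.

Lemma inord_inj (n x y : nat) : (x <= n)%N -> (y <= n)%N -> (inord x : 'I_n.+1) = inord y -> x = y.
Proof. by move=> hx hy /(congr1 (fun i : 'I_n.+1 => i : nat)); rewrite !inordK. Qed.

Lemma block_count (A n m : nat) : (0 < n)%N -> (m <= 2 * A)%N -> (m %/ (A %/ n).+1 <= 2 * n)%N.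
Proof.
move=> n0 mA; rewrite -ltnS ltn_divLR //.
have := ltn_ceil A n0; move: (A %/ n)%N => x; nia.
Qed.

Lemma ler_of_sqr (R : realFieldType) (x y : R) : 0 <= y -> x ^+ 2 <= y ^+ 2 -> x <= y.
Proof.
move=> y0 h; rewrite leNgt; apply/negP => yx.
by have := ltrXn2r 2 y0 yx; rewrite /= ltNge h.
Qed.

Lemma absz_modz_le (c : int) (Q : nat) : (0 < Q)%N -> (`|(c %% Q)%Z| <= Q)%N.
Proof. by move=> Q0; have := @ltz_pmod c Q Q0; have := @modz_ge0 c Q; lia. Qed.

Lemma dvdz_absz_modz (a b : int) (Q : nat) : (0 < Q)%N ->
  `|(a %% Q)%Z|%N = `|(b %% Q)%Z|%N -> (Q %| a - b)%Z.
Proof.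
move=> Q0 E; rewrite -eqz_mod_dvd; apply/eqP.
by have := @modz_ge0 a Q; have := @modz_ge0 b Q; lia.
Qed.

Lemma primaryb_mod8 (a a' b : int) : (8%:Z %| a - a')%Z ->
  primaryb (a +i* b) = primaryb (a' +i* b).
Proof. rewrite /primaryb; lia. Qed.

Lemma slab_dist (A B : nat) (a a' : int) : (`|a| <= A)%N -> (`|a'| <= A)%N -> (0 < B)%N ->
  (`|(a + A%:Z)%R|%N %/ B = `|(a' + A%:Z)%R|%N %/ B)%N -> (`|a - a'| < B)%N.
Proof.
move=> ha ha' B0 E.
have := divn_eq `|(a + A%:Z)%R|%N B; have := divn_eq `|(a' + A%:Z)%R|%N B; rewrite E.
have := ltn_pmod `|(a + A%:Z)%R|%N B0; have := ltn_pmod `|(a' + A%:Z)%R|%N B0.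
move: (_ %/ B)%N (_ %% B)%N (_ %% B)%N => x y z h1 h2 h3 h4; clear E B0.
move: (x * B)%N h3 h4 => w; lia.
Qed.

Lemma block_mul (A n m : nat) : (n * m <= A)%N -> (m * (A %/ (n * m)).+1 * n <= 2 * A)%N.
Proof.
move=> le; have := leq_divM A (n * m).
rewrite -mulnA mulSn mulnDr; move: (A %/ _)%N => x h.
have -> : (m * n + m * (x * n) = n * m + x * (n * m))%N by ring.
by rewrite mul2n -addnn leq_add.
Qed.

Lemma absz_shift_le (A : nat) (c : int) : (`|c| <= A)%N -> (`|(c + A%:Z)%R|%N <= 2 * A)%N.
Proof. lia. Qed.

Lemma succ_double (n : nat) : (0 < n)%N -> (n.+1 <= 2 * n)%N.
Proof. lia. Qed.

Lemma succ_triple (n : nat) : (0 < n)%N -> ((2 * n).+1 <= 3 * n)%N.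
Proof. lia. Qed.

(** Here 63 comes from [typeI_moment], 108 from the number of labels, and [x] will be [D ^ 2]. *)
Lemma cube_const (x : nat) : (100 <= x)%N -> (63 * 108 * 108 <= x * x * x)%N.
Proof.
move=> h; have h2 : (100 * 100 <= x * x)%N by exact: leq_mul.
by apply: leq_trans (leq_mul h2 h); lia.
Qed.

Lemma normc_mulB (R : realType) (x y p j : R[i]) :
  ComplexField.Normc.normc (x * p * j - y * p * j) =
  ComplexField.Normc.normc (x - y) *
    (ComplexField.Normc.normc p * ComplexField.Normc.normc j).
Proof. by rewrite -!normcM; congr ComplexField.Normc.normc; ring. Qed.

Section TypeOne.
Variable R : realType.
Local Notation nc := (@ComplexField.Normc.normc R).
Variables (chi : gaussInt -> R[i]) (k : int) (d : nat).
Hypothesis d0 : (1 <= d)%N.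
Hypothesis hchi : gauss_character (4 * d)%:R chi.
Variables (u v : int).
Hypothesis pw : primaryb (u +i* v).
Variables (A D T Y : nat).
Let q := gsqn (u +i* v).
(** A common period in [a]: 8 for the phase and primarity, [4 * d] for [chi], [q] for the kernel
    (r/q). *)
Let Q := (8 * d * q)%N.
Let K := (`|k| + 1)%N.
Hypothesis T1 : (1 <= T)%N.
Hypothesis D10 : (10 <= D)%N.
Hypothesis HD : forall n, (0 < n)%N -> (n <= A ^ 4)%N -> (2 * size (divisors n) <= D)%N.
Hypothesis Hln : 2 * (1 + ln (A%:R : R)) <= D%:R.
Hypothesis Hcond : (Q ^ 2 * K ^ 2 * T ^ 12 * D ^ 11 <= A)%N.

Let W := [seq a <- gintbox A | odd `|a|].
Let Zs := [seq b <- gintbox A | b != 0].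

Definition typeI_weight (a b : int) : R[i] :=
  let r := u * a - v * b in
  if primaryb (a +i* b) && (gsqn (a +i* b) <= Y)%N then
    psi chi k (a +i* b) *
    jk_phase R (u %% 8)%Z (u < 0) (a %% 8)%Z (a < 0) (r %% 8)%Z (r < 0) b *
    ((jacobi v `|u|)%:~R * (jacobi r q)%:~R)
  else 0.

Let P1 (a b : int) : bool := (gsqn (a +i* b) <= Y)%N.
Let P2 (a b : int) : bool := u * a - v * b < 0.
Let B := (A %/ T).+1.
Let B3 := (A %/ (T * K)).+1.

(* The components fix [a] mod [Q], the sign of [a], up to [B] points the sets of
   [b] cut out by the norm condition and by the sign of [r], and a slab of
   width [B3] containing [a] (for the angle). *)
Definition typeI_label (a : int) :
    ('I_Q.+1 * bool * 'I_(2 * T).+1 * 'I_(2 * T).+1 * 'I_(2 * T * K).+1)%type :=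
  (inord `|(a %% Q)%Z|, a < 0, inord (count (P1 a) Zs %/ B),
   inord (count (P2 a) Zs %/ B), inord (`|(a + A%:Z)%R|%N %/ B3)).

Let q0 : (0 < q)%N.
Proof. by rewrite gsqn_gt0; exact: primary_neq0. Qed.

Let Q0 : (0 < Q)%N.
Proof. by rewrite !muln_gt0 d0 q0. Qed.

Let A0 : (0 < A)%N.
Proof.
have h x y z t : (0 < x -> 0 < y -> 0 < z -> 0 < t -> 0 < x * y * z * t)%N.
  by move=> x0 y0 z0 t0; rewrite !muln_gt0 x0 y0 z0 t0.
apply: leq_trans Hcond; apply: h; rewrite expn_gt0; apply/orP; left; rewrite ?Q0 ?T1 //.
  by rewrite /K addn1.
by apply: leq_trans D10.
Qed.

Let K0 : (0 < K)%N. Proof. by rewrite /K addn1. Qed.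

Let TKA : (T * K <= A)%N.
Proof.
apply: leq_trans Hcond.
have h1 : (1 <= Q ^ 2)%N by rewrite expn_gt0 Q0.
have h2 : (1 <= D ^ 11)%N by rewrite expn_gt0 (leq_trans _ D10).
have h3 : (T <= T ^ 12)%N by rewrite -{1}(expn1 T) leq_pexp2l.
have h4 : (K <= K ^ 2)%N by rewrite -{1}(expn1 K) leq_pexp2l.
move: (Q ^ 2)%N (D ^ 11)%N (T ^ 12)%N (K ^ 2)%N h1 h2 h3 h4 => x y z t h1 h2 h3 h4.
have h5 : (T * K <= z * t)%N by exact: leq_mul.
apply: leq_trans h5 _; rewrite -[leqLHS]muln1 -[X in (X <= _)%N]mul1n.
have -> : (x * t * z * y = x * (z * t * y))%N by ring.
by apply: leq_mul => //; rewrite leq_mul2l h2 orbT.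
Qed.

Let sZs : (size Zs <= 2 * A)%N.
Proof.
have u1 : uniq (0 :: Zs) by rewrite cons_uniq mem_filter eqxx /= filter_uniq ?gintbox_uniq.
have := uniq_leq_size (s2 := gintbox A) u1.
rewrite size_gintbox /= ltnS; apply => x; rewrite inE => /orP [/eqP ->|].
  by rewrite mem_gintbox.
by rewrite mem_filter => /andP [].
Qed.

Let blk (n m : nat) : (0 < n)%N -> (m <= 2 * A)%N -> (m %/ (A %/ n).+1 <= 2 * n)%N :=
  @block_count A n m.

Let labelE a a' : a \in W -> a' \in W -> typeI_label a = typeI_label a' ->
  [/\ (Q %| a - a')%Z, (a < 0) = (a' < 0),
   (count (fun b => P1 a b != P1 a' b) Zs < B)%N,
   (count (fun b => P2 a b != P2 a' b) Zs < B)%N & (`|a - a'| < B3)%N].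
Proof.
rewrite !mem_filter !mem_gintbox => /andP [oa ha] /andP [oa' ha'].
move=> [e1 e2 e3 e4 e5].
have lq c : (`|(c %% Q)%Z| <= Q)%N by exact: absz_modz_le.
have lc p : (count p Zs <= 2 * A)%N by apply: leq_trans sZs; exact: count_size.
split.
- by apply: dvdz_absz_modz => //; exact: inord_inj (lq _) (lq _) e1.
- exact: e2.
(* The sets [P1 a] are nested according to the size of [a]; those of [P2 a], below, according to
   [u * a]. *)
- apply: chain_count => //.
    rewrite /P1; have [le|/ltnW le] := leqP `|a| `|a'|; [right|left] => b; apply: leq_trans;
    by rewrite /gsqn /= leq_add2r leq_expr2w.
  by apply: inord_inj e3; apply: blk.
- apply: chain_count => //.
    rewrite /P2; have [le|/ltW le] := lerP (u * a) (u * a'); [right|left] => b; apply: le_lt_trans;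
    by rewrite lerD2r.
  by apply: inord_inj e4; apply: blk.
have bb (c : int) : (`|c| <= A)%N -> (`|(c + A%:Z)%R|%N %/ B3 <= 2 * T * K)%N.
  move=> hc; rewrite -mulnA; apply: blk; first by rewrite muln_gt0 T1.
  exact: absz_shift_le.
by apply: (slab_dist ha ha') => //; exact: inord_inj (bb _ ha) (bb _ ha') e5.
Qed.

Let weight_le1 a b : b != 0 -> nc (typeI_weight a b) <= 1.
Proof.
move=> b0; rewrite /typeI_weight; case: ifP => _; last by rewrite ComplexField.Normc.normc0.
rewrite normcM [nc (_ * jk_phase _ _ _ _ _ _ _ _)]normcM nc_phase mulr1.
have nj (x : int) n : nc (jacobi x n)%:~R <= 1.
  have -> : ((jacobi x n)%:~R : R[i]) = ((jacobi x n)%:~R : R)%:C by rewrite rmorph_int.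
  by rewrite normcR jacobi_intr_le1.
have z0 : (a +i* b : gaussInt) != 0 by rewrite eq_complex negb_and b0 orbT.
rewrite -[leRHS]mul1r; apply: ler_pM; rewrite ?mulr_ge0 ?normc_ge0 //.
  exact: (psi_norm k d0 hchi).
by rewrite normcM -[leRHS]mul1r; apply: ler_pM; rewrite ?normc_ge0.
Qed.

(** When the norm condition and the sign of [r] agree, every factor except the angle is the same for
    [a] and [a']; on the exceptional [b] the trivial bound 2 is used. *)
Let weight_dist a a' b : a \in W -> a' \in W -> typeI_label a = typeI_label a' ->
  b \in Zs ->
  nc (typeI_weight a b - typeI_weight a' b) <=
  2 * (P1 a b != P1 a' b)%:R + 2 * (P2 a b != P2 a' b)%:R
  + 2 * K%:R * B3%:R / `|b|%N%:R.
Proof.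
move=> aW a'W E bZ; have [Qa nea _ _ da] := labelE aW a'W E.
have b0 : b != 0 by move: bZ; rewrite mem_filter => /andP [].
have t0 : 0 <= 2 * K%:R * B3%:R / `|b|%N%:R :> R by rewrite !mulr_ge0 ?invr_ge0.
have triv : nc (typeI_weight a b - typeI_weight a' b) <= 2.
  apply: le_trans (normcB _ _) _; rewrite -[leRHS]/(1 + 1)%R.
  by apply: lerD; apply: weight_le1.
have [e1|ne1] := eqVneq (P1 a b) (P1 a' b); last first.
  by apply: le_trans triv _; rewrite mulr1 -addrA lerDl addr_ge0 // mulr_ge0.
have [e2|ne2] := eqVneq (P2 a b) (P2 a' b); last first.
  by apply: le_trans triv _; rewrite mulr1 mulr0 add0r lerDl.
rewrite !mulr0 !add0r.
have dv (n : nat) : (n %| Q)%N -> (n%:Z %| a - a')%Z.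
  by move=> h; apply: dvdz_trans Qa; rewrite dvdzE.
have Q8 : (8%:Z %| a - a')%Z by apply: dv; rewrite /Q -mulnA dvdn_mulr.
have pe : primaryb (a +i* b) = primaryb (a' +i* b) by exact: primaryb_mod8.
have ae : (a %% 8)%Z = (a' %% 8)%Z by apply/eqP; rewrite eqz_mod_dvd.
have re : ((u * a - v * b) %% 8)%Z = ((u * a' - v * b) %% 8)%Z.
  apply/eqP; rewrite eqz_mod_dvd.
  have -> : u * a - v * b - (u * a' - v * b) = u * (a - a') by ring.
  by rewrite dvdz_mull.
have je : jacobi (u * a - v * b) q = jacobi (u * a' - v * b) q.
  apply: jacobi_modP; first exact: primary_norm_odd.
  have -> : u * a - v * b - (u * a' - v * b) = u * (a - a') by ring.
  by rewrite dvdz_mull // dv // /Q dvdn_mull.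
have ce : chi (a +i* b) = chi (a' +i* b).
  apply: (gauss_character_cong hchi); apply: gcong_nat_int; last by rewrite subrr dvdz0.
  apply: dv; rewrite /Q; apply: dvdn_mulr; rewrite (_ : 8 = 2 * 4)%N //.
  by rewrite -mulnA dvdn_mull.
rewrite /typeI_weight -pe -/(P1 a b) -/(P1 a' b) -e1 -ae -re -je -nea.
rewrite -/(P2 a b) -/(P2 a' b) -e2.
case: (boolP (primaryb (a +i* b) && P1 a b)) => [/andP [pa _]|_]; last first.
  by rewrite subr0 ComplexField.Normc.normc0.
have nj (x : int) n : nc (jacobi x n)%:~R <= 1.
  have -> : ((jacobi x n)%:~R : R[i]) = ((jacobi x n)%:~R : R)%:C by rewrite rmorph_int.
  by rewrite normcR jacobi_intr_le1.
have nph : nc (jk_phase R (u %% 8)%Z (u < 0) (a %% 8)%Z (a < 0)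
  ((u * a - v * b) %% 8)%Z (P2 a b) b) = 1 by exact: nc_phase.
move: (jk_phase R _ _ _ _ _ _ _) nph => ph nph.
have nJ : nc ((jacobi v `|u|)%:~R * (jacobi (u * a - v * b) q)%:~R) <= 1.
  by rewrite normcM -[leRHS]mul1r; apply: ler_pM; rewrite ?normc_ge0.
move: (_%:~R * _%:~R) nJ => J nJ.
apply: (@le_trans _ _ (nc (psi chi k (a +i* b) - psi chi k (a' +i* b)) * 1)).
  move: (psi chi k (a +i* b)) (psi chi k (a' +i* b)) => x y.
  by rewrite normc_mulB nph mul1r; apply: ler_wpM2l; first exact: normc_ge0.
rewrite mulr1 /psi -ce -mulrBr normcM.
apply: (@le_trans _ _ (1 * (2 * `|k|%N%:R * `|a - a'|%N%:R / `|b|%N%:R))).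
  apply: ler_pM; rewrite ?normc_ge0 //; first exact: (chi_norm d0 hchi).
  exact: gangle_expz_dist.
rewrite mul1r; apply: ler_wpM2r; first by rewrite invr_ge0.
apply: ler_pM => //; first by rewrite mulr_ge0.
  by apply: ler_wpM2l => //; rewrite ler_nat /K leq_addr.
by rewrite ler_nat ltnW.
Qed.

Lemma typeI_bound :
  nc (\sum_(z <- gbox A | primaryb z && (gsqn z <= Y)%N)
      psi chi k z * jacobi_kubota R ((u +i* v : gaussInt) * z))
  <= 45 * D%:R * A%:R ^+ 2 / T%:R.
Proof.
pose term (a b : int) := if primaryb (a +i* b) && (gsqn (a +i* b) <= Y)%N then
   psi chi k (a +i* b) * jacobi_kubota R ((u +i* v : gaussInt) * (a +i* b)) else 0.
have Tr : 1 <= T%:R :> R by rewrite ler1n.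
have Ar : 1 <= A%:R :> R by rewrite ler1n A0.
have Dr : 10 <= D%:R :> R by rewrite ler_nat.
have Tp : 0 < T%:R :> R by rewrite ltr0n.
have Ap : 0 < A%:R :> R by rewrite ltr0n A0.
have termn a b : nc (term a b) <= 1.
  rewrite /term; case: ifP => [/andP [pz _]|_]; last by rewrite ComplexField.Normc.normc0 ler01.
  rewrite normcM -[leRHS]mul1r; apply: ler_pM; rewrite ?normc_ge0 ?jk_norm //.
  by apply: (psi_norm k d0 hchi); exact: primary_neq0.
(* Real [z] fall outside [jk_mul]; they are split off and cost only [O(A)]. *)
have -> : \sum_(z <- gbox A | primaryb z && (gsqn z <= Y)%N)
      psi chi k z * jacobi_kubota R ((u +i* v : gaussInt) * z) =
   \sum_(a <- gintbox A) term a 0 + \sum_(a <- W) \sum_(b <- Zs) (kap1 R a b)%:C * typeI_weight a b.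
  rewrite big_mkcond /= big_allpairs_dep.
  have -> : \sum_(a <- W) \sum_(b <- Zs) (kap1 R a b)%:C * typeI_weight a b =
     \sum_(a <- gintbox A) \sum_(b <- Zs) term a b.
    rewrite /W big_filter big_mkcond; apply: eq_bigr => a _; case: ifPn => oa; last first.
      rewrite big1 // => b _; rewrite /term; case: ifP => // /andP [/primary_parity [oa' _]].
      by rewrite oa' in oa.
    rewrite /Zs !big_filter; apply: eq_bigr => b b0.
    rewrite /term /typeI_weight; case: ifP => [/andP [pz _]|_]; last by rewrite mulr0.
    rewrite (jk_mul _ pw pz b0) /kap1 oa rmorph_int -/q; ring.
  rewrite -big_split /=; apply: eq_bigr => a _.
  rewrite (bigD1_seq 0) ?gintbox_uniq ?mem_gintbox //=; congr (_ + _).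
  by rewrite /Zs big_filter.
have sW : (size W)%:R <= 3 * A%:R :> R.
  rewrite -natrM ler_nat; apply: leq_trans (_ : size (gintbox A) <= _)%N.
    by rewrite size_filter count_size.
  by rewrite size_gintbox; have := A0; lia.
pose Lb := (#|{: 'I_Q.+1 * bool * 'I_(2 * T).+1 * 'I_(2 * T).+1 * 'I_(2 * T * K).+1}|)%N.
have LbE : (Lb <= 108 * Q * K * T ^ 3)%N.
  rewrite /Lb !card_prod !card_ord card_bool.
  have h1 : (Q.+1 <= 2 * Q)%N by exact: succ_double.
  have h2 : ((2 * T).+1 <= 3 * T)%N by exact: succ_triple.
  have h3 : ((2 * T * K).+1 <= 3 * T * K)%N by rewrite -!mulnA succ_triple // muln_gt0 T1.
  apply: leq_trans (leq_mul (leq_mul (leq_mul (leq_mul h1 (leqnn 2)) h2) h2) h3) _.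
  by apply: eq_leq; ring.
have Lb0 : (0 < Lb)%N by rewrite /Lb !card_prod !card_ord card_bool.
have Lbp : 0 < Lb%:R :> R by rewrite ltr0n.
(* Chosen so that, with [tau = A / T], the term [Lb * V / tau ^+ 2] is [A ^ 2 / T]. That the moment
   stays below [V] requires [63 * D ^ 5 * (T ^ 3 * Lb) ^ 2 <= A], which is the source of [Hcond]. *)
pose V : R := A%:R ^+ 4 / (T%:R ^+ 3 * Lb%:R).
have Vp : 0 <= V by rewrite /V divr_ge0 ?mulr_ge0 ?exprn_ge0.
have Bb : B%:R <= 2 * A%:R / T%:R :> R.
  rewrite ler_pdivlMr // -!natrM ler_nat /B.
  have := @block_mul A T 1; rewrite muln1 mul1n; apply.
  by apply: leq_trans TKA; rewrite leq_pmulr.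
have B3b : K%:R * B3%:R <= 2 * A%:R / T%:R :> R.
  by rewrite ler_pdivlMr // -!natrM ler_nat; exact: block_mul.
have HV (beta : int -> R) : (forall z, z \in Zs -> `|beta z| <= 1) ->
    \sum_(w <- W) `|\sum_(z <- Zs) beta z * kap1 R w z| ^+ 3 <= V.
  move=> b1; apply: ler_of_sqr => //.
  apply: le_trans (typeI_moment A0 HD b1) _.
  rewrite /V exprMn exprVn ler_pdivlMr; last by rewrite exprn_gt0 // mulr_gt0 // exprn_gt0.
  have -> : (A%:R ^+ 4) ^+ 2 = A%:R ^+ 7 * A%:R :> R by ring.
  rewrite [63 * D%:R ^+ 5 * _]mulrC -mulrA; apply: ler_wpM2l; first exact: exprn_ge0.
  suff : (63 * D ^ 5 * (T ^ 3 * Lb) ^ 2 <= A)%N by rewrite -(ler_nat R) !(natrM, natrX).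
  apply: leq_trans Hcond.
  apply: (@leq_trans (63 * D ^ 5 * (T ^ 3 * (108 * Q * K * T ^ 3)) ^ 2)%N).
    by rewrite leq_mul2l; apply/orP; right; apply: leq_expr2w; rewrite leq_mul2l LbE orbT.
  have -> : (63 * D ^ 5 * (T ^ 3 * (108 * Q * K * T ^ 3)) ^ 2 =
    63 * 108 * 108 * (Q ^ 2 * K ^ 2 * T ^ 12 * D ^ 5))%N by ring.
  have -> : (Q ^ 2 * K ^ 2 * T ^ 12 * D ^ 11 = D ^ 6 * (Q ^ 2 * K ^ 2 * T ^ 12 * D ^ 5))%N by ring.
  rewrite leq_mul2r; apply/orP; right.
  have d2 : (100 <= D ^ 2)%N by rewrite -mulnn; apply: (@leq_trans (10 * 10)); rewrite ?leq_mul.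
  have -> : (D ^ 6 = D ^ 2 * D ^ 2 * D ^ 2)%N by ring.
  exact: cube_const.
pose E : R := 12 * A%:R * D%:R / T%:R.
have HE (w w' : int) : w \in W -> w' \in W -> typeI_label w = typeI_label w' ->
    \sum_(z <- Zs) nc (typeI_weight w z - typeI_weight w' z) <= E.
  move=> wW w'W Ew; have [_ _ c1 c2 _] := labelE wW w'W Ew.
  apply: (@le_trans _ _ (\sum_(b <- Zs) (2 * (P1 w b != P1 w' b)%:R + 2 * (P2 w b != P2 w' b)%:R
     + 2 * K%:R * B3%:R / `|b|%N%:R))).
    by rewrite big_seq [leRHS]big_seq; apply: ler_sum => b bZ; exact: weight_dist.
  rewrite !big_split /= -!mulr_sumr.
  have cnt (p : pred int) : \sum_(i <- Zs) (p i)%:R = (count p Zs)%:R :> R.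
    by rewrite -sum1_count natr_sum [RHS]big_mkcond; apply: eq_bigr => i _; case: (p i).
  rewrite (cnt (fun b => P1 w b != P1 w' b)) (cnt (fun b => P2 w b != P2 w' b)).
  have hs : \sum_(i <- Zs) (`|i|%N%:R : R)^-1 <= D%:R.
    apply: le_trans (sum_abs_box A (F := fun n => (n%:R : R)^-1) _) _.
      by move=> n; rewrite invr_ge0.
    by apply: le_trans Hln; apply: ler_wpM2l => //; exact: harmonic_ln A0.
  apply: (@le_trans _ _ (2 * (2 * A%:R / T%:R) + 2 * (2 * A%:R / T%:R) + 2 * (2 * A%:R / T%:R) * D%:R)).
    apply: lerD.
      apply: lerD; apply: ler_wpM2l => //; apply: le_trans Bb; rewrite ler_nat; exact: ltnW.
    rewrite -[2 * K%:R * B3%:R]mulrA; apply: ler_pM => //.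
    - by rewrite !mulr_ge0.
    - by apply: sumr_ge0 => i _; rewrite invr_ge0.
    by apply: ler_wpM2l.
  rewrite /E -subr_ge0.
  have -> : 12 * A%:R * D%:R / T%:R - (2 * (2 * A%:R / T%:R) + 2 * (2 * A%:R / T%:R) + 2 * (2 * A%:R / T%:R) * D%:R)
    = (8 * (D%:R - 1)) * (A%:R / T%:R) :> R by field; rewrite gt_eqF.
  by apply: mulr_ge0; [lra|rewrite divr_ge0].
have tau0 : 0 < A%:R / T%:R :> R by rewrite divr_gt0.
have := @approx_bound R int int W Zs (kap1 R) _ typeI_label typeI_weight V (A%:R / T%:R) E 2 tau0.
move=> /(_ (fun w z _ _ => kap1_le1 R w z)) /(_ _ HV HE) main.
have {}main := main (fun w z _ zZ => weight_le1 w (proj1 (andP (etrans (esym (mem_filter (fun b => b != 0) z (gintbox A))) zZ)))).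
apply: le_trans (normcD _ _) _.
apply: (@le_trans _ _ (3 * A%:R + (3 * A%:R * E + 2 * (3 * A%:R * (A%:R / T%:R) + A%:R ^+ 2 / T%:R)))).
  apply: lerD.
    apply: le_trans (normc_sum _ _ _) _.
    apply: (@le_trans _ _ (\sum_(a <- gintbox A) 1)); first exact: ler_sum.
    rewrite big_const_seq count_predT iter_addr_0 size_gintbox -natrM ler_nat.
    exact: succ_triple.
  apply: le_trans (normc_sum _ _ _) _; apply: le_trans main _.
  apply: lerD; first by apply: ler_wpM2r => //; rewrite /E divr_ge0 ?mulr_ge0.
  apply: ler_wpM2l => //; apply: lerD; first by apply: ler_wpM2r => //; exact: ltW.
  rewrite -/Lb le_eqVlt; apply/orP; left; apply/eqP; rewrite /V.
  by field; rewrite !gt_eqF.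
have TA : T%:R <= A%:R :> R by rewrite ler_nat; apply: leq_trans TKA; rewrite leq_pmulr.
rewrite /E -subr_ge0.
have -> : 45 * D%:R * A%:R ^+ 2 / T%:R - (3 * A%:R + (3 * A%:R * (12 * A%:R * D%:R / T%:R) +
   2 * (3 * A%:R * (A%:R / T%:R) + A%:R ^+ 2 / T%:R))) =
   (9 * D%:R * A%:R - 8 * A%:R - 3 * T%:R) * (A%:R / T%:R) :> R by field; rewrite gt_eqF.
apply: mulr_ge0; last by rewrite divr_ge0.
by nra.
Qed.

End TypeOne.

(** * Type II sums *)

Lemma label_count_le (D T : nat) : (10 <= D)%N -> (0 < T)%N ->
  (9 * 9 * 2 * (36 * T).+1 * (36 * T).+1 <= D ^ 6 * T ^ 2)%N.
Proof.
move=> D10 T0.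
have h : ((36 * T).+1 <= 37 * T)%N by lia.
apply: (@leq_trans (9 * 9 * 2 * (37 * T) * (37 * T))); first by rewrite !leq_mul.
have -> : (9 * 9 * 2 * (37 * T) * (37 * T) = (9 * 9 * 2 * 37) * 37 * T ^ 2)%N by ring.
rewrite leq_mul2r; apply/orP; right.
have D2 : (100 <= D ^ 2)%N by rewrite -mulnn; apply: (@leq_trans (10 * 10)); rewrite ?leq_mul.
have -> : (D ^ 6 = D ^ 2 * D ^ 2 * D ^ 2)%N by ring.
apply: leq_mul; last by lia.
by apply: leq_trans (leq_mul D2 D2); lia.
Qed.

(** Twice the part of [typeII_moment] due to pairs with square product fits under the squared target
    [M * N ^ (2 * kap) / (T ^ (2 * kap) * L)]; as [h ^ 2] is about [N], the powers of [N] cancel and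
    a lower bound for [M] remains. *)
Lemma typeII_cond1 (D T M N h L kap : nat) : (10 <= D)%N -> (kap <= 3)%N ->
  (h ^ 2 <= 4 * N)%N -> (L <= D ^ 6 * T ^ 2)%N ->
  (T ^ (4 * kap + 4) * D ^ 40 <= M)%N ->
  (D ^ (4 * kap + 1) * (2 * 81 * M * (h ^ (2 * kap)) ^ 4) * (T ^ (2 * kap) * L) ^ 2
   <= M ^ 2 * N ^ (4 * kap))%N.
Proof.
move=> D10 k3 hN LD c1.
have H4 : ((h ^ (2 * kap)) ^ 4 <= D ^ (4 * kap) * N ^ (4 * kap))%N.
  rewrite -expnMn -expnM.
  have -> : (2 * kap * 4 = 2 * (4 * kap))%N by ring.
  rewrite expnM; have [->|k0] := posnP (4 * kap); first by rewrite !expn0.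
  rewrite leq_exp2r //; apply: leq_trans hN _; rewrite leq_mul2r; apply/orP; right.
  by apply: leq_trans D10.
have L2 : ((T ^ (2 * kap) * L) ^ 2 <= D ^ 12 * T ^ (4 * kap + 4))%N.
  have h5 : (T ^ (2 * kap) * L <= T ^ (2 * kap) * (D ^ 6 * T ^ 2))%N by rewrite leq_mul2l LD orbT.
  have h6 : ((T ^ (2 * kap) * L) ^ 2 <= (T ^ (2 * kap) * (D ^ 6 * T ^ 2)) ^ 2)%N by rewrite leq_sqr.
  apply: leq_trans h6 _.
  have -> : (T ^ (4 * kap + 4) = (T ^ (2 * kap)) ^ 2 * T ^ 4)%N.
    by rewrite expnD -expnM; congr (_ ^ _ * _)%N; ring.
  by apply: eq_leq; ring.
have D3 : (2 * 81 <= D ^ 3)%N.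
  have -> : (D ^ 3 = D * D * D)%N by ring.
  by apply: leq_trans (leq_mul (leq_mul D10 D10) D10).
apply: (@leq_trans (D ^ (4 * kap + 1) * (D ^ 3 * M * (D ^ (4 * kap) * N ^ (4 * kap))) *
   (D ^ 12 * T ^ (4 * kap + 4)))).
  apply: leq_mul L2; rewrite leq_mul2l; apply/orP; right; apply: leq_mul H4.
  by rewrite leq_mul2r D3 orbT.
apply: (@leq_trans (M * N ^ (4 * kap) * (T ^ (4 * kap + 4) * D ^ 40))); last first.
  by rewrite -mulnn mulnAC leq_mul2r leq_mul2l c1 !orbT.
have -> : (D ^ (4 * kap + 1) * (D ^ 3 * M * (D ^ (4 * kap) * N ^ (4 * kap))) *
   (D ^ 12 * T ^ (4 * kap + 4)) =
   M * N ^ (4 * kap) * (T ^ (4 * kap + 4) * D ^ (4 * kap + 1 + 3 + 4 * kap + 12)))%N.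
  by rewrite ![(D ^ (_ + _))%N]expnD; ring.
rewrite !leq_mul2l leq_pexp2l ?orbT //; first by apply: leq_trans D10.
by clear -k3; lia.
Qed.

(** The same for the pairs without square product: their sums are shorter by a power [N ^ kap],
    which has to pay for [M ^ 2 * c ^ 2] and the saving. *)
Lemma typeII_cond2 (D T M N h L kap c : nat) : (10 <= D)%N -> (kap <= 3)%N ->
  (h ^ 2 <= 4 * N)%N -> (L <= D ^ 6 * T ^ 2)%N ->
  (T ^ (4 * kap + 4) * D ^ 40 * M ^ 2 * c ^ 2 <= N ^ kap)%N ->
  (D ^ (4 * kap + 1) * (2 * 54 * M ^ 4 * c ^ 2 * (h ^ (2 * kap)) ^ 3) * (T ^ (2 * kap) * L) ^ 2
   <= M ^ 2 * N ^ (4 * kap))%N.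
Proof.
move=> D10 k3 hN LD c1.
have H4 : ((h ^ (2 * kap)) ^ 3 <= D ^ (3 * kap) * N ^ (3 * kap))%N.
  rewrite -expnMn -expnM.
  have -> : (2 * kap * 3 = 2 * (3 * kap))%N by ring.
  rewrite expnM; have [->|k0] := posnP (3 * kap); first by rewrite !expn0.
  rewrite leq_exp2r //; apply: leq_trans hN _; rewrite leq_mul2r; apply/orP; right.
  by apply: leq_trans D10.
have L2 : ((T ^ (2 * kap) * L) ^ 2 <= D ^ 12 * T ^ (4 * kap + 4))%N.
  have h5 : (T ^ (2 * kap) * L <= T ^ (2 * kap) * (D ^ 6 * T ^ 2))%N by rewrite leq_mul2l LD orbT.
  have h6 : ((T ^ (2 * kap) * L) ^ 2 <= (T ^ (2 * kap) * (D ^ 6 * T ^ 2)) ^ 2)%N by rewrite leq_sqr.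
  apply: leq_trans h6 _.
  have -> : (T ^ (4 * kap + 4) = (T ^ (2 * kap)) ^ 2 * T ^ 4)%N.
    by rewrite expnD -expnM; congr (_ ^ _ * _)%N; ring.
  by apply: eq_leq; ring.
have D3 : (2 * 54 <= D ^ 3)%N.
  have -> : (D ^ 3 = D * D * D)%N by ring.
  by apply: leq_trans (leq_mul (leq_mul D10 D10) D10).
apply: (@leq_trans (D ^ (4 * kap + 1) * (D ^ 3 * M ^ 4 * c ^ 2 * (D ^ (3 * kap) * N ^ (3 * kap))) *
   (D ^ 12 * T ^ (4 * kap + 4)))).
  apply: leq_mul L2; rewrite leq_mul2l; apply/orP; right; apply: leq_mul H4.
  by rewrite !leq_mul2r D3 !orbT.
have -> : (D ^ (4 * kap + 1) * (D ^ 3 * M ^ 4 * c ^ 2 * (D ^ (3 * kap) * N ^ (3 * kap))) *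
   (D ^ 12 * T ^ (4 * kap + 4)) =
   M ^ 2 * N ^ (3 * kap) * (T ^ (4 * kap + 4) * D ^ (4 * kap + 1 + 3 + 3 * kap + 12) * M ^ 2 * c ^ 2))%N.
  by rewrite ![(D ^ (_ + _))%N]expnD; ring.
apply: (@leq_trans (M ^ 2 * N ^ (3 * kap) * N ^ kap)).
  rewrite leq_mul2l; apply/orP; right; apply: leq_trans c1.
  rewrite 2!leq_mul2r leq_mul2l leq_pexp2l ?orbT //; first by apply: leq_trans D10.
  by clear -k3; lia.
by rewrite -mulnA -expnD; apply: eq_leq; congr (_ * _ ^ _)%N; ring.
Qed.

(** The real elements of the box, of order [sqrt N] in number, stay below [N / T] and may be counted
    trivially. *)
Lemma real_part_box (D T N h : nat) : (10 <= D)%N -> (0 < h)%N -> (h ^ 2 <= 4 * N)%N ->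
  (T ^ 2 * D ^ 3 <= N)%N -> ((2 * h).+1 * T <= N)%N.
Proof.
move=> D10 h0 hN TN.
have h3 : ((2 * h).+1 * T <= 3 * h * T)%N by rewrite leq_mul2r succ_triple ?orbT.
apply: leq_trans h3 _; rewrite -leq_sqr.
have D3 : (36 <= D ^ 3)%N.
  have -> : (D ^ 3 = D * D * D)%N by ring.
  by apply: leq_trans (leq_mul (leq_mul D10 D10) D10).
have -> : ((3 * h * T) ^ 2 = 9 * h ^ 2 * T ^ 2)%N by ring.
apply: (@leq_trans (9 * (4 * N) * T ^ 2)).
  by rewrite leq_mul2r leq_mul2l hN !orbT.
have -> : (9 * (4 * N) * T ^ 2 = N * (T ^ 2 * 36))%N by ring.
rewrite -[leqRHS]mulnn leq_mul2l; apply/orP; right; apply: leq_trans TN.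
by rewrite leq_mul2l D3 orbT.
Qed.

(** Factor out [u * b]. The sign of [r] then depends on both variables only through the comparison
    of two ratios, one for each variable, and conditions of that form are a chain in the outer
    one. *)
Lemma lt_sign (u v a b : int) : u != 0 -> b != 0 -> u * a - v * b != 0 ->
  (u * a - v * b < 0) =
  (u < 0) (+) (b < 0) (+) (a%:~R / b%:~R < v%:~R / u%:~R :> rat).
Proof.
move=> u0 b0 r0.
have uq : u%:~R != 0 :> rat by rewrite intr_eq0.
have bq : b%:~R != 0 :> rat by rewrite intr_eq0.
have E : (u * a - v * b)%:~R = u%:~R * b%:~R * (a%:~R / b%:~R - v%:~R / u%:~R) :> rat.
  by rewrite rmorphB !rmorphM /=; field; rewrite uq bq.
rewrite -[a%:~R / _ < _]subr_lt0; set t : rat := a%:~R / _ - _ in E *.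
have t0 : t != 0 by apply: contraNneq r0 => t0; rewrite -(intr_eq0 rat) E t0 mulr0.
rewrite -(ltrz0 rat (u * a - v * b)) E -(ltrz0 rat u) -(ltrz0 rat b).
rewrite -!sgr_cp0 !sgrM.
case: (sgrP u%:~R) uq => // _ _; case: (sgrP b%:~R) bq => // _ _; case: (sgrP t) t0 => // _ _;
by rewrite ?mulr1 ?mul1r ?mulN1r ?opprK ?mulrN1 ?opprK.
Qed.

Lemma ltn_double6 (j k kap : nat) : (j < k)%N -> k.+1 = (2 * kap)%N -> (kap <= 3)%N ->
  (j.+2 <= 6)%N.
Proof. lia. Qed.

Lemma odd_exponent (k kap : nat) : k.+1 = (2 * kap)%N -> (4 * kap + 1 = k * 2 + 3)%N.
Proof. lia. Qed.

Section TypeTwo.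
Variable R : realType.
Local Notation nc := (@ComplexField.Normc.normc R).

Definition kap2 (w z : gaussInt) : R :=
  if odd (gsqn w) then (jacobi (complex.Re (w * z)) (gsqn w))%:~R else 0.

Definition sig2 (w : gaussInt) : R := (jacobi (complex.Re w) (gsqn w))%:~R.

Lemma kap2_le1 w z : `|kap2 w z| <= 1.
Proof.
by rewrite /kap2; case: ifP => _; [exact: jacobi_intr_le1|rewrite normr0 ler01].
Qed.

(* [Re (w x) * Re (w z)] and [Re w * Re (w x z)] differ by a multiple of the
   norm of [w]. *)
Lemma kap2M w x z : kap2 w x * kap2 w z = sig2 w * kap2 w (x * z).
Proof.
rewrite /kap2 /sig2; case: ifP => o; last by rewrite !mulr0.
rewrite -!rmorphM /= -!jacobiMl //; congr (_%:~R); apply: jacobi_modP => //.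
case: w o => u v; case: x => a b; case: z => a' b' _; rewrite !gaussE /=.
have -> : (u * a - v * b) * (u * a' - v * b') -
   u * (u * (a * a' - b * b') - v * (a * b' + b * a')) = (b * b') * (gsqn (u +i* v))%:Z.
  by rewrite gsqnE /=; ring.
by rewrite dvdz_mull.
Qed.

Variables (c M N h T D kap X : nat) (beta : gaussInt -> R[i]).
Hypothesis c0 : (0 < c)%N.
Hypothesis M0 : (0 < M)%N.
Hypothesis T0 : (0 < T)%N.
Hypothesis h0 : (0 < h)%N.
Hypothesis D10 : (10 <= D)%N.
Hypothesis kap0 : (0 < kap)%N.
Hypothesis kap3 : (kap <= 3)%N.
Hypothesis Nh : (N <= h ^ 2)%N.
Hypothesis hN : (h ^ 2 <= 4 * N)%N.
Hypothesis beta1 : forall z, z != 0 -> nc (beta z) <= 1.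
Hypothesis HDg : forall z, z != 0 -> (gsqn z <= N ^ 6)%N -> (gdivcount z <= D)%N.
Hypothesis HDp : forall m, (0 < m)%N -> (m <= M)%N -> (size (plist (c * m)) <= D)%N.
Hypothesis HDs : forall s, (0 < s)%N -> (s <= M)%N -> (size (divisors (s * s)) <= D)%N.
Hypothesis Hc0 : (T ^ 2 * D ^ 3 <= N)%N.
Hypothesis Hc1 : (T ^ (4 * kap + 4) * D ^ 40 <= M)%N.
Hypothesis Hc2 : (T ^ (4 * kap + 4) * D ^ 40 * M ^ 2 * c ^ 2 <= N ^ kap)%N.

Let W := flatten [seq plist (c * m) | m <- iota 1 M].
Let Zs := [seq z <- gbox h | primaryb z && (gsqn z <= N)%N && (complex.Im z != 0)].
Let k := (2 * kap).-1.
Let H := (h ^ (2 * kap))%N.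

Let kE : k.+1 = (2 * kap)%N.
Proof. by rewrite /k prednK // muln_gt0. Qed.

Let sumW (S : zmodType) (F : gaussInt -> S) :
  \sum_(w <- W) F w = \sum_(m <- iota 1 M) \sum_(w <- plist (c * m)) F w.
Proof. by rewrite /W big_flatten big_map. Qed.

Let WP w : w \in W -> exists2 m, (0 < m <= M)%N & primaryb w /\ gsqn w = (c * m)%N.
Proof.
move=> /flattenP [s /seq.mapP [m mi ->]] /plistP [pw E].
by exists m => //; move: mi; rewrite mem_iota add1n ltnS.
Qed.

Let ZsP z : z \in Zs -> [/\ primaryb z, (gsqn z <= N)%N, complex.Im z != 0 & z != 0].
Proof.
rewrite mem_filter => /andP [/andP [/andP [p n] b] _]; split=> //.
exact: primary_neq0.
Qed.

Let sizeW : (size W <= M * D)%N.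
Proof.
rewrite -sum1_size /W big_flatten big_map; apply: (@leq_trans (\sum_(m <- iota 1 M) D)%N).
  rewrite big_seq [leqRHS]big_seq; apply: leq_sum => m; rewrite mem_iota add1n ltnS => /andP [m0 mM].
  by rewrite sum1_size HDp.
by rewrite big_const_seq count_predT iter_addn_0 size_iota mulnC.
Qed.

Let N0 : (0 < N)%N.
Proof. by apply: leq_trans Hc0; rewrite muln_gt0 !expn_gt0 T0 (leq_trans _ D10). Qed.

Lemma typeII_moment (b : gaussInt -> R) : (forall z, z \in Zs -> `|b z| <= 1) ->
  (\sum_(w <- W) `|\sum_(z <- Zs) b z * kap2 w z| ^+ k.+1) ^+ 2 <=
  D%:R ^+ (4 * kap + 1) * (81 * M%:R * H%:R ^+ 4 + 54 * M%:R ^+ 4 * c%:R ^+ 2 * H%:R ^+ 3).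
Proof.
move=> b1.
(* Products keep only what the divisor bound needs: being nonzero, and a bound on the norm. *)
pose Box j := if j is 0%N then Zs else
  [seq z <- gbox (h ^ j.+1) | (z != 0) && (gsqn z <= N ^ j.+1)%N].
have mBox j z : z \in Box j -> z != 0 /\ (gsqn z <= N ^ j.+1)%N.
  case: j => [/ZsP [_ h1 _ h2]|j]; first by rewrite expn1.
  by rewrite mem_filter => /andP [/andP [h1 h2] _].
have HV := @power_moment R gaussInt gaussInt Zs Box kap2 sig2 D%:R kap2M.
have {}HV : (\sum_(w <- W) `|\sum_(z <- Zs) b z * kap2 w z| ^+ k.+1) ^+ 2 <=
  (D%:R ^+ k) ^+ 2 * ((size (gbox H))%:R *
     \sum_(w1 <- W) \sum_(w2 <- W) `|\sum_(y <- gbox H) kap2 w1 y * kap2 w2 y|).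
  apply: HV.
  - by case=> [|j]; rewrite filter_uniq ?gbox_uniq.
  - by [].
  - move=> j x z /mBox [x0 xN] /ZsP [_ zN _ z0].
    have z2 : (gsqn (x * z)%R <= N ^ j.+2)%N by rewrite gsqnM [(N ^ j.+2)%N]expnSr leq_mul.
    rewrite mem_filter z2 andbT -gsqn_gt0 gsqnM muln_gt0 !gsqn_gt0 x0 z0 /=.
    apply: gsqn_box; apply: leq_trans z2 _; rewrite -expnM mulnC expnM.
    by rewrite leq_exp2r.
  - exact: ler0n.
  - move=> j y jk /mBox [y0 yN].
    apply: le_trans (divisor_pairs_le R _ _ _) _.
    + by case: j {jk yN} => [|j]; rewrite filter_uniq ?gbox_uniq.
    + by move=> z x x' /ZsP [_ _ _ z0]; rewrite mulrC [x' * z]mulrC; exact: gmulfI.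
    rewrite ler_nat; apply: leq_trans (HDg y0 _); last first.
      apply: leq_trans yN _; rewrite leq_pexp2l //.
      by apply: ltn_double6 jk kE kap3.
    apply: uniq_leq_size; first by rewrite !filter_uniq ?gbox_uniq.
    move=> z; rewrite mem_filter => /andP [/hasP [x _ /eqP E] _].
    by apply/gdivisorsP => //; exists x; rewrite E.
  - exact: b1.
  - move=> y; rewrite -[H]/(h ^ (2 * kap))%N -kE; case: (k) => [|j].
      by rewrite mem_filter expn1 => /andP [].
    by rewrite mem_filter => /andP [].
  - by move=> w; exact: jacobi_intr_le1.
apply: le_trans HV _.
have H0 : (0 < H)%N by rewrite expn_gt0 h0.
have sB : (size (gbox H))%:R <= 9 * H%:R ^+ 2 :> R.
  rewrite size_gbox -natrX -natrM ler_nat (_ : 9 = 3 ^ 2)%N // -expnMn.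
  by apply: leq_expr2w; exact: succ_triple.
have D1 : 1 <= D%:R :> R by rewrite ler1n (leq_trans _ D10).
have pair m1 m2 w1 w2 : (0 < m1 <= M)%N -> (0 < m2 <= M)%N ->
   w1 \in plist (c * m1) -> w2 \in plist (c * m2) ->
   `|\sum_(y <- gbox H) kap2 w1 y * kap2 w2 y| <=
   (issq (m1 * m2))%:R * (9 * H%:R ^+ 2) + 6 * H%:R * c%:R ^+ 2 * M%:R ^+ 2.
  move=> /andP [m10 m1M] /andP [m20 m2M] /plistP [p1 e1] /plistP [p2 e2].
  have [sq|nsq] := boolP (issq (m1 * m2)).
    rewrite mul1r; apply: ler_wpDr; first by rewrite !mulr_ge0.
    apply: le_trans sB; apply: le_trans (ler_norm_sum _ _ _) _.
    apply: (@le_trans _ _ (\sum_(y <- gbox H) 1)).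
      apply: ler_sum => y _; rewrite normrM -[leRHS]mul1r.
      by apply: ler_pM; rewrite ?kap2_le1.
    by rewrite big_const_seq count_predT iter_addr_0.
  rewrite mul0r add0r.
  have o1 := primary_norm_odd p1; have o2 := primary_norm_odd p2.
  (* The product of the norms is [c ^ 2 * (m1 * m2)], which is a square only if [m1 * m2] is one; so
     the factor [c] creates no new diagonal terms. *)
  have nsq' : ~~ issq (gsqn w1 * gsqn w2).
    apply: contra nsq => /issqP [s E]; apply/issqP.
    have E2 : (c ^ 2 * (m1 * m2) = s ^ 2)%N by rewrite e1 e2 in E; rewrite -[RHS]mulnn -E; ring.
    have : (c ^ 2 %| s ^ 2)%N by rewrite -E2 dvdn_mulr.
    rewrite dvdn_pexp2r // => /dvdnP [t Et]; exists t.
    apply/eqP; rewrite -(eqn_pmul2l (m := c ^ 2)) ?expn_gt0 ?c0 // E2 Et.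
    by apply/eqP; ring.
  have -> : \sum_(y <- gbox H) kap2 w1 y * kap2 w2 y =
     \sum_(z <- gbox H) (jacobi (complex.Re w1 * complex.Re z - complex.Im w1 * complex.Im z) (gsqn w1))%:~R *
             (jacobi (complex.Re w2 * complex.Re z - complex.Im w2 * complex.Im z) (gsqn w2))%:~R.
    apply: eq_bigr => z _; rewrite /kap2 o1 o2.
    by case: (w1) => ? ?; case: (w2) => ? ?; case: z => ? ?; rewrite !gaussE.
  apply: le_trans (@jacobi_plane_sum R _ _ _ _ _ _ H o1 o2 nsq') _.
  rewrite e1 e2 -!natrX -!natrM ler_nat.
  apply: (@leq_trans (2 * (3 * H) * (c * M * (c * M)))).
    by rewrite !leq_mul // succ_triple.
  by apply: eq_leq; ring.
have tot : \sum_(w1 <- W) \sum_(w2 <- W) `|\sum_(y <- gbox H) kap2 w1 y * kap2 w2 y|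
   <= 9 * D%:R ^+ 3 * M%:R * H%:R ^+ 2 + 6 * D%:R ^+ 2 * M%:R ^+ 4 * c%:R ^+ 2 * H%:R.
  apply: (@le_trans _ _ (\sum_(m1 <- iota 1 M) \sum_(m2 <- iota 1 M)
     D%:R ^+ 2 * ((issq (m1 * m2))%:R * (9 * H%:R ^+ 2) + 6 * H%:R * c%:R ^+ 2 * M%:R ^+ 2))).
    rewrite sumW big_seq [leRHS]big_seq; apply: ler_sum => m1; rewrite mem_iota add1n ltnS => h1.
    under eq_bigr do rewrite sumW.
    rewrite exchange_big big_seq [leRHS]big_seq; apply: ler_sum => m2; rewrite mem_iota add1n ltnS => h2.
    set F := (_ + _).
    have F0 : 0 <= F by rewrite addr_ge0 // !mulr_ge0.
    apply: (@le_trans _ _ (\sum_(w1 <- plist (c * m1)) \sum_(w2 <- plist (c * m2)) F)).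
      rewrite big_seq [leRHS]big_seq; apply: ler_sum => w1 k1.
      by rewrite big_seq [leRHS]big_seq; apply: ler_sum => w2 k2; exact: pair.
    rewrite !big_const_seq !count_predT !iter_addr_0 -mulrnA -[_ *+ _]mulr_natl.
    apply: ler_wpM2r => //; rewrite -natrX ler_nat -mulnn.
    by apply: leq_mul; apply: HDp; [case/andP: h2|case/andP: h2|case/andP: h1|case/andP: h1].
  under eq_bigr do rewrite -mulr_sumr big_split /= -mulr_suml big_const_seq count_predT iter_addr_0 size_iota.
  rewrite -mulr_sumr big_split /= -mulr_suml big_const_seq count_predT iter_addr_0 size_iota.
  have sq : \sum_(m1 <- iota 1 M) \sum_(m2 <- iota 1 M) (issq (m1 * m2))%:R <= M%:R * D%:R :> R.
    rewrite -natrM; apply: le_trans (_ : (\sum_(m1 <- iota 1 M) \sum_(m2 <- iota 1 M) issq (m1 * m2))%:R <= _).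
      by rewrite natr_sum; apply: ler_sum => m1 _; rewrite natr_sum.
    by rewrite ler_nat; exact: square_pairs.
  rewrite -mulrnA -[_ *+ (M * M)]mulr_natl natrM.
  apply: (@le_trans _ _ (D%:R ^+ 2 * (M%:R * D%:R * (9 * H%:R ^+ 2) +
     M%:R * M%:R * (6 * H%:R * c%:R ^+ 2 * M%:R ^+ 2)))).
    apply: ler_wpM2l; first exact: exprn_ge0.
    by rewrite lerD2r; apply: ler_wpM2r => //; rewrite mulr_ge0 // exprn_ge0.
  by rewrite le_eqVlt; apply/orP; left; apply/eqP; ring.
apply: (@le_trans _ _ ((D%:R ^+ k) ^+ 2 * (9 * H%:R ^+ 2 *
   (9 * D%:R ^+ 3 * M%:R * H%:R ^+ 2 + 6 * D%:R ^+ 2 * M%:R ^+ 4 * c%:R ^+ 2 * H%:R)))).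
  apply: ler_wpM2l; first exact: sqr_ge0.
  apply: ler_pM => //; apply: sumr_ge0 => ? _; exact: sumr_ge0.
have -> : D%:R ^+ (4 * kap + 1) = (D%:R ^+ k) ^+ 2 * D%:R ^+ 3 :> R.
  by rewrite -exprM -exprD (odd_exponent kE).
have e0 : 0 <= (D%:R ^+ k) ^+ 2 :> R by exact: sqr_ge0.
rewrite -[leRHS]mulrA; apply: ler_wpM2l => //.
set d : R := D%:R in D1 *; set x : R := H%:R; set m : R := M%:R; set e : R := c%:R.
have -> : 9 * x ^+ 2 * (9 * d ^+ 3 * m * x ^+ 2 + 6 * d ^+ 2 * m ^+ 4 * e ^+ 2 * x) =
  81 * d ^+ 3 * m * x ^+ 4 + 54 * (m ^+ 4 * e ^+ 2 * x ^+ 3) * d ^+ 2 by ring.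
have -> : d ^+ 3 * (81 * m * x ^+ 4 + 54 * m ^+ 4 * e ^+ 2 * x ^+ 3) =
  81 * d ^+ 3 * m * x ^+ 4 + 54 * (m ^+ 4 * e ^+ 2 * x ^+ 3) * d ^+ 3 by ring.
rewrite lerD2l; apply: ler_wpM2l; first by rewrite !mulr_ge0 // exprn_ge0.
by rewrite ler_weXn2l.
Qed.

(** Since [gsqn w = c * m] on [W], this is the hyperbola condition [m * gsqn z <= X]. *)
Let P1 (w z : gaussInt) : bool := (gsqn z * gsqn w <= c * X)%N.
Let P2 (w z : gaussInt) : bool :=
  (complex.Re z)%:~R / (complex.Im z)%:~R < (complex.Im w)%:~R / (complex.Re w)%:~R :> rat.
Let B := (N %/ T).+1.

Definition typeII_weight (w z : gaussInt) : R[i] :=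
  let r := complex.Re (w * z) in
  if P1 w z then
    beta z * (jacobi (complex.Im z) `|complex.Re z|%N)%:~R *
    jk_phase R (complex.Re w %% 8)%Z (complex.Re w < 0) (complex.Re z %% 8)%Z
      (complex.Re z < 0) (r %% 8)%Z (r < 0) (complex.Im z)
  else 0.

Definition typeII_label (w : gaussInt) :
    ('I_9 * 'I_9 * bool * 'I_(36 * T).+1 * 'I_(36 * T).+1)%type :=
  (inord `|(complex.Re w %% 8)%Z|, inord `|(complex.Im w %% 8)%Z|, complex.Re w < 0,
   inord (count (P1 w) Zs %/ B), inord (count (P2 w) Zs %/ B)).

Let sizeZs : (size Zs <= 36 * N)%N.
Proof.
apply: (@leq_trans (size (gbox h))); first by rewrite size_filter count_size.
rewrite size_gbox; apply: (@leq_trans ((3 * h) ^ 2)); first by rewrite leq_sqr succ_triple.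
by rewrite expnMn (_ : 36 = 3 ^ 2 * 4)%N // -mulnA leq_mul2l hN.
Qed.

Let labelE w w' : w \in W -> w' \in W -> typeII_label w = typeII_label w' ->
  [/\ (8%:Z %| complex.Re w - complex.Re w')%Z, (8%:Z %| complex.Im w - complex.Im w')%Z,
      (complex.Re w < 0) = (complex.Re w' < 0),
   (count (fun z => P1 w z != P1 w' z) Zs < B)%N &
   (count (fun z => P2 w z != P2 w' z) Zs < B)%N].
Proof.
move=> wW w'W [e1 e2 e3 e4 e5].
have l8 a : (`|(a %% 8)%Z| <= 8)%N by exact: absz_modz_le.
have lc p : (count p Zs %/ B <= 36 * T)%N.
  (* The block length is rescaled so that [block_count] applies to counts up to
     [36 * N = 2 * (18 * N)]. *)
  have -> : B = ((18 * N) %/ (18 * T)).+1 by rewrite divnMl.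
  rewrite (_ : 36 * T = 2 * (18 * T))%N; last by rewrite mulnA.
  apply: block_count; first by rewrite muln_gt0 T0.
  by rewrite mulnA; apply: leq_trans sizeZs; exact: count_size.
split.
- by apply: dvdz_absz_modz => //; exact: inord_inj (l8 _) (l8 _) e1.
- by apply: dvdz_absz_modz => //; exact: inord_inj (l8 _) (l8 _) e2.
- exact: e3.
- apply: chain_count => //; last exact: inord_inj (lc _) (lc _) e4.
  rewrite /P1; have [le|/ltnW le] := leqP (gsqn w) (gsqn w'); [right|left] => z; apply: leq_trans;
  by rewrite leq_mul2l le orbT.
- apply: chain_count => //; last exact: inord_inj (lc _) (lc _) e5.
  rewrite /P2; set s : rat := _ / (complex.Re w)%:~R; set s' : rat := _ / (complex.Re w')%:~R.
  have [le|/ltW le] := lerP s s'; [left|right] => z h1; exact: lt_le_trans h1 le.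
Qed.

Let weight_le1 w z : z \in Zs -> nc (typeII_weight w z) <= 1.
Proof.
move=> /ZsP [_ _ _ z0]; rewrite /typeII_weight; case: (P1 w z); last by rewrite ComplexField.Normc.normc0.
rewrite normcM nc_phase mulr1 normcM -[leRHS]mul1r; apply: ler_pM; rewrite ?normc_ge0 ?beta1 //.
have -> : ((jacobi (complex.Im z) `|complex.Re z|)%:~R : R[i]) =
  ((jacobi (complex.Im z) `|complex.Re z|)%:~R : R)%:C by rewrite rmorph_int.
by rewrite normcR jacobi_intr_le1.
Qed.

(** Off the two exceptional sets the weights are equal: the label fixes [w] mod 8 and the sign of
    its real part, and [lt_sign] turns agreement of [P2] into agreement of the sign of
    [Re (w * z)]. *)
Let weight_dist w w' z : w \in W -> w' \in W -> typeII_label w = typeII_label w' ->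
  z \in Zs ->
  nc (typeII_weight w z - typeII_weight w' z) <=
  2 * (P1 w z != P1 w' z)%:R + 2 * (P2 w z != P2 w' z)%:R.
Proof.
move=> wW w'W E zZ; have [q1 q2 e3 _ _] := labelE wW w'W E.
have [pz _ b0 _] := ZsP zZ.
have [m _ [pw _]] := WP wW; have [m' _ [pw' _]] := WP w'W.
have triv : nc (typeII_weight w z - typeII_weight w' z) <= 2.
  apply: le_trans (normcB _ _) _; rewrite -[leRHS]/(1 + 1)%R.
  by apply: lerD; apply: weight_le1.
have [e1|ne1] := eqVneq (P1 w z) (P1 w' z); last first.
  by apply: le_trans triv _; rewrite mulr1 lerDl mulr_ge0.
have [e2|ne2] := eqVneq (P2 w z) (P2 w' z); last first.
  by apply: le_trans triv _; rewrite mulr1 mulr0 add0r.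
rewrite !mulr0 !add0r; suff -> : typeII_weight w z = typeII_weight w' z.
  by rewrite subrr ComplexField.Normc.normc0.
rewrite /typeII_weight -e1; case: (P1 w z) => //.
have nz (x : gaussInt) : primaryb x -> complex.Re x != 0.
  case: x => x y /primary_parity [ox _] /=; by apply: contraTneq ox => ->.
have rw x : primaryb x -> complex.Re (x * z) != 0 by move=> px; apply: nz; exact: primaryM.
have RE (x : gaussInt) : complex.Re (x * z) = complex.Re x * complex.Re z - complex.Im x * complex.Im z.
  by case: x => ? ?; case: (z) => ? ?; rewrite gaussE.
have sE x : primaryb x -> (complex.Re (x * z) < 0) =
   (complex.Re x < 0) (+) (complex.Im z < 0) (+) P2 x z.
  by move=> px; have := rw x px; rewrite RE => r0; apply: lt_sign => //; exact: nz.
rewrite (sE w pw) (sE w' pw') -e3 -e2.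
have -> : (complex.Re w %% 8)%Z = (complex.Re w' %% 8)%Z by apply/eqP; rewrite eqz_mod_dvd.
have -> // : (complex.Re (w * z) %% 8)%Z = (complex.Re (w' * z) %% 8)%Z.
apply/eqP; rewrite eqz_mod_dvd !RE.
set a := complex.Re z; set b := complex.Im z.
have -> : complex.Re w * a - complex.Im w * b - (complex.Re w' * a - complex.Im w' * b) =
  (complex.Re w - complex.Re w') * a - (complex.Im w - complex.Im w') * b by ring.
by rewrite rpredB // dvdz_mulr.
Qed.

Lemma typeII_bound :
  \sum_(m <- iota 1 M) \sum_(w <- plist (c * m))
    nc (\sum_(z <- gbox h | primaryb z && (gsqn z <= N)%N && (gsqn z * gsqn w <= c * X)%N)
       beta z * jacobi_kubota R (w * z))
  <= 13 * D%:R * M%:R * N%:R / T%:R.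
Proof.
rewrite -(sumW (fun w => nc (\sum_(z <- gbox h | primaryb z && (gsqn z <= N)%N &&
  (gsqn z * gsqn w <= c * X)%N) beta z * jacobi_kubota R (w * z)))).
have Tp : 0 < T%:R :> R by rewrite ltr0n.
have Np : 0 < N%:R :> R by rewrite ltr0n N0.
have Mp : 0 < M%:R :> R by rewrite ltr0n.
have Dr : 10 <= D%:R :> R by rewrite ler_nat.
have D0 : 0 < D%:R :> R by rewrite ltr0n (leq_trans _ D10).
have sW : (size W)%:R <= M%:R * D%:R :> R by rewrite -natrM ler_nat.
apply: (@le_trans _ _ (\sum_(w <- W) (N%:R / T%:R +
   nc (\sum_(z <- Zs) (kap2 w z)%:C * typeII_weight w z)))).
  rewrite big_seq [leRHS]big_seq; apply: ler_sum => w wW.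
  have [m _ [pw _]] := WP wW.
  (* [jk_mul] does not cover real [z], which are counted trivially. *)
  rewrite (bigID (fun z : gaussInt => complex.Im z == 0)) /=.
  apply: le_trans (normcD _ _) _; apply: lerD.
    apply: le_trans (normc_sum _ _ _) _.
    apply: (@le_trans _ _ (\sum_(z <- gbox h | complex.Im z == 0) 1)).
      rewrite big_mkcond [leRHS]big_mkcond; apply: ler_sum => z _.
      case: ifP => [/andP [/andP [/andP [pz _] _] ->]|_]; last by case: ifP.
      rewrite normcM -[leRHS]mul1r; apply: ler_pM; rewrite ?normc_ge0 ?jk_norm //.
      by apply: beta1; exact: primary_neq0.
    have -> : \sum_(z <- gbox h | complex.Im z == 0) 1 = (2 * h).+1%:R :> R.
      rewrite big_mkcond big_allpairs_dep /=.
      rewrite (eq_bigr (fun=> 1)) ?big_const_seq ?count_predT ?iter_addr_0 ?size_gintbox // => a _.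
      rewrite (bigD1_seq 0) ?gintbox_uniq ?mem_gintbox //= big1 ?addr0 // => b b0.
      by rewrite (negPf b0).
    by rewrite ler_pdivlMr // -natrM ler_nat; exact: real_part_box D10 h0 hN Hc0.
  have -> : \sum_(z <- gbox h | primaryb z && (gsqn z <= N)%N && (gsqn z * gsqn w <= c * X)%N &&
      (complex.Im z != 0)) beta z * jacobi_kubota R (w * z) =
     ((jacobi (complex.Im w) `|complex.Re w|%N)%:~R : R)%:C *
      \sum_(z <- Zs) (kap2 w z)%:C * typeII_weight w z.
    rewrite mulr_sumr /Zs big_filter big_mkcond [RHS]big_mkcond; apply: eq_bigr => z _.
    rewrite -/(P1 w z).
    case pz : (primaryb z) => //=; case: (gsqn z <= N)%N => //=.
    case b0 : (complex.Im z == 0) => /=; first by rewrite !andbF.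
    rewrite /typeII_weight; case: (P1 w z) => /=; last by rewrite !mulr0.
    have ow := primary_norm_odd pw.
    move: pw pz b0 ow; case: (w) => u v; case: (z) => a b pw' pz b0 ow.
    rewrite (jk_mul _ pw' pz) ?b0 // /kap2 ow gaussE /= !rmorph_int; ring.
  rewrite normcM -[leRHS]mul1r; apply: ler_wpM2r; first exact: normc_ge0.
  by rewrite normcR jacobi_intr_le1.
rewrite big_split /= big_const_seq count_predT iter_addr_0.
pose Lb := (#|{: 'I_9 * 'I_9 * bool * 'I_(36 * T).+1 * 'I_(36 * T).+1}|)%N.
have LbE : (Lb <= D ^ 6 * T ^ 2)%N.
  by rewrite /Lb !card_prod !card_ord card_bool; exact: label_count_le.
have Lb0 : (0 < Lb)%N by rewrite /Lb !card_prod !card_ord card_bool.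
have Lbp : 0 < Lb%:R :> R by rewrite ltr0n.
(* With [tau = N / T] this makes [Lb * V / tau ^+ k] equal to [M * N / T]. The two parts of the
   moment bound each take half of [V ^+ 2]. *)
pose V : R := M%:R * N%:R ^+ (2 * kap) / (T%:R ^+ (2 * kap) * Lb%:R).
have Vp : 0 <= V by rewrite /V divr_ge0 ?mulr_ge0 ?exprn_ge0.
have HV (b : gaussInt -> R) : (forall z, z \in Zs -> `|b z| <= 1) ->
    \sum_(w <- W) `|\sum_(z <- Zs) b z * kap2 w z| ^+ k.+1 <= V.
  move=> b1; apply: ler_of_sqr => //.
  apply: le_trans (typeII_moment b1) _.
  rewrite /V exprMn exprVn ler_pdivlMr; last by rewrite exprn_gt0 // mulr_gt0 // exprn_gt0.
  have h1 := typeII_cond1 D10 kap3 hN LbE Hc1.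
  have h2 := typeII_cond2 D10 kap3 hN LbE Hc2.
  rewrite -(ler_nat R) -/H !(natrM, natrX) in h1.
  rewrite -(ler_nat R) -/H !(natrM, natrX) in h2.
  have -> : (M%:R * N%:R ^+ (2 * kap)) ^+ 2 = M%:R ^+ 2 * N%:R ^+ (4 * kap) :> R.
    by rewrite exprMn -exprM (_ : 2 * kap * 2 = 4 * kap)%N // mulnC mulnA.
  move: h1 h2; set d := D%:R ^+ (4 * kap + 1); set y := _ ^+ 2; set z := M%:R ^+ 2 * _.
  rewrite /H natrX; set x1 := (h%:R ^+ _) ^+ 4; set x2 := (h%:R ^+ _) ^+ 3; move=> h1 h2.
  have -> : d * (81 * M%:R * x1 + 54 * M%:R ^+ 4 * c%:R ^+ 2 * x2) * y =
    2^-1 * (d * (2 * 81 * M%:R * x1) * y) + 2^-1 * (d * (2 * 54 * M%:R ^+ 4 * c%:R ^+ 2 * x2) * y).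
    by field.
  by lra.
pose E : R := 8 * N%:R / T%:R.
have TN : (T <= N)%N.
  apply: leq_trans Hc0; rewrite -[leqLHS]muln1 leq_mul ?expn_gt0 ?(leq_trans _ D10) //.
  by rewrite -{1}(expn1 T) leq_pexp2l.
have Bb : B%:R <= 2 * N%:R / T%:R :> R.
  rewrite ler_pdivlMr // -!natrM ler_nat /B.
  by have := @block_mul N T 1; rewrite muln1 mul1n; apply.
have HE (w w' : gaussInt) : w \in W -> w' \in W -> typeII_label w = typeII_label w' ->
    \sum_(z <- Zs) nc (typeII_weight w z - typeII_weight w' z) <= E.
  move=> wW w'W Ew; have [_ _ _ c1 c2] := labelE wW w'W Ew.
  apply: (@le_trans _ _ (\sum_(z <- Zs) (2 * (P1 w z != P1 w' z)%:R + 2 * (P2 w z != P2 w' z)%:R))).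
    by rewrite big_seq [leRHS]big_seq; apply: ler_sum => z zZ; exact: weight_dist.
  rewrite !big_split /= -!mulr_sumr.
  have cnt (p : pred gaussInt) : \sum_(i <- Zs) (p i)%:R = (count p Zs)%:R :> R.
    by rewrite -sum1_count natr_sum [RHS]big_mkcond; apply: eq_bigr => i _; case: (p i).
  rewrite (cnt (fun z => P1 w z != P1 w' z)) (cnt (fun z => P2 w z != P2 w' z)).
  have -> : E = 2 * (2 * N%:R / T%:R) + 2 * (2 * N%:R / T%:R) by rewrite /E; ring.
  by apply: lerD; apply: ler_wpM2l => //; apply: le_trans Bb; rewrite ler_nat; exact: ltnW.
have tau0 : 0 < N%:R / T%:R :> R by rewrite divr_gt0.
have := @approx_bound R gaussInt gaussInt W Zs kap2 _ typeII_label typeII_weight V (N%:R / T%:R) E k tau0.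
move=> /(_ (fun w z _ _ => kap2_le1 w z)) /(_ (fun w z _ zZ => weight_le1 w zZ) HV HE) main.
have Ek : (#|{: 'I_9 * 'I_9 * bool * 'I_(36 * T).+1 * 'I_(36 * T).+1}|%:R * V / (N%:R / T%:R) ^+ k : R)
   = M%:R * (N%:R / T%:R).
  rewrite -/Lb /V -kE !exprS; move: (k) => kk.
  have n1 : N%:R ^+ kk != 0 :> R by rewrite expf_neq0 // gt_eqF.
  have n2 : T%:R ^+ kk != 0 :> R by rewrite expf_neq0 // gt_eqF.
  by rewrite exprMn exprVn; field; rewrite n1 n2 !gt_eqF.
rewrite Ek in main.
apply: (@le_trans _ _ (M%:R * D%:R * (N%:R / T%:R) + (M%:R * D%:R * E +
   2 * (M%:R * D%:R * (N%:R / T%:R) + M%:R * (N%:R / T%:R))))).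
  apply: lerD; first by rewrite -[_ *+ size W]mulr_natl; apply: ler_wpM2r => //; exact: ltW.
  apply: le_trans main _; apply: lerD.
    by apply: ler_wpM2r => //; rewrite /E divr_ge0 ?mulr_ge0.
  by rewrite ler_pM2l // lerD2r; apply: ler_wpM2r => //; exact: ltW.
rewrite /E -subr_ge0.
have -> : 13 * D%:R * M%:R * N%:R / T%:R - (M%:R * D%:R * (N%:R / T%:R) + (M%:R * D%:R * (8 * N%:R / T%:R) +
   2 * (M%:R * D%:R * (N%:R / T%:R) + M%:R * (N%:R / T%:R)))) =
   (2 * D%:R - 2) * (M%:R * (N%:R / T%:R)) :> R by ring.
by apply: mulr_ge0; [lra|rewrite mulr_ge0 // ltW].
Qed.

End TypeTwo.

(** * Sums over prime powers *)

Lemma plist_sum (V : zmodType) (A y : nat) (F : nat -> gaussInt -> V) : (y <= A ^ 2)%N ->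
  \sum_(1 <= n < y.+1) \sum_(z <- plist n) F n z =
  \sum_(z <- gbox A | primaryb z && (gsqn z <= y)%N) F (gsqn z) z.
Proof.
move=> yA.
transitivity (\sum_(1 <= n < y.+1) \sum_(z <- gbox A)
   if primaryb z && (gsqn z == n) then F (gsqn z) z else 0).
  rewrite big_nat [RHS]big_nat; apply: eq_bigr => n /andP [n1 ny].
  rewrite -[RHS]big_mkcond -[RHS]big_filter.
  have pe : perm_eq [seq z <- gbox A | primaryb z && (gsqn z == n)] (plist n).
    apply: uniq_perm; rewrite ?plist_uniq ?filter_uniq ?gbox_uniq // => z.
    rewrite mem_filter; apply/idP/plistP => [/andP [/andP [-> /eqP ->] _] //|[-> E]].
    by rewrite E eqxx /= gsqn_box // E (leq_trans _ yA).
  by rewrite (perm_big _ pe) /=; apply: eq_big_seq => z /plistP [_ ->].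
rewrite exchange_big [RHS]big_mkcond /=; apply: eq_bigr => z _.
have [pz|_] := boolP (primaryb z); last by rewrite big1.
have z0 : (0 < gsqn z)%N by rewrite gsqn_gt0; exact: primary_neq0.
have [le|gt] := leqP (gsqn z) y.
  rewrite (bigD1_seq (gsqn z)) ?iota_uniq ?mem_index_iota ?z0 //= eqxx big1 ?addr0 // => n.
  by rewrite eq_sym => /negPf ->.
rewrite big_nat big1 // => n /andP [_ ny]; case: eqP => // E.
by move: ny gt; rewrite E => h1 h2; have := leq_trans h1 h2; rewrite ltnn.
Qed.

Lemma sqrt_up (n : nat) : (0 < n)%N -> exists h, [/\ (0 < h)%N, (n <= h ^ 2)%N & (h ^ 2 <= 4 * n)%N].
Proof.
move=> n0; have ex : exists h, (n <= h ^ 2)%N by exists n; rewrite -mulnn leq_pmull.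
case: (ex_minnP ex) => h nh minh.
have h0 : (0 < h)%N by case: h nh {minh} => //; rewrite exp0n // leqNgt n0.
exists h; split=> //.
have [h1|h1] := leqP h 1; first by apply: (@leq_trans 4); [rewrite (@leq_exp2r _ 2 2); lia|lia].
have lt : (h.-1 ^ 2 < n)%N by rewrite ltnNge; apply/negP => /minh; lia.
case: h h1 lt {nh minh h0} => // h h1 /= lt.
apply: (@leq_trans ((2 * h) ^ 2)); first by apply: leq_expr2w; lia.
by rewrite expnMn; lia.
Qed.

Lemma size_divisors_gdivcount (n : nat) : (0 < n)%N ->
  (size (divisors n) <= gdivcount (n%:R : gaussInt))%N.
Proof.
move=> n0; have z0 : (n%:R : gaussInt) != 0.
  by rewrite gauss_natE eq_complex /= eqxx andbT eqz_nat -lt0n.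
rewrite -(size_map (fun m : nat => (m%:R : gaussInt)) (divisors n)); apply: uniq_leq_size.
  rewrite map_inj_uniq ?divisors_uniq // => a b; rewrite !gauss_natE => - [].
  by [].
move=> z /seq.mapP [m]; rewrite -dvdn_divisors // => /dvdnP [e E] ->.
by apply/gdivisorsP => //; exists e%:R; rewrite E natrM mulrC.
Qed.

Section Assembly.
Variable R : realType.
Local Notation nc := (@ComplexField.Normc.normc R).

(** Partial summation: the difference from [ln y] times the plain partial sum grows at each step by
    an increment of [ln] times a partial sum, and the increments telescope. *)
Lemma abel_ln (g : nat -> R[i]) (Y : nat) (B : R) :
  (forall y, (y <= Y)%N -> nc (\sum_(1 <= n < y.+1) g n) <= B) ->
  nc (\sum_(1 <= n < Y.+1) (ln n%:R : R)%:C * g n) <= 2 * B * ln Y%:R.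
Proof.
move=> HB.
have B0 : 0 <= B by apply: le_trans (HB 0%N isT); rewrite normc_ge0.
have lnn n : 0 <= ln n%:R :> R.
  by case: n => [|n]; [rewrite ln0|apply: ln_ge0; rewrite ler1n].
have H y : (y <= Y)%N -> nc (\sum_(1 <= n < y.+1) (ln n%:R : R)%:C * g n -
    (ln y%:R)%:C * \sum_(1 <= n < y.+1) g n) <= B * ln y%:R.
  elim: y => [|y IH] yY.
    by rewrite !big_geq // mulr0 subrr ComplexField.Normc.normc0 mulr_ge0.
  rewrite !(big_nat_recr y.+1) //=.
  set S := \sum_(1 <= i < y.+1) _ * _ in IH *; set G := \sum_(1 <= i < y.+1) g i in IH *.
  have -> : S + (ln y.+1%:R)%:C * g y.+1 - (ln y.+1%:R)%:C * (G + g y.+1) =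
     (S - (ln y%:R)%:C * G) - (ln y.+1%:R - ln y%:R)%:C * G by rewrite rmorphB /=; ring.
  apply: le_trans (normcB _ _) _.
  have -> : B * ln y.+1%:R = B * ln y%:R + B * (ln y.+1%:R - ln y%:R) by ring.
  apply: lerD; first by apply: IH; exact: ltnW.
  have mono : 0 <= ln y.+1%:R - ln y%:R :> R.
    rewrite subr_ge0; case: (y) => [|y']; first by rewrite ln0.
    by rewrite ler_ln ?posrE ?ltr0n // ler_nat.
  rewrite normcM normcR ger0_norm // mulrC; apply: ler_wpM2r => //.
  by apply: HB; exact: ltnW.
have h1 := H Y (leqnn Y).
rewrite -[X in nc X](subrK ((ln Y%:R)%:C * \sum_(1 <= n < Y.+1) g n)).
apply: le_trans (normcD _ _) _.
have -> : 2 * B * ln Y%:R = B * ln Y%:R + B * ln Y%:R by ring.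
apply: lerD => //; rewrite normcM normcR ger0_norm // mulrC; apply: ler_wpM2r => //.
exact: HB.
Qed.

Lemma swap_hyperbola (X : nat) (G : nat -> nat -> R[i]) :
  \sum_(1 <= m < X.+1) \sum_(1 <= n < (X %/ m).+1) G m n =
  \sum_(1 <= n < X.+1) \sum_(1 <= m < (X %/ n).+1) G m n.
Proof.
have E (F : nat -> nat -> R[i]) : \sum_(1 <= m < X.+1) \sum_(1 <= n < (X %/ m).+1) F m n =
   \sum_(1 <= m < X.+1) \sum_(1 <= n < X.+1) if (m * n <= X)%N then F m n else 0.
  rewrite big_nat [RHS]big_nat; apply: eq_bigr => m /andP [m1 mX].
  rewrite -big_mkcond /= (big_nat_widen _ _ X.+1); last first.
    by rewrite ltnS; exact: leq_div.
  rewrite big_nat_cond [RHS]big_nat_cond; apply: eq_bigl => n.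
  by rewrite andTb [(n < (X %/ m).+1)%N]ltnS leq_divRL // mulnC.
rewrite E exchange_big (E (fun n m => G m n)) /=.
by apply: eq_bigr => n _; apply: eq_bigr => m _; rewrite mulnC.
Qed.

Variables (chi : gaussInt -> R[i]) (k : int) (d : nat).
Hypothesis d0 : (1 <= d)%N.
Hypothesis hchi : gauss_character (4 * d)%:R chi.

Lemma lambda_norm (n : nat) : nc (lambda chi k n) <= (size (plist n))%:R.
Proof.
rewrite (@lambdaE R chi k d d0); apply: le_trans (normc_sum _ _ _) _.
apply: (@le_trans _ _ (\sum_(z <- plist n) 1)).
  rewrite big_seq [leRHS]big_seq; apply: ler_sum => z /plistP [pz _].
  rewrite normcM -[leRHS]mul1r; apply: ler_pM; rewrite ?normc_ge0 ?jk_norm //.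
  by apply: (psi_norm k d0 hchi); exact: primary_neq0.
by rewrite big_const_seq count_predT iter_addr_0.
Qed.

Variables (c X U L T D : nat).
Hypothesis c0 : (0 < c)%N.
Hypothesis X0 : (0 < X)%N.
Hypothesis T0 : (0 < T)%N.
Hypothesis D10 : (10 <= D)%N.
Hypothesis U0 : (0 < U)%N.
Hypothesis UL : (U * U <= L)%N.
Hypothesis XL : (X <= L * L)%N.
Hypothesis LX : (2 * L <= X)%N.
Hypothesis Hdiv : forall z : gaussInt, z != 0 -> (gsqn z <= 256 * (c * X) ^ 6)%N ->
  (2 * gdivcount z <= D)%N.
Hypothesis Hln : 4 * (1 + ln (X%:R : R)) <= D%:R.
Hypothesis Hlog : (trunc_log 2 X < D)%N.
Hypothesis HI : forall A m, (0 < m)%N -> (m <= U)%N -> (X %/ m <= A ^ 2)%N ->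
  ((8 * d * (c * m)) ^ 2 * (`|k| + 1) ^ 2 * T ^ 12 * D ^ 11 <= A)%N.
Hypothesis HII : forall i, (U < 2 ^ i.+1)%N -> (2 ^ i <= L)%N ->
  [/\ (T ^ 2 * D ^ 3 <= X %/ 2 ^ i)%N & exists kap, [/\ (0 < kap)%N, (kap <= 3)%N,
   (T ^ (4 * kap + 4) * D ^ 40 <= 2 ^ i.+1)%N &
   (T ^ (4 * kap + 4) * D ^ 40 * (2 ^ i.+1) ^ 2 * c ^ 2 <= (X %/ 2 ^ i) ^ kap)%N]].

Let f (n : nat) : R[i] := lambda chi k (c * n).

Let Dr : 10 <= D%:R :> R. Proof. by rewrite ler_nat. Qed.
Let Tp : 0 < T%:R :> R. Proof. by rewrite ltr0n. Qed.

Let UX : (U <= X)%N.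
Proof.
apply: leq_trans (leq_trans UL _); first by rewrite leq_pmull.
by apply: leq_trans LX; rewrite leq_pmull.
Qed.

Let divisors_le n : (0 < n)%N -> (n ^ 2 <= 256 * (c * X) ^ 6)%N -> (2 * size (divisors n) <= D)%N.
Proof.
move=> n0 h; apply: leq_trans (Hdiv _ _ : 2 * gdivcount (n%:R : gaussInt) <= D)%N.
- by rewrite leq_mul2l size_divisors_gdivcount ?orbT.
- by rewrite gauss_natE eq_complex /= eqxx andbT eqz_nat -lt0n.
by rewrite gsqn_nat.
Qed.

(** Here [256 = 4 ^ 4]: type I boxes have [A ^ 2 <= 4 * X] and use divisors of integers up to
    [A ^ 4], whose norms reach [(4 * X) ^ 4]. The exponent 6 is that of the sixth moments. *)
Let pow_bound a e : (a <= 4 * X)%N -> (e <= 4)%N -> (a ^ e <= 256 * (c * X) ^ 6)%N.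
Proof.
move=> h e4; apply: (@leq_trans ((4 * (c * X)) ^ e)).
  by apply: leq_expr2w; apply: leq_trans h _; rewrite leq_mul2l leq_pmull ?orbT.
apply: (@leq_trans ((4 * (c * X)) ^ 4)); first by rewrite leq_pexp2l // !muln_gt0 c0.
rewrite expnMn; apply: leq_mul => //.
by rewrite leq_pexp2l // muln_gt0 c0.
Qed.

Let plist_le m : (0 < m)%N -> (m <= X)%N -> (size (plist (c * m)) <= D)%N.
Proof.
move=> m0 mX; have cm0 : (0 < c * m)%N by rewrite muln_gt0 c0.
apply: leq_trans (size_plist_le cm0) _.
apply: leq_trans (_ : 2 * gdivcount ((c * m)%:R : gaussInt) <= _)%N; first by rewrite leq_pmull.
apply: Hdiv; first by rewrite gauss_natE eq_complex /= eqxx andbT eqz_nat -lt0n.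
rewrite gsqn_nat; apply: (@leq_trans ((c * X) ^ 2)).
  by apply: leq_expr2w; rewrite leq_mul2l mX orbT.
apply: leq_trans (leq_pmull _ _) => //; rewrite leq_pexp2l // muln_gt0 c0 //.
Qed.

Let divisors_small m : (0 < m)%N -> (m <= X)%N -> (size (divisors m) <= D)%N.
Proof.
move=> m0 mX; apply: leq_trans (divisors_le m0 _); first by rewrite leq_pmull.
by apply: pow_bound => //; apply: leq_trans mX _; rewrite leq_pmull.
Qed.

Let lnX0 : 0 <= ln (X%:R : R).
Proof. by apply: ln_ge0; rewrite ler1n. Qed.

Let ln_small m : (0 < m)%N -> (m <= X)%N -> ln (m%:R : R) <= D%:R.
Proof.
move=> m0 mX; apply: (@le_trans _ _ (ln X%:R)).
  by rewrite ler_ln ?posrE ?ltr0n // ler_nat.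
by have := Hln; have := lnX0; lra.
Qed.

Lemma typeI_partial (m : nat) (w : gaussInt) (y : nat) : (0 < m)%N -> (m <= U)%N ->
  w \in plist (c * m) -> (y <= X %/ m)%N ->
  nc (\sum_(1 <= n < y.+1) \sum_(z <- plist n) psi chi k z * jacobi_kubota R (w * z))
  <= 180 * D%:R * X%:R / (m%:R * T%:R).
Proof.
move=> m0 mU /plistP [pw Nw] yX.
have mX : (m <= X)%N by apply: leq_trans UX.
have Xm0 : (0 < X %/ m)%N by rewrite divn_gt0.
have [A [A0 XA AX]] := sqrt_up Xm0.
rewrite (plist_sum (A := A) _ (leq_trans yX XA)).
have A4X : (A ^ 2 <= 4 * X)%N by apply: leq_trans AX _; rewrite leq_mul2l leq_div orbT.
have A2X : (A <= 2 * X)%N.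
  rewrite -leq_sqr; apply: leq_trans A4X _; rewrite expnMn leq_mul2l /= -mulnn leq_pmull //.
case: w pw Nw => u v pw Nw.
apply: (@le_trans _ _ (45 * D%:R * A%:R ^+ 2 / T%:R)).
  apply: (@typeI_bound R chi k d d0 hchi u v pw A D T y T0 D10).
  - move=> n n0 nA; apply: divisors_le => //.
    apply: (@leq_trans ((4 * X) ^ 4)); last by apply: pow_bound.
    apply: (@leq_trans ((A ^ 2) ^ 4)); last exact: leq_expr2w.
    by apply: leq_trans (leq_expr2w 2 nA) _; rewrite -!expnM.
  - apply: le_trans Hln.
    have lnA : ln (A%:R : R) <= ln (2 * X%:R).
      by rewrite ler_ln ?posrE ?mulr_gt0 ?ltr0n // -natrM ler_nat.
    have ln2 : ln (2 : R) <= 1 by have := @le_ln1Dx R 1; rewrite -[1 + 1]/2; apply; lra.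
    rewrite lnM ?posrE ?ltr0n // in lnA; have := lnX0; lra.
  - by rewrite Nw; exact: HI.
rewrite -subr_ge0; have mp : 0 < m%:R :> R by rewrite ltr0n.
have -> : 180 * D%:R * X%:R / (m%:R * T%:R) - 45 * D%:R * A%:R ^+ 2 / T%:R =
  45 * D%:R / (m%:R * T%:R) * (4 * X%:R - A%:R ^+ 2 * m%:R) :> R.
  by field; rewrite !gt_eqF.
apply: mulr_ge0; first by rewrite divr_ge0 ?mulr_ge0.
rewrite subr_ge0 -natrX -!natrM ler_nat; apply: (@leq_trans (4 * (X %/ m) * m)).
  by rewrite leq_mul2r AX orbT.
by rewrite -mulnA leq_mul2l leq_divM orbT.
Qed.

(** The smooth factor [omega] enters only through its effect on partial sums; it will be [ln], by
    [abel_ln], and the constant 1. *)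
Lemma typeI_total (alpha omega : nat -> R) :
  (forall m, (0 < m)%N -> (m <= X)%N -> `|alpha m| <= D%:R) ->
  (forall Y g B, (0 < Y)%N -> (Y <= X)%N ->
     (forall y, (y <= Y)%N -> nc (\sum_(1 <= n < y.+1) g n) <= B) ->
     nc (\sum_(1 <= n < Y.+1) (omega n)%:C * g n) <= 2 * D%:R * B) ->
  nc (\sum_(1 <= m < X.+1) \sum_(1 <= n < (X %/ m).+1)
        (if (m <= U)%N then alpha m * omega n else 0)%:C * f (m * n))
  <= 360 * D%:R ^+ 5 * X%:R / T%:R.
Proof.
move=> Ha Ho; apply: le_trans (normc_sum _ _ _) _.
apply: (@le_trans _ _ (\sum_(1 <= m < X.+1) 360 * D%:R ^+ 4 * X%:R / T%:R * m%:R^-1)).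
  apply: ler_sum_nat => m /andP [m0]; rewrite ltnS => mX.
  have mp : 0 < m%:R :> R by rewrite ltr0n.
  have [mU|_] := leqP m U; last first.
    rewrite (_ : \sum_(1 <= n < (X %/ m).+1) 0%:C * f (m * n) = 0); last first.
      by apply: big1 => n _; rewrite mul0r.
    rewrite ComplexField.Normc.normc0.
    by rewrite !mulr_ge0 // ?exprn_ge0 // invr_ge0.
  have -> : \sum_(1 <= n < (X %/ m).+1) (alpha m * omega n)%:C * f (m * n) =
     \sum_(w <- plist (c * m)) ((alpha m)%:C * psi chi k w) *
       \sum_(1 <= n < (X %/ m).+1) (omega n)%:C *
        \sum_(z <- plist n) psi chi k z * jacobi_kubota R (w * z).
    under [RHS]eq_bigr do rewrite mulr_sumr.
    rewrite exchange_big; apply: eq_big_nat => n /andP [n0 _] /=.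
    rewrite /f mulnA (@lambda_mul R chi k d d0 (c * m) n) ?muln_gt0 ?c0 // mulr_sumr.
    apply: eq_bigr => w _; rewrite mulrA mulr_sumr [RHS]mulr_sumr; apply: eq_bigr => z _.
    by rewrite (psiM k hchi) rmorphM; ring.
  apply: le_trans (normc_sum _ _ _) _.
  apply: (@le_trans _ _ (\sum_(w <- plist (c * m)) D%:R * (2 * D%:R * (180 * D%:R * X%:R / (m%:R * T%:R))))).
    rewrite big_seq [leRHS]big_seq; apply: ler_sum => w wm.
    rewrite normcM; apply: ler_pM; rewrite ?normc_ge0 //.
      rewrite normcM normcR -[leRHS]mulr1; apply: ler_pM; rewrite ?normc_ge0 ?Ha //.
      by apply: (psi_norm k d0 hchi); apply: primary_neq0; case/plistP: wm.
    apply: Ho; rewrite ?divn_gt0 ?leq_div // => y yX.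
    exact: typeI_partial.
  rewrite big_const_seq count_predT iter_addr_0 -[_ *+ _]mulr_natl.
  apply: (@le_trans _ _ (D%:R * (D%:R * (2 * D%:R * (180 * D%:R * X%:R / (m%:R * T%:R)))))).
    apply: ler_wpM2r; first by rewrite !mulr_ge0 // invr_ge0 mulr_ge0.
    by rewrite ler_nat plist_le.
  rewrite le_eqVlt; apply/orP; left; apply/eqP.
  by field; rewrite !gt_eqF.
rewrite -mulr_sumr.
have h : \sum_(1 <= m < X.+1) (m%:R : R)^-1 <= D%:R.
  rewrite /index_iota subn1; apply: le_trans (harmonic_ln _ X0) _.
  by have := Hln; have := lnX0; lra.
apply: (@le_trans _ _ (360 * D%:R ^+ 4 * X%:R / T%:R * D%:R)).
  by apply: ler_wpM2l => //; rewrite !mulr_ge0 // ?exprn_ge0 // invr_ge0.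
by rewrite le_eqVlt; apply/orP; left; apply/eqP; ring.
Qed.

(** On [2 ^ i <= m < 2 ^ i.+1] the cut-off [n <= X %/ m] still depends on [m]. It is kept inside the
    bilinear sum, where the labels of [typeII_bound] handle it. *)
Lemma typeII_block (A B : nat -> R) (i : nat) :
  (forall m, (0 < m)%N -> (m <= X)%N -> `|A m| <= D%:R) ->
  (forall m, (0 < m)%N -> (m <= X)%N -> `|B m| <= D%:R) ->
  (U < 2 ^ i.+1)%N -> (2 ^ i <= L)%N ->
  nc (\sum_(1 <= m < X.+1 | trunc_log 2 m == i) \sum_(1 <= n < (X %/ m).+1)
     (A m * B n)%:C * f (m * n)) <= 26 * D%:R ^+ 3 * X%:R / T%:R.
Proof.
move=> HA HB iU iL; have [Hc0 [kap [kap0 kap3 Hc1 Hc2]]] := HII iU iL.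
have e2 (j : nat) : (2 ^ j.+1 = 2 * 2 ^ j)%N by rewrite expnS.
set M := (2 ^ i.+1)%N in Hc1 Hc2; set N := (X %/ 2 ^ i)%N in Hc0 Hc2.
have M0 : (0 < M)%N by rewrite expn_gt0.
have MX : (M <= X)%N by apply: leq_trans LX; rewrite /M e2 leq_mul2l iL orbT.
have D0 : (0 < D)%N by apply: leq_trans D10.
have N0 : (0 < N)%N by apply: leq_trans Hc0; rewrite muln_gt0 !expn_gt0 T0 D0.
have NX : (N <= X)%N by exact: leq_div.
have [h [h0 Nh hN]] := sqrt_up N0.
have Dp : 0 < D%:R :> R by rewrite ltr0n.
(* Division by [D] normalizes the coefficients to modulus at most 1. *)
pose beta (z : gaussInt) : R[i] :=
  if (gsqn z <= X)%N then (B (gsqn z) / D%:R)%:C * psi chi k z else 0.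
have beta1 z : z != 0 -> nc (beta z) <= 1.
  move=> z0; rewrite /beta; case: ifP => [zX|_]; last by rewrite ComplexField.Normc.normc0.
  rewrite normcM -[leRHS]mul1r; apply: ler_pM; rewrite ?normc_ge0 ?(psi_norm k d0 hchi) //.
  rewrite normcR normrM normfV [`|D%:R|]ger0_norm // ler_pdivrMr // mul1r.
  by apply: HB; rewrite ?gsqn_gt0.
pose E m := \sum_(w <- plist (c * m)) nc (\sum_(z <- gbox h | primaryb z && (gsqn z <= N)%N &&
   (gsqn z * gsqn w <= c * X)%N) beta z * jacobi_kubota R (w * z)).
have E0 m : 0 <= E m by apply: sumr_ge0 => w _; exact: normc_ge0.
have bound : \sum_(m <- iota 1 M) E m <= 13 * D%:R * M%:R * N%:R / T%:R.
  apply: (@typeII_bound R c M N h T D kap X beta c0 M0 T0 h0 D10 kap0 kap3 Nh hN beta1) => //.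
  - move=> z z0 zN; apply: leq_trans (Hdiv z0 _); first by rewrite leq_pmull.
    apply: leq_trans zN _; apply: leq_trans (leq_pmull _ _) => //.
    by apply: leq_expr2w; apply: leq_trans NX _; rewrite leq_pmull.
  - by move=> m m0 mM; apply: plist_le => //; exact: leq_trans MX.
  - move=> s s0 sM; apply: (@leq_trans (2 * size (divisors (s * s)))); first by rewrite leq_pmull.
    apply: divisors_le; first by rewrite muln_gt0 s0.
    rewrite mulnn -expnM; apply: pow_bound => //.
    by apply: leq_trans sM _; apply: leq_trans MX _; rewrite leq_pmull.
have inner m : (0 < m)%N -> (m <= X)%N -> trunc_log 2 m == i ->
   nc (\sum_(1 <= n < (X %/ m).+1) (A m * B n)%:C * f (m * n)) <= D%:R ^+ 2 * E m.
  move=> m0 mX /eqP Ei.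
  have im : (2 ^ i <= m)%N by rewrite -Ei trunc_logP.
  have XmN : (X %/ m <= N)%N by rewrite leq_div2l // expn_gt0.
  have -> : \sum_(1 <= n < (X %/ m).+1) (A m * B n)%:C * f (m * n) =
    \sum_(w <- plist (c * m)) ((A m * D%:R)%:C * psi chi k w) *
     \sum_(z <- gbox h | primaryb z && (gsqn z <= N)%N &&
        (gsqn z * gsqn w <= c * X)%N) beta z * jacobi_kubota R (w * z).
    transitivity (\sum_(w <- plist (c * m)) ((A m)%:C * psi chi k w) *
       \sum_(1 <= n < (X %/ m).+1) \sum_(z <- plist n) (B n)%:C * psi chi k z * jacobi_kubota R (w * z)).
      under [RHS]eq_bigr do rewrite mulr_sumr.
      rewrite exchange_big; apply: eq_big_nat => n /andP [n0 _] /=.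
      rewrite /f mulnA (@lambda_mul R chi k d d0 (c * m) n) ?muln_gt0 ?c0 // mulr_sumr.
      apply: eq_bigr => w _; rewrite !mulr_sumr; apply: eq_bigr => z _.
      by rewrite (psiM k hchi) rmorphM; ring.
    rewrite big_seq [RHS]big_seq; apply: eq_bigr => w /plistP [_ Nw].
    rewrite (plist_sum (A := h) (fun n z => (B n)%:C * psi chi k z * jacobi_kubota R (w * z)) (leq_trans XmN Nh)).
    move: (psi chi k w) => p.
    have -> (x : R[i]) : (A m * D%:R)%:C * p * x = (A m)%:C * p * ((D%:R : R)%:C * x).
      by rewrite rmorphM; ring.
    congr (_ * _).
    rewrite mulr_sumr big_mkcond [RHS]big_mkcond; apply: eq_bigr => z _.
    (* For [m >= 2 ^ i] the hyperbola condition already forces [gsqn z <= N]. *)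
    have -> : primaryb z && (gsqn z <= N)%N && (gsqn z * gsqn w <= c * X)%N =
       primaryb z && (gsqn z <= X %/ m)%N.
      rewrite -andbA; congr (_ && _); rewrite Nw leq_divRL //.
      have -> : (gsqn z * (c * m) <= c * X)%N = (gsqn z * m <= X)%N.
        by rewrite mulnCA leq_pmul2l.
      case: (leqP (gsqn z * m) X) => le; last by rewrite andbF.
      by rewrite andbT; apply: leq_trans XmN; rewrite leq_divRL.
    case: ifP => // /andP [_ zX].
    rewrite /beta (leq_trans zX (leq_div _ _)) rmorphM fmorphV /=.
    have nD : (D%:R : R)%:C != 0 by rewrite eq_complex /= eqxx andbT gt_eqF.
    move: ((D%:R : R)%:C) nD ((B (gsqn z))%:C) (psi chi k z) (jacobi_kubota R (w * z)) => x nx b q j.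
    by field.
  apply: le_trans (normc_sum _ _ _) _; rewrite mulr_sumr big_seq [leRHS]big_seq; apply: ler_sum => w wm.
  rewrite normcM; apply: ler_wpM2r; first exact: normc_ge0.
  rewrite normcM normcR -[leRHS]mulr1; apply: ler_pM; rewrite ?normc_ge0 //.
    by rewrite normrM [`|D%:R|]ger0_norm // expr2; apply: ler_wpM2r => //; exact: HA.
  by apply: (psi_norm k d0 hchi); apply: primary_neq0; case/plistP: wm.
apply: le_trans (normc_sum _ _ _) _.
apply: (@le_trans _ _ (\sum_(m <- iota 1 M) D%:R ^+ 2 * E m)).
  apply: (@le_trans _ _ (\sum_(m <- [seq m <- index_iota 1 X.+1 | trunc_log 2 m == i]) D%:R ^+ 2 * E m)).
    rewrite big_filter big_seq_cond [leRHS]big_seq_cond; apply: ler_sum => m /andP [].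
    by rewrite mem_index_iota ltnS => /andP [m0 mX] mi; exact: inner.
  apply: ler_sum_subset; first by rewrite filter_uniq ?iota_uniq.
    move=> m; rewrite mem_filter mem_index_iota mem_iota => /andP [/eqP mi /andP [m0 _]].
    by rewrite m0 add1n ltnS /M -mi ltnW // trunc_log_ltn.
  by move=> m; rewrite mulr_ge0 // exprn_ge0.
rewrite -mulr_sumr; apply: (@le_trans _ _ (D%:R ^+ 2 * (13 * D%:R * M%:R * N%:R / T%:R))).
  by apply: ler_wpM2l => //; rewrite exprn_ge0.
have MN : M%:R * N%:R <= 2 * X%:R :> R.
  by rewrite -!natrM ler_nat /M e2 -mulnA leq_mul2l /= mulnC leq_divM.
have -> : D%:R ^+ 2 * (13 * D%:R * M%:R * N%:R / T%:R) = 13 * D%:R ^+ 3 / T%:R * (M%:R * N%:R) :> R by ring.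
have -> : 26 * D%:R ^+ 3 * X%:R / T%:R = 13 * D%:R ^+ 3 / T%:R * (2 * X%:R) :> R by ring.
by apply: ler_wpM2l => //; rewrite divr_ge0 // mulr_ge0 // exprn_ge0.
Qed.

Lemma typeII_total (A B : nat -> R) :
  (forall m, (0 < m)%N -> (m <= X)%N -> `|A m| <= D%:R) ->
  (forall m, (0 < m)%N -> (m <= X)%N -> `|B m| <= D%:R) ->
  (forall m, (m <= U)%N -> A m = 0) -> (forall m, (L < m)%N -> A m = 0) ->
  nc (\sum_(1 <= m < X.+1) \sum_(1 <= n < (X %/ m).+1)
     (A m * B n)%:C * f (m * n)) <= 26 * D%:R ^+ 4 * X%:R / T%:R.
Proof.
move=> HA HB AU AL.
set F := fun m => \sum_(1 <= n < (X %/ m).+1) (A m * B n)%:C * f (m * n).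
have F0 m : A m = 0 -> F m = 0.
  by move=> Am; apply: big1 => n _; rewrite Am mul0r mul0r.
have -> : \sum_(1 <= m < X.+1) F m = \sum_(i <- iota 0 D) \sum_(1 <= m < X.+1 | trunc_log 2 m == i) F m.
  under [RHS]eq_bigr do rewrite big_mkcond.
  rewrite exchange_big; apply: eq_big_nat => m /andP [m0 mX] /=.
  rewrite (bigD1_seq (trunc_log 2 m)) ?iota_uniq //=; last first.
    by rewrite mem_iota /= add0n; apply: leq_ltn_trans Hlog; exact: leq_trunc_log.
  rewrite eqxx big1 ?addr0 // => i; rewrite eq_sym => /negPf ->; by [].
apply: le_trans (normc_sum _ _ _) _.
apply: (@le_trans _ _ (\sum_(i <- iota 0 D) 26 * D%:R ^+ 3 * X%:R / T%:R)); last first.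
  rewrite big_const_seq count_predT iter_addr_0 size_iota -[_ *+ D]mulr_natl.
  by rewrite le_eqVlt; apply/orP; left; apply/eqP; ring.
apply: ler_sum => i _.
have [iU|iU] := leqP (2 ^ i.+1) U; last have [iL|iL] := leqP (2 ^ i) L.
- rewrite big_nat_cond big1 ?ComplexField.Normc.normc0 ?divr_ge0 ?mulr_ge0 ?exprn_ge0 // => m.
  move=> /andP [/andP [m0 _] /eqP mi]; apply: F0; apply: AU; apply: leq_trans iU.
  by rewrite -mi ltnW // trunc_log_ltn.
- exact: typeII_block.
rewrite big_nat_cond big1 ?ComplexField.Normc.normc0 ?divr_ge0 ?mulr_ge0 ?exprn_ge0 // => m.
move=> /andP [/andP [m0 _] /eqP mi]; apply: F0; apply: AL; apply: leq_trans iL _.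
by rewrite -mi trunc_logP.
Qed.

(** In Vaughan's identity the initial segment is trivial and the logarithmic term is of type I. The
    term with [vaughan_a] extends to [U * U], so it is of type I up to [U] and of type II between
    [U] and [L]; the last term is of type II throughout. *)
Lemma prime_sum_bound :
  nc (\sum_(1 <= n < X.+1) (von_mangoldt R n)%:C * f n) <=
  U%:R * D%:R ^+ 2 + 800 * D%:R ^+ 5 * X%:R / T%:R.
Proof.
have D1 : 1 <= D%:R :> R by apply: le_trans Dr; rewrite ler1n.
have Lam n : (0 < n)%N -> (n <= X)%N -> `|von_mangoldt R n| <= D%:R.
  move=> n0 nX; rewrite ger0_norm ?von_mangoldt_ge0 //.
  by apply: le_trans (von_mangoldt_le R n0) _; exact: ln_small.
have vb m : (0 < m)%N -> (m <= X)%N -> `|vaughan_b R U m| <= D%:R.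
  by move=> m0 mX; apply: le_trans (vaughan_b_le _ _ _) _; rewrite ler_nat divisors_small.
have va m : (0 < m)%N -> (m <= X)%N -> `|vaughan_a R U m| <= D%:R.
  by move=> m0 mX; apply: le_trans (vaughan_a_le _ _ m0) _; exact: ln_small.
have if0 (b : bool) (x : R) : `|x| <= D%:R -> `|if b then x else 0| <= D%:R.
  by case: b => //; rewrite normr0.
have UL' : (U <= L)%N by apply: leq_trans UL; rewrite leq_pmull.
rewrite (vaughan_identity U).
set S1 := \sum_(1 <= n < X.+1) (if _ then _ else _)%:C * _.
set S2 := \sum_(1 <= m < X.+1) _; set S3 := \sum_(1 <= m < X.+1) _.
set S4 := \sum_(1 <= m < X.+1) _.
have b1 : nc S1 <= U%:R * D%:R ^+ 2.
  apply: le_trans (normc_sum _ _ _) _.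
  apply: (@le_trans _ _ (\sum_(1 <= n < X.+1 | (n <= U)%N) D%:R ^+ 2)).
    rewrite [leRHS]big_mkcond; apply: ler_sum_nat => n /andP [n0 nX].
    case: ifP => nU; last by rewrite mul0r ComplexField.Normc.normc0.
    rewrite normcM normcR expr2; apply: ler_pM; rewrite ?normc_ge0 ?Lam //.
    apply: le_trans (lambda_norm _) _.
    by rewrite ler_nat plist_le.
  rewrite big_const_seq iter_addr_0 -[leLHS]mulr_natl; apply: ler_wpM2r; first exact: exprn_ge0.
  rewrite ler_nat -size_filter -[leqRHS](size_iota 1 U); apply: uniq_leq_size.
    by rewrite filter_uniq ?iota_uniq.
  by move=> n; rewrite mem_filter mem_index_iota mem_iota add1n !ltnS => /andP [-> /andP [-> _]].
have b2 : nc S2 <= 360 * D%:R ^+ 5 * X%:R / T%:R.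
  have -> : S2 = \sum_(1 <= m < X.+1) \sum_(1 <= n < (X %/ m).+1)
        (if (m <= U)%N then moebius R m * ln n%:R else 0)%:C * f (m * n) by [].
  apply: typeI_total => [m _ _|Y g B Y0 YX HB].
    by apply: le_trans (moebius_norm _ _) _.
  have B0 : 0 <= B by apply: le_trans (HB 0%N isT); rewrite normc_ge0.
  apply: le_trans (abel_ln HB) _.
  rewrite -mulrA [B * _]mulrC mulrA; apply: ler_wpM2r => //; apply: ler_wpM2l => //.
  exact: ln_small.
have b3 : nc S3 <= 360 * D%:R ^+ 5 * X%:R / T%:R + 26 * D%:R ^+ 4 * X%:R / T%:R.
  have -> : S3 = \sum_(1 <= m < X.+1) \sum_(1 <= n < (X %/ m).+1)
        (if (m <= U)%N then vaughan_a R U m * 1 else 0)%:C * f (m * n) +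
      \sum_(1 <= m < X.+1) \sum_(1 <= n < (X %/ m).+1)
        ((if (m <= U)%N then 0 else vaughan_a R U m) * 1)%:C * f (m * n).
    rewrite -big_split; apply: eq_bigr => m _; rewrite -big_split; apply: eq_bigr => n _ /=.
    by case: ifP => _; rewrite !mulr1 ?mul0r ?addr0 ?add0r.
  apply: le_trans (normcD _ _) _; apply: lerD.
    apply: (typeI_total (omega := fun=> 1)) => // Y g B Y0 YX HB.
    have B0 : 0 <= B by apply: le_trans (HB 0%N isT); rewrite normc_ge0.
    under eq_bigr do rewrite mul1r.
    apply: le_trans (HB Y (leqnn Y)) _; rewrite -[leLHS]mul1r; apply: ler_wpM2r => //.
    by move: D1; lra.
  apply: (typeII_total (A := fun m => if (m <= U)%N then 0 else vaughan_a R U m) (B := fun=> 1)).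
  - by move=> m m0 mX; case: ifP => _; rewrite ?normr0 ?va.
  - by move=> m _ _; rewrite normr1.
  - by move=> m ->.
  - move=> m mL; case: ifP => // _; apply: vaughan_a_eq0; last exact: leq_ltn_trans UL mL.
    exact: leq_ltn_trans mL.
(* Beyond [L] the variables [m] and [n] exchange their roles. *)
have b4 : nc S4 <= 26 * D%:R ^+ 4 * X%:R / T%:R + 26 * D%:R ^+ 4 * X%:R / T%:R.
  have -> : S4 = \sum_(1 <= m < X.+1) \sum_(1 <= n < (X %/ m).+1)
        ((if (U < m)%N && (m <= L)%N then vaughan_b R U m else 0) *
         (if (U < n)%N then von_mangoldt R n else 0))%:C * f (m * n) +
      \sum_(1 <= n < X.+1) \sum_(1 <= m < (X %/ n).+1)
        ((if (U < n)%N && (n <= L)%N then von_mangoldt R n else 0) *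
         (if (L < m)%N then vaughan_b R U m else 0))%:C * f (n * m).
    rewrite -[X in _ = _ + X](swap_hyperbola X (fun m n =>
        ((if (U < n)%N && (n <= L)%N then von_mangoldt R n else 0) *
         (if (L < m)%N then vaughan_b R U m else 0))%:C * f (n * m))).
    rewrite -big_split; apply: eq_big_nat => m /andP [m0 mX].
    rewrite -big_split; apply: eq_big_nat => n /andP [n0] /=.
    rewrite ltnS leq_divRL // => nm; rewrite [(n * m)%N]mulnC.
    have [nU|nU] := leqP n U; first by rewrite !mulr0 !mul0r addr0.
    have [mU|mU] := leqP m U.
      by rewrite ltnNge (leq_trans mU UL') /= !mul0r mulr0 mul0r addr0.
    have [mL|mL] := leqP m L; first by rewrite /= mulr0 mul0r addr0.
    have nL : (n <= L)%N.
      rewrite leqNgt; apply/negP => nL; have := leq_trans (leq_mul nL mL) nm.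
      by move/leq_trans => /(_ _ XL); rewrite leqNgt ltn_mul.
    rewrite nL /= mul0r mul0r add0r [von_mangoldt R n * _]mulrC; by [].
  apply: le_trans (normcD _ _) _; apply: lerD.
    apply: (typeII_total (A := fun m => if (U < m)%N && (m <= L)%N then vaughan_b R U m else 0)
      (B := fun n => if (U < n)%N then von_mangoldt R n else 0)).
    - by move=> m m0 mX; apply: if0; exact: vb.
    - by move=> m m0 mX; apply: if0; exact: Lam.
    - by move=> m mU; rewrite ltnNge mU.
    - by move=> m mL; rewrite [(m <= L)%N]leqNgt mL andbF.
  apply: (typeII_total (A := fun m => if (U < m)%N && (m <= L)%N then von_mangoldt R m else 0)
      (B := fun n => if (L < n)%N then vaughan_b R U n else 0)).
  - by move=> m m0 mX; apply: if0; exact: Lam.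
  - by move=> m m0 mX; apply: if0; exact: vb.
  - by move=> m mU; rewrite ltnNge mU.
  - by move=> m mL; rewrite [(m <= L)%N]leqNgt mL andbF.
have r0 : 0 <= X%:R / T%:R :> R by rewrite divr_ge0.
apply: le_trans (normcD _ _) _; apply: le_trans (lerD (normcB _ _) b4) _.
apply: le_trans (lerD (lerD (normcD _ _) b3) (lexx _)) _.
apply: le_trans (lerD (lerD (lerD b1 b2) (lexx _)) (lexx _)) _.
rewrite -!addrA lerD2l -subr_ge0.
have -> : 800 * D%:R ^+ 5 * X%:R / T%:R - (360 * D%:R ^+ 5 * X%:R / T%:R +
   (360 * D%:R ^+ 5 * X%:R / T%:R + (26 * D%:R ^+ 4 * X%:R / T%:R +
   (26 * D%:R ^+ 4 * X%:R / T%:R + 26 * D%:R ^+ 4 * X%:R / T%:R)))) =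
   (80 * D%:R - 78) * (D%:R ^+ 4 * (X%:R / T%:R)) :> R by ring.
by apply: mulr_ge0; [lra|rewrite mulr_ge0 // exprn_ge0].
Qed.

End Assembly.

(** * Choice of the parameters *)

(* The cut-offs are [U = t ^ (9 * n0)], [L = t ^ (39 * n0)], [T = t ^ (n0 + 20)]
   and [D = t ^ 2]. *)
Section Ranges.
Variables (n0 t X c d K : nat).
Hypothesis n0_ge : (500 <= n0)%N.
Hypothesis t2 : (2 ^ (77 * n0) <= t)%N.
Hypothesis tX : (t ^ (77 * n0) <= X)%N.
Hypothesis Xt : (X <= (2 * t) ^ (77 * n0))%N.
Hypothesis F_small : (c * d * K <= t ^ (n0 + 5))%N.
Hypothesis d0 : (0 < d)%N.
Hypothesis K0 : (0 < K)%N.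

Let two_t : (2 <= t)%N.
Proof.
apply: leq_trans t2; rewrite -[X in (X <= _)%N](expn1 2) leq_pexp2l //.
by clear -n0_ge; lia.
Qed.

Let t0 : (0 < t)%N. Proof. exact: ltnW. Qed.

Let pw e f : (e <= f)%N -> (t ^ e <= t ^ f)%N.
Proof. by move=> h; rewrite leq_pexp2l. Qed.

Let c_le : (c <= t ^ (n0 + 5))%N.
Proof. by apply: leq_trans F_small; rewrite -mulnA leq_pmulr // muln_gt0 d0. Qed.

(** The lower bound on [t] turns the constant [2 ^ (77 * n0)] into a single further factor [t]. *)
Let X_le : (X <= t ^ (77 * n0 + 1))%N.
Proof. by apply: leq_trans Xt _; rewrite expnMn expnD expn1 mulnC leq_mul2l t2 orbT. Qed.

Lemma size_bound : (256 * (c * X) ^ 6 <= t ^ (1000 * n0))%N.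
Proof.
have h : (c * X <= t ^ (78 * n0 + 6))%N.
  apply: leq_trans (leq_mul c_le X_le) _; rewrite -expnD; apply: pw; clear; lia.
apply: (@leq_trans (t ^ 8 * (t ^ (78 * n0 + 6)) ^ 6)).
  apply: leq_mul; last exact: leq_expr2w.
  by rewrite (_ : 256 = 2 ^ 8)%N //; exact: leq_expr2w.
by rewrite -expnM -expnD; apply: pw; clear -n0_ge; lia.
Qed.

(** In units of [n0], [A] has exponent at least [(77 - 9) / 2 = 34], while [2 * (1 + 9) + 12 = 32]
    is needed; the gap absorbs the additive constants. *)
Lemma typeI_range A m : (0 < m)%N -> (m <= t ^ (9 * n0))%N -> (X %/ m <= A ^ 2)%N ->
  ((8 * d * (c * m)) ^ 2 * K ^ 2 * (t ^ (n0 + 20)) ^ 12 * (t ^ 2) ^ 11 <= A)%N.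
Proof.
move=> m0 mU XA.
have A_ge : (t ^ (34 * n0) <= A)%N.
  rewrite -leq_sqr -expnM; apply: leq_trans XA; rewrite leq_divRL //.
  apply: leq_trans tX; apply: leq_trans (leq_mul (leqnn _) mU) _.
  by rewrite -expnD; apply: pw; clear; lia.
apply: leq_trans A_ge.
have -> : ((8 * d * (c * m)) ^ 2 * K ^ 2 * (t ^ (n0 + 20)) ^ 12 * (t ^ 2) ^ 11 =
  (2 ^ 3 * (c * d * K) * m) ^ 2 * (t ^ (n0 + 20)) ^ 12 * (t ^ 2) ^ 11)%N by ring.
have h : (2 ^ 3 * (c * d * K) * m <= t ^ (10 * n0 + 8))%N.
  apply: (@leq_trans (t ^ 3 * t ^ (n0 + 5) * t ^ (9 * n0))).
    by rewrite !leq_mul // leq_expr2w.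
  by rewrite -!expnD; apply: pw; clear; lia.
apply: (@leq_trans ((t ^ (10 * n0 + 8)) ^ 2 * (t ^ (n0 + 20)) ^ 12 * (t ^ 2) ^ 11)).
  by rewrite 2!leq_mul2r leq_expr2w // !orbT.
by rewrite -!expnM -!expnD; apply: pw; clear -n0_ge; lia.
Qed.

(** In units of [n0]: up to exponent 20, [kap = 1] needs [8 <= 9] and [8 + 3 * 20 + 2 <= 77]; beyond
    it, [kap = 3] needs [16 <= 20] and [16 + 2 * 39 + 2 <= 3 * 38]. The tightest is [8 <= 9], where
    the constants [8 * 20 + 160] must fit into [n0]. *)
Lemma typeII_range i : (t ^ (9 * n0) < 2 ^ i.+1)%N -> (2 ^ i <= t ^ (39 * n0))%N ->
  [/\ ((t ^ (n0 + 20)) ^ 2 * (t ^ 2) ^ 3 <= X %/ 2 ^ i)%N &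
   exists kap, [/\ (0 < kap)%N, (kap <= 3)%N,
   ((t ^ (n0 + 20)) ^ (4 * kap + 4) * (t ^ 2) ^ 40 <= 2 ^ i.+1)%N &
   ((t ^ (n0 + 20)) ^ (4 * kap + 4) * (t ^ 2) ^ 40 * (2 ^ i.+1) ^ 2 * c ^ 2 <= (X %/ 2 ^ i) ^ kap)%N]].
Proof.
rewrite expnS; set P := (2 ^ i)%N => iU iL.
have P0 : (0 < P)%N by rewrite expn_gt0.
have c2 : (c ^ 2 <= t ^ (2 * n0 + 10))%N.
  by apply: leq_trans (leq_expr2w 2 c_le) _; rewrite -expnM; apply: pw; clear; lia.
split.
  rewrite leq_divRL //; apply: leq_trans tX; apply: leq_trans (leq_mul (leqnn _) iL) _.
  by rewrite -!expnM -!expnD; apply: pw; clear -n0_ge; lia.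
have [P20|P20] := leqP P (t ^ (20 * n0)).
  exists 1%N; split=> //.
    apply: leq_trans (ltnW iU); rewrite -!expnM -!expnD; apply: pw; clear -n0_ge; lia.
  rewrite expn1 leq_divRL //; apply: leq_trans tX.
  have -> : ((t ^ (n0 + 20)) ^ (4 * 1 + 4) * (t ^ 2) ^ 40 * (2 * P) ^ 2 * c ^ 2 * P =
     (t ^ (n0 + 20)) ^ 8 * (t ^ 2) ^ 40 * 2 ^ 2 * P ^ 3 * c ^ 2)%N by ring.
  apply: (@leq_trans ((t ^ (n0 + 20)) ^ 8 * (t ^ 2) ^ 40 * t ^ 2 * (t ^ (20 * n0)) ^ 3 * t ^ (2 * n0 + 10))).
    apply: leq_mul c2; apply: leq_mul; last exact: leq_expr2w.
    by apply: leq_mul => //; exact: leq_expr2w.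
  by rewrite -!expnM -!expnD; apply: pw; clear -n0_ge; lia.
exists 3%N; split=> //.
  apply: (@leq_trans P); last by rewrite leq_pmull.
  apply: leq_trans (ltnW P20); rewrite -!expnM -!expnD; apply: pw; clear -n0_ge; lia.
have XP : (t ^ (38 * n0) <= X %/ P)%N.
  rewrite leq_divRL //; apply: leq_trans tX; apply: leq_trans (leq_mul (leqnn _) iL) _.
  by rewrite -!expnD; apply: pw; clear; lia.
apply: leq_trans (leq_expr2w 3 XP).
rewrite [((2 * P) ^ 2)%N]expnMn mulnA.
apply: (@leq_trans ((t ^ (n0 + 20)) ^ (4 * 3 + 4) * (t ^ 2) ^ 40 * t ^ 2 * (t ^ (39 * n0)) ^ 2 * t ^ (2 * n0 + 10))).
  apply: leq_mul c2; apply: leq_mul; last exact: leq_expr2w.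
  by apply: leq_mul => //; exact: leq_expr2w.
by rewrite -!expnM -!expnD; apply: pw; clear -n0_ge; lia.
Qed.

Lemma two_sqrt_range : (2 * t ^ (39 * n0) <= X)%N.
Proof.
apply: leq_trans tX; apply: (@leq_trans (t * t ^ (39 * n0))); first by rewrite leq_mul2r two_t orbT.
by rewrite -expnS; apply: pw; clear -n0_ge; lia.
Qed.

(** 39 is the least integer above 77/2; of two factors with product at most [X], one is then at most
    [L]. *)
Lemma sqrt_range : (X <= t ^ (39 * n0) * t ^ (39 * n0))%N.
Proof. by apply: leq_trans X_le _; rewrite -expnD; apply: pw; clear -n0_ge; lia. Qed.

End Ranges.

Section Final.
Variable R : realType.
Local Notation nc := (@ComplexField.Normc.normc R).

Lemma ln_pow2_le (X e : nat) : (0 < X)%N -> (X <= 2 ^ e)%N -> ln (X%:R : R) <= e%:R.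
Proof.
move=> X0 Xe; apply: (@le_trans _ _ (ln ((2 : R) ^+ e))).
  by rewrite ler_ln ?posrE ?ltr0n ?exprn_gt0 // -natrX ler_nat.
have ln2 : ln (2 : R) <= 1 by have := @le_ln1Dx R 1; rewrite -[1 + 1]/2; apply; lra.
by rewrite lnXn // -[leLHS]mulr_natr -[leRHS]mul1r; apply: ler_wpM2r.
Qed.

Lemma pow_le_pow2 (X t N : nat) : (X <= (2 * t) ^ N)%N -> (X <= 2 ^ (2 * N * t))%N.
Proof.
move=> h; apply: leq_trans h _; rewrite mulnAC expnM; apply: leq_expr2w.
by apply: ltnW; exact: ltn_expl.
Qed.

Variables (chi : gaussInt -> R[i]) (k : int) (d c X : nat).
Hypothesis d0 : (1 <= d)%N.
Hypothesis hchi : gauss_character (4 * d)%:R chi.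
Hypothesis c0 : (0 < c)%N.
Hypothesis X0 : (0 < X)%N.

Let S := \sum_(1 <= n < X.+1) (von_mangoldt R n)%:C * lambda chi k (c * n).

Lemma trivial_bound (G : nat) :
  (forall n, (0 < n)%N -> (n <= X)%N -> (gdivcount ((c * n)%:R : gaussInt) <= G)%N) ->
  nc S <= X%:R * (ln X%:R * G%:R).
Proof.
move=> HG; apply: le_trans (normc_sum _ _ _) _.
apply: (@le_trans _ _ (\sum_(1 <= n < X.+1) ln X%:R * G%:R)).
  apply: ler_sum_nat => n /andP [n0]; rewrite ltnS => nX.
  have cn0 : (0 < c * n)%N by rewrite muln_gt0 c0.
  rewrite normcM normcR ger0_norm ?von_mangoldt_ge0 //; apply: ler_pM; rewrite ?von_mangoldt_ge0 ?normc_ge0 //.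
    apply: le_trans (von_mangoldt_le R n0) _; by rewrite ler_ln ?posrE ?ltr0n // ler_nat.
  apply: le_trans (lambda_norm k d0 hchi _) _; rewrite ler_nat.
  by apply: leq_trans (size_plist_le cn0) _; exact: HG.
by rewrite big_const_seq count_predT iter_addr_0 size_iota subn1 -[leLHS]mulr_natl.
Qed.

Variables (n0 t : nat).
Hypothesis n0_ge : (500 <= n0)%N.
Hypothesis t1 : (0 < t)%N.
Hypothesis tX : (t ^ (77 * n0) <= X)%N.
Hypothesis Xt : (X <= (2 * t) ^ (77 * n0))%N.

Let F := (c * d * (`|k| + 1))%N.

Let K0 : (0 < `|k| + 1)%N. Proof. by rewrite addn1. Qed.

Let cF : (c <= F)%N.
Proof. by rewrite /F -mulnA leq_pmulr // muln_gt0 d0. Qed.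

Let lnX : ln (X%:R : R) <= (154 * n0 * t)%:R.
Proof. by apply: ln_pow2_le => //; rewrite (_ : 154 * n0 = 2 * (77 * n0))%N ?pow_le_pow2 // mulnA. Qed.

(** The factor [D ^ 5 / T] is [t ^ 10 / t ^ (n0 + 20)], more than enough to lower [t ^ (77 * n0)] to
    [t ^ (76 * n0)]; [700 * n0 <= t] puts [ln X] and the number of dyadic blocks below [t ^ 2]. *)
Lemma small_parameters_bound : (2 ^ (77 * n0) <= t)%N -> (700 * n0 <= t)%N ->
  (F <= t ^ (n0 + 5))%N ->
  (forall z : gaussInt, z != 0 -> (gsqn z <= t ^ (1000 * n0))%N -> (2 * gdivcount z <= t ^ 2)%N) ->
  nc S <= 801 * (2 ^ (77 * n0))%:R * t%:R ^+ (76 * n0).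
Proof.
move=> tb1 tb2 Fs Hdiv.
have tn0 : (0 < n0 * t)%N by rewrite muln_gt0 t1 andbT (leq_trans _ n0_ge).
have tt : (700 * (n0 * t) <= t ^ 2)%N by rewrite -mulnn mulnA leq_mul2r tb2 orbT.
have t10 : (10 <= t)%N by apply: leq_trans tb2; clear -n0_ge; lia.
have pw e f : (e <= f)%N -> (t ^ e <= t ^ f)%N by move=> h; rewrite leq_pexp2l.
have sb := size_bound n0_ge tb1 Xt Fs d0 K0.
have h := @prime_sum_bound R chi k d d0 hchi c X (t ^ (9 * n0)) (t ^ (39 * n0)) (t ^ (n0 + 20)) (t ^ 2) c0 X0.
have {h}b : nc S <= (t ^ (9 * n0))%:R * (t ^ 2)%:R ^+ 2 + 800 * (t ^ 2)%:R ^+ 5 * X%:R / (t ^ (n0 + 20))%:R.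
  apply: h.
  - by rewrite expn_gt0 t1.
  - by rewrite -mulnn; apply: (@leq_trans (10 * 10)); rewrite ?leq_mul.
  - by rewrite expn_gt0 t1.
  - by rewrite -expnD; apply: pw; clear; lia.
  - exact: sqrt_range.
  - exact: two_sqrt_range.
  - by move=> z z0 zN; apply: Hdiv => //; exact: leq_trans sb.
  - apply: (@le_trans _ _ (4 * (1 + (154 * n0 * t)%:R))); first by rewrite ler_pM2l // lerD2l.
    rewrite -[4]/(4%:R) -[1]/(1%:R) -natrD -natrM ler_nat; apply: leq_trans tt.
    by move: tn0; rewrite -!mulnA; move: (n0 * t)%N; lia.
  - have tl : (trunc_log 2 X <= 154 * n0 * t)%N.
      have := leq_trans (trunc_logP (leqnn 2) X0) (pow_le_pow2 Xt).
      by rewrite leq_exp2l // mulnA.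
    apply: leq_ltn_trans tl _; apply: leq_trans tt.
    by move: tn0; rewrite -!mulnA; move: (n0 * t)%N; lia.
  - by move=> A m; exact: (typeI_range n0_ge tb1 tX Fs).
  - by move=> i; exact: (typeII_range n0_ge tb1 tX Fs d0 K0).
apply: le_trans b _.
have tp : 0 < t%:R :> R by rewrite ltr0n.
set C := (2 ^ (77 * n0))%N.
have C1 : 1 <= C%:R :> R by rewrite ler1n expn_gt0.
have -> : 801 * C%:R * t%:R ^+ (76 * n0) = C%:R * t%:R ^+ (76 * n0) + 800 * (C%:R * t%:R ^+ (76 * n0)) :> R by ring.
apply: lerD.
  rewrite -natrX -natrM -natrX -natrM ler_nat -expnM -expnD.
  apply: (@leq_trans (t ^ (76 * n0))); first by apply: pw; clear -n0_ge; lia.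
  by rewrite leq_pmull // expn_gt0.
rewrite ler_pdivrMr; last by rewrite ltr0n expn_gt0 t1.
rewrite -[leLHS]mulrA -[leRHS]mulrA ler_pM2l // -[leRHS]mulrA.
rewrite -!natrX -!natrM ler_nat; apply: (@leq_trans ((t ^ 2) ^ 5 * (C * t ^ (77 * n0)))).
  by rewrite leq_mul2l -expnMn Xt orbT.
have -> : ((t ^ 2) ^ 5 * (C * t ^ (77 * n0)) = C * ((t ^ 2) ^ 5 * t ^ (77 * n0)))%N by ring.
rewrite leq_mul2l; apply/orP; right.
by rewrite -expnM -!expnD; apply: pw; clear; lia.
Qed.

Lemma large_parameters_bound (C : nat) : (0 < C)%N ->
  (forall z : gaussInt, z != 0 -> (gdivcount z ^ (40 * n0) <= C * gsqn z)%N) ->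
  (t ^ (n0 + 5) <= F)%N ->
  nc S <= (2 ^ (77 * n0) * (154 * n0) * (C * 2 ^ (154 * n0)))%:R * F%:R * t%:R ^+ (76 * n0).
Proof.
move=> C0 HC Fb.
set G := \max_(n < X.+1 | (0 < n)%N) gdivcount ((c * n)%:R : gaussInt).
have HG n : (0 < n)%N -> (n <= X)%N -> (gdivcount ((c * n)%:R : gaussInt) <= G)%N.
  move=> n1 nX; have nX' : (n < X.+1)%N by [].
  exact: (@leq_bigmax_cond _ _ (fun i : 'I_X.+1 => gdivcount ((c * i)%:R : gaussInt)) (Ordinal nX') n1).
(* Compare powers of order [40 * n0]: [F] exceeds [t ^ (n0 + 1)] by [t ^ 4], a gain of about
   [t ^ (160 * n0)], which pays for the [t ^ (154 * n0)] in [(c * X) ^ 2]; two of the factors [F]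
   are spent on [c ^ 2]. The additional [t] in [t ^ (n0 + 1)] is for the logarithm. *)
have Gb : (t ^ (n0 + 1) * G <= C * 2 ^ (154 * n0) * F)%N.
  have [n [n1 nX ->]] : exists n, [/\ (0 < n)%N, (n <= X)%N & G = gdivcount ((c * n)%:R : gaussInt)].
    have ne : (0 < #|[pred n : 'I_X.+1 | (0 < n)%N]|)%N.
      by apply/card_gt0P; exists (Ordinal (X0 : 1 < X.+1)%N).
    have [i i0 Ei] := eq_bigmax_cond (fun i : 'I_X.+1 => gdivcount ((c * i)%:R : gaussInt)) ne.
    by exists i; split => //; rewrite -ltnS.
  have j0 : (0 < 40 * n0)%N by rewrite muln_gt0 (leq_trans _ n0_ge).
  rewrite -(leq_exp2r _ _ j0) expnMn.
  have cn0 : ((c * n)%:R : gaussInt) != 0.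
    by rewrite -gsqn_gt0 gsqn_nat expn_gt0 muln_gt0 c0 n1.
  apply: (@leq_trans ((t ^ (n0 + 1)) ^ (40 * n0) * (C * (c * X) ^ 2))).
    rewrite leq_mul2l; apply/orP; right; apply: leq_trans (HC _ cn0) _.
    by rewrite gsqn_nat leq_mul2l leq_expr2w ?orbT // leq_mul2l nX orbT.
  rewrite [((c * X) ^ 2)%N]expnMn.
  apply: (@leq_trans (C * 2 ^ (154 * n0) * F ^ (40 * n0))); last first.
    rewrite [leqRHS]expnMn leq_mul2r; apply/orP; right.
    by rewrite -{1}[(C * _)%N]expn1 leq_pexp2l // muln_gt0 C0 expn_gt0.
  apply: (@leq_trans ((t ^ (n0 + 1)) ^ (40 * n0) * (C * (F ^ 2 * ((2 * t) ^ (77 * n0)) ^ 2)))).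
    rewrite leq_mul2l; apply/orP; right; rewrite leq_mul2l; apply/orP; right.
    by apply: leq_mul; exact: leq_expr2w.
  have E : (((2 * t) ^ (77 * n0)) ^ 2 = 2 ^ (154 * n0) * t ^ (154 * n0))%N.
    by rewrite -expnM expnMn (_ : 77 * n0 * 2 = 154 * n0)%N //; lia.
  rewrite E.
  have -> : ((t ^ (n0 + 1)) ^ (40 * n0) * (C * (F ^ 2 * (2 ^ (154 * n0) * t ^ (154 * n0)))) =
     C * 2 ^ (154 * n0) * (F ^ 2 * ((t ^ (n0 + 1)) ^ (40 * n0) * t ^ (154 * n0))))%N by ring.
  rewrite leq_mul2l; apply/orP; right.
  have -> : (40 * n0 = 2 + (40 * n0 - 2))%N by clear -n0_ge; lia.
  rewrite [leqRHS]expnD leq_mul2l; apply/orP; right.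
  apply: leq_trans (leq_expr2w _ Fb); rewrite -!expnM -expnD leq_pexp2l //.
  by clear -n0_ge; nia.
apply: le_trans (trivial_bound HG) _.
apply: (@le_trans _ _ (X%:R * ((154 * n0 * t)%:R * G%:R))).
  by apply: ler_wpM2l => //; apply: ler_wpM2r.
rewrite -!natrX -!natrM ler_nat.
apply: (@leq_trans ((2 * t) ^ (77 * n0) * (154 * n0 * t * G))); first by rewrite leq_mul2r Xt orbT.
rewrite expnMn.
have -> : (77 * n0 = 76 * n0 + n0)%N by lia.
rewrite [(t ^ (_ + _))%N]expnD.
have -> : (2 ^ (76 * n0 + n0) * (t ^ (76 * n0) * t ^ n0) * (154 * n0 * t * G) =
  2 ^ (76 * n0 + n0) * (154 * n0) * t ^ (76 * n0) * (t ^ n0 * t ^ 1 * G))%N by ring.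
rewrite -expnD.
apply: (@leq_trans (2 ^ (76 * n0 + n0) * (154 * n0) * t ^ (76 * n0) * (C * 2 ^ (154 * n0) * F))).
  by rewrite leq_mul2l Gb orbT.
by apply: eq_leq; ring.
Qed.

(** For bounded [X] only uniformity in [c] matters: the square of a divisor number is at most
    [C * (c * X) ^ 2], so the divisor number is linear in [c], hence in [F]. *)
Lemma bounded_range_bound (C B : nat) : (0 < C)%N ->
  (forall z : gaussInt, z != 0 -> (gdivcount z ^ (40 * n0) <= C * gsqn z)%N) ->
  (X <= B)%N ->
  nc S <= (B * (B * (C * B)))%:R * F%:R * t%:R ^+ (76 * n0).
Proof.
move=> C0 HC XB.
have HG n : (0 < n)%N -> (n <= X)%N -> (gdivcount ((c * n)%:R : gaussInt) <= C * c * B)%N.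
  move=> n1 nX; have cn0 : ((c * n)%:R : gaussInt) != 0.
    by rewrite -gsqn_gt0 gsqn_nat expn_gt0 muln_gt0 c0 n1.
  rewrite -leq_sqr; set g := gdivcount _.
  have [->|g0] := posnP g; first by [].
  apply: (@leq_trans (g ^ (40 * n0))); first by rewrite leq_pexp2l //; clear -n0_ge; lia.
  apply: leq_trans (HC _ cn0) _; rewrite gsqn_nat -mulnA [leqRHS]expnMn; apply: leq_mul.
    by rewrite -mulnn leq_pmull.
  by apply: leq_expr2w; rewrite leq_mul2l (leq_trans nX XB) orbT.
apply: le_trans (trivial_bound HG) _.
have lnB : ln (X%:R : R) <= B%:R.
  have : ln (1 + (X%:R - 1) : R) <= X%:R - 1.
    apply: le_ln1Dx; rewrite -subr_gt0 opprK addrNK ltr0n //.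
  rewrite addrC subrK => h; apply: le_trans h _; apply: (@le_trans _ _ X%:R); first lra.
  by rewrite ler_nat.
apply: (@le_trans _ _ (B%:R * (B%:R * (C * c * B)%:R))).
  apply: ler_pM; rewrite ?ler_nat // ?mulr_ge0 ?ln_ge0 ?ler1n //.
  by apply: ler_wpM2r.
rewrite -!natrX -!natrM ler_nat.
apply: (@leq_trans (B * (B * (C * B)) * F)); last by rewrite leq_pmulr // expn_gt0 t1.
have -> : (B * (B * (C * c * B)) = B * (B * (C * B)) * c)%N by ring.
by rewrite leq_mul2l cF orbT.
Qed.

End Final.

Lemma gdivcount_poly (e : nat) : (0 < e)%N -> exists2 C : nat, (0 < C)%N &
  forall z : gaussInt, z != 0 -> (gdivcount z ^ e <= C * gsqn z)%N.
Proof.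
move=> e0; have [C HC] := gdivcount_bound e; exists C.+1 => // z z0.
by apply: leq_trans (HC z z0) _; rewrite leq_mul2r leqnSn orbT.
Qed.

(** The divisor bound of order [e] gives at most [C * t] divisors; the second factor [t] absorbs
    [2 * C]. *)
Lemma gdivcount_le_sqr (e : nat) : (0 < e)%N -> exists t0 : nat, forall t, (t0 <= t)%N ->
  forall z : gaussInt, z != 0 -> (gsqn z <= t ^ e)%N -> (2 * gdivcount z <= t ^ 2)%N.
Proof.
move=> e0; have [C C0 HC] := @gdivcount_poly e e0; exists (2 * C)%N => t tC z z0 zt.
have g : (gdivcount z <= C * t)%N.
  rewrite -(leq_exp2r _ _ e0) expnMn; apply: leq_trans (HC z z0) _; apply: leq_mul => //.
  by rewrite -{1}(expn1 C) leq_pexp2l.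
apply: (@leq_trans (2 * (C * t))); first by rewrite leq_mul2l g.
by rewrite mulnA -mulnn leq_mul2r tC orbT.
Qed.

Lemma root_range (N X : nat) : (0 < N)%N -> (0 < X)%N ->
  exists t, [/\ (0 < t)%N, (t ^ N <= X)%N & (X <= (2 * t) ^ N)%N].
Proof.
move=> N0 X0.
have ex : exists t, (t ^ N <= X)%N by exists 1%N; rewrite exp1n.
have ub t : (t ^ N <= X)%N -> (t <= X)%N.
  move=> h; apply: leq_trans h; case: t => // t; by rewrite -{1}(expn1 t.+1) leq_pexp2l.
case: (ex_maxnP ex ub) => t tX tmax.
have t0 : (0 < t)%N by apply: tmax; rewrite exp1n.
exists t; split=> //.
have lt : (X < t.+1 ^ N)%N by rewrite ltnNge; apply/negP => /tmax; rewrite ltnn.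
by apply: leq_trans (ltnW lt) _; rewrite leq_exp2r // succ_double.
Qed.

Section Main.
Variable R : realType.
Local Notation nc := (@ComplexField.Normc.normc R).

Lemma powR_range (x : R) (t n0 : nat) : (0 < n0)%N ->
  (t ^ (77 * n0))%:R <= x -> t%:R ^+ (76 * n0) <= x `^ (76 / 77).
Proof.
move=> n00 tx.
have -> : t%:R ^+ (76 * n0) = ((t ^ (77 * n0))%:R : R) `^ (76 / 77).
  rewrite natrX -!powR_mulrn // -powRrM; congr (_ `^ _).
  by rewrite !natrM; field.
by apply: ge0_ler_powR; rewrite ?nnegrE ?divr_ge0 ?ler0n // (le_trans _ tx).
Qed.

Lemma prime_sum_uniform (n0 : nat) : (500 <= n0)%N ->
  exists2 K : R, 0 <= K & forall (d : nat) (k : int) (chi : gaussInt -> R[i]),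
    (1 <= d)%N -> gauss_character (4 * d)%:R chi ->
    forall (c X t : nat), (1 <= c)%N -> (0 < X)%N -> (0 < t)%N ->
    (t ^ (77 * n0) <= X)%N -> (X <= (2 * t) ^ (77 * n0))%N ->
    nc (\sum_(1 <= n < X.+1) (von_mangoldt R n)%:C * lambda chi k (c * n))
    <= K * (c * d * (`|k| + 1))%:R * t%:R ^+ (76 * n0).
Proof.
move=> n0_ge; have n00 : (0 < n0)%N by apply: leq_trans n0_ge.
have [C C0 HC] : exists2 C : nat, (0 < C)%N &
    forall z : gaussInt, z != 0 -> (gdivcount z ^ (40 * n0) <= C * gsqn z)%N.
  by apply: gdivcount_poly; rewrite muln_gt0.
have [t0 Ht0] : exists t0 : nat, forall t, (t0 <= t)%N ->
    forall z : gaussInt, z != 0 -> (gsqn z <= t ^ (1000 * n0))%N -> (2 * gdivcount z <= t ^ 2)%N.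
  by apply: gdivcount_le_sqr; rewrite muln_gt0.
(* One threshold for the divisor bound, the factor 2 in [X <= (2 * t) ^ (77 * n0)], and the
   logarithms; below it [X] is bounded by [B]. *)
pose t1 := (t0 + 2 ^ (77 * n0) + 700 * n0)%N.
pose B := ((2 * t1) ^ (77 * n0))%N.
pose K1 : R := (B * (B * (C * B)))%:R.
pose K2 : R := (2 ^ (77 * n0) * (154 * n0) * (C * 2 ^ (154 * n0)))%:R.
pose K3 : R := 801 * (2 ^ (77 * n0))%:R.
have K10 : 0 <= K1 by rewrite /K1.
have K20 : 0 <= K2 by rewrite /K2.
have K30 : 0 <= K3 by rewrite /K3 mulr_ge0.
exists (K1 + K2 + K3); first by rewrite !addr_ge0.
move=> d k chi d0 hchi c X t c0 X0 tp tX Xt.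
set S := nc _; set F := (c * d * (`|k| + 1))%N.
have F1 : 1 <= F%:R :> R by rewrite ler1n !muln_gt0 c0 d0 addn1.
have F0 : 0 <= F%:R :> R by rewrite ler0n.
have P0 : 0 <= t%:R ^+ (76 * n0) :> R by rewrite exprn_ge0.
have step (a b : R) : 0 <= a -> a <= b -> S <= a * F%:R * t%:R ^+ (76 * n0) -> S <= b * F%:R * t%:R ^+ (76 * n0).
  by move=> a0 ab h; apply: le_trans h _; apply: ler_wpM2r => //; apply: ler_wpM2r.
have [tt|tt] := ltnP t t1.
  apply: (step K1) => //; first by move: K10 K20 K30; lra.
  apply: (@bounded_range_bound R chi k d c X d0 hchi c0 X0 n0 t n0_ge tp C B C0 HC).
  by apply: leq_trans Xt _; rewrite leq_exp2r ?muln_gt0 // leq_mul2l ltnW // orbT.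
have [Fs|Fb] := leqP (t ^ (n0 + 5)) F.
  apply: (step K2) => //; first by move: K10 K20 K30; lra.
  exact: (@large_parameters_bound R chi k d c X d0 hchi c0 X0 n0 t n0_ge tp tX Xt C C0 HC Fs).
apply: (step K3) => //; first by move: K10 K20 K30; lra.
apply: (@le_trans _ _ (K3 * t%:R ^+ (76 * n0))); last first.
  by apply: ler_wpM2r => //; rewrite -[leLHS]mulr1; apply: ler_wpM2l.
apply: (@small_parameters_bound R chi k d c X d0 hchi c0 X0 n0 t n0_ge tp tX Xt).
- by apply: leq_trans tt; rewrite /t1 addnAC leq_addl.
- by apply: leq_trans tt; rewrite /t1 leq_addl.
- exact: ltnW.
by apply: Ht0; apply: leq_trans tt; rewrite /t1 -addnA leq_addr.
Qed.

End Main.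

Unset Implicit Arguments.

Theorem mainTheorem3 (R : realType) :
  exists K : R, forall (d : nat) (k : int) (chi : gaussInt -> R[i]),
    (1 <= d)%N -> gauss_character (4 * d)%:R chi ->
    forall (c : nat) (x : R), (1 <= c)%N -> 2 <= x ->
      `| \sum_(1 <= n < (Num.truncn x).+1)
           (von_mangoldt R n)%:C * lambda chi k (c * n) |
      <= (K * c%:R * (d * (`|k| + 1))%:R * x `^ (76 / 77))%:C.
Proof.
(* Any larger value would do as well; it is kept abstract so that powers such as [2 ^ (77 * n0)]
   remain symbolic. *)
have [n0 n0_ge] : exists n0, (500 <= n0)%N by exists 500%N.
have n00 : (0 < n0)%N by apply: leq_trans n0_ge.
have [K K0 HK] := @prime_sum_uniform R n0 n0_ge.
exists K => d k chi d0 hchi c x c0 x2.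
have x0 : 0 <= x by apply: le_trans x2.
set X := Num.truncn x.
have Xx : X%:R <= x by rewrite truncn_le.
have X0 : (0 < X)%N by rewrite truncn_gt0 (le_trans _ x2) // ler1n.
have N0 : (0 < 77 * n0)%N by rewrite muln_gt0.
have [t [t1 tX Xt]] := @root_range (77 * n0) X N0 X0.
rewrite normcE lecR.
apply: le_trans (HK d k chi d0 hchi c X t c0 X0 t1 tX Xt) _.
rewrite -mulnA natrM mulrA; apply: ler_wpM2l.
  by rewrite !mulr_ge0.
apply: powR_range => //; apply: le_trans Xx; by rewrite ler_nat.
Qed.
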